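(* Let $m\le n$ be positive integers with $mn>6$, and consider the set $\mathcal{E}$ of all normalized (trace-one) nondecomposable entanglement witnesses $W$ on $\mathbb{C}^m\otimes\mathbb{C}^n$, with eigenvalues $\lambda_1(W)\ge\cdots\ge\lambda_{mn}(W)$. Then: (i) $\sup_{W\in\mathcal{E}}\operatorname{tr}(W^2)=1$. (ii) $\inf_{W\in\mathcal{E}}\operatorname{tr}(W^2)$ is not attained by any $W\in\mathcal{E}$. (iii) $\sup_{W\in\mathcal{E}}\lambda_{mn}(W)=0$ and it is not attained. (iv) $\inf_{W\in\mathcal{E}}\lambda_{mn}(W)=-\frac12$ and it is not attained. (v) $\sup_{W\in\mathcal{E}}\lambda_1(W)=1$ and it is not attained. (vi) $\inf_{W\in\mathcal{E}}\lambda_1(W)$ is not attained. (vii) If $m=2$, or if $m=n\ge3$, then $\sup_{W\in\mathcal{E}}\mathcal{N}(W)=\frac{m-1}{2}$. (viii) If $m=n=3$, then $\sup_{W\in\mathcal{E}}\mathcal{N}(W)$ is not attained. (ix) $\inf_{W\in\mathcal{E}}\mathcal{N}(W)=0$ and it is not attained.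
   Context: For $M\in M_m(\mathbb{C})\otimes M_n(\mathbb{C})$, the partial transpose is $M^\Gamma:=(T\otimes \mathrm{id})(M)$, where $T$ is the transpose on the first factor. A Hermitian $W\in M_m(\mathbb{C})\otimes M_n(\mathbb{C})$ is block-positive if $\langle a,b|W|a,b\rangle\ge0$ for all $|a\rangle\in\mathbb{C}^m,|b\rangle\in\mathbb{C}^n$; it is an entanglement witness (EW) if it is block-positive and has at least one negative eigenvalue. An EW is decomposable if $W=P+Q^\Gamma$ for some positive semidefinite $P,Q$, and nondecomposable otherwise. Normalized means $\operatorname{tr}W=1$. Eigenvalues are listed in non-increasing order. For Hermitian trace-one $M$, $\mathcal{N}(M):=\frac{\|M\|_1-1}{2}$, the absolute value of the sum of the negative eigenvalues of $M$.
   Formalization: The case m = 1 is excluded (m ≥ 2 is assumed): for m = 1 every block-positive matrix is positive semidefinite, so the set of nondecomposable entanglement witnesses is empty and the claimed suprema and infima fail. *)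

(* Defs.v *)
From mathcomp Require Import all_boot all_order all_algebra.
From mathcomp Require Import reals complex.
Set Implicit Arguments.
Unset Strict Implicit.
Unset Printing Implicit Defensive.
Import Order.TTheory GRing.Theory Num.Theory.
Local Open Scope ring_scope.
Local Open Scope complex_scope.

Section EW.
Variables (R : realType) (m n : nat).
Local Notation C := R[i].

(* index of C^m (x) C^n = C^(m*n) as a pair (i, j) *)
Definition idx (p : 'I_(m * n)) : 'I_m * 'I_n :=
  enum_val (cast_ord (esym (mxvec_cast m n)) p).

Definition adjmx (k l : nat) (M : 'M[C]_(k, l)) : 'M[C]_(l, k) :=
  (map_mx Num.conj M)^T.

Definition hermitian (M : 'M[C]_(m * n)) : Prop := adjmx M = M.

Definition ptrans (M : 'M[C]_(m * n)) : 'M[C]_(m * n) :=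
  \matrix_(p, q) M (mxvec_index (idx q).1 (idx p).2)
                   (mxvec_index (idx p).1 (idx q).2).

Definition prodvec (a : 'cV[C]_m) (b : 'cV[C]_n) : 'cV[C]_(m * n) :=
  \col_p (a (idx p).1 0 * b (idx p).2 0).

Definition psdmx (P : 'M[C]_(m * n)) : Prop :=
  hermitian P /\ forall v : 'cV[C]_(m * n), 0 <= (adjmx v *m P *m v) 0 0.

Definition block_positive (W : 'M[C]_(m * n)) : Prop :=
  hermitian W /\
  forall (a : 'cV[C]_m) (b : 'cV[C]_n),
    0 <= (adjmx (prodvec a b) *m W *m prodvec a b) 0 0.

Definition ent_witness (W : 'M[C]_(m * n)) : Prop :=
  block_positive W /\ exists a : C, a < 0 /\ eigenvalue W a.

Definition decomposable (W : 'M[C]_(m * n)) : Prop :=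
  exists P Q : 'M[C]_(m * n), [/\ psdmx P, psdmx Q & W = P + ptrans Q].

Definition normalized_NDEW (W : 'M[C]_(m * n)) : Prop :=
  [/\ ent_witness W, ~ decomposable W & \tr W = 1].

Definition spectrum (W : 'M[C]_(m * n)) (s : seq R) : Prop :=
  sorted (fun x y : R => y <= x) s /\
  char_poly W = \prod_(x <- s) ('X - (x%:C)%:P).

Definition negativity (s : seq R) : R := - \sum_(x <- s | x < 0) x.

Definition trsq_set : R -> Prop :=
  fun x => exists W, normalized_NDEW W /\ x%:C = \tr (W *m W).
Definition lmin_set : R -> Prop :=
  fun x => exists W s, [/\ normalized_NDEW W, spectrum W s & x = nth 0 s (m * n).-1].
Definition lmax_set : R -> Prop :=
  fun x => exists W s, [/\ normalized_NDEW W, spectrum W s & x = nth 0 s 0].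
Definition negativity_set : R -> Prop :=
  fun x => exists W s, [/\ normalized_NDEW W, spectrum W s & x = negativity s].

End EW.

Definition is_sup (R : realType) (S : R -> Prop) (x : R) : Prop :=
  (forall y, S y -> y <= x) /\ (forall z, (forall y, S y -> y <= z) -> x <= z).
Definition is_inf (R : realType) (S : R -> Prop) (x : R) : Prop :=
  (forall y, S y -> x <= y) /\ (forall z, (forall y, S y -> z <= y) -> z <= x).

Arguments trsq_set : clear implicits.
Arguments lmin_set : clear implicits.
Arguments lmax_set : clear implicits.
Arguments negativity_set : clear implicits.

(* Main.v *)
(* Write a witness W as an m x m matrix of blocks W_ij. Block positivity gives
   |<v|W_ij|v>|^2 <= <v|W_ii|v> <v|W_jj|v>, hence, by diagonalizing unitaries,
   |tr (W_ij X)|^2 <= tr W_ii tr W_jj for every compression X of a unitary. With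
   the singular value decomposition this yields tr W^2 <= (tr W)^2, and, applied
   to the sign of W, the trace norm bound ||W||_1 <= m tr W. For the smallest
   eigenvalue, take a unit vector with Schmidt form sum_k s_k |kk> and average
   over phases the product vectors with coordinates sqrt (s_k) th_k and
   sqrt (s_k) conj (th_k): this gives
   <v|W|v> >= - sum_(k <> l) s_k s_l <kl|W|kl> >= - 1/2.
   In the equality cases of the bounds -1/2 and ||W||_1 = m (for m = n) the
   partial transpose of W turns out to be positive, so W is decomposable.

   A nondecomposable witness exists by the examples of Choi (3 x 3) and Horodecki
   (2 x 4). Invertible local filters deform it to a product projector, which gives
   the values 1, 0, 1, 0 in (i), (iii), (v), (ix). Adding a small multiple of it to
   the partial transpose of a maximally entangled projector in the kernel of the
   detecting state gives -1/2 and (m - 1)/2. Finally, decomposable matrices form a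
   closed cone, so a little white noise preserves nondecomposability while it
   decreases tr W^2 and the largest eigenvalue: the infima are not attained. *)
Require Import Defs.
From mathcomp Require Import all_boot all_order all_algebra.
From mathcomp Require Import reals complex.
From mathcomp Require Import perm spectral ring lra.
Set Implicit Arguments.
Unset Strict Implicit.
Unset Printing Implicit Defensive.
Import Order.TTheory GRing.Theory Num.Theory.
Local Open Scope ring_scope.

(** * Unitary matrices and the Russo-Dye bound *)

Section Unitary.
Variable C : numClosedFieldType.
Local Open Scope sesquilinear_scope.

(** Block positivity only sees forms <v|W_ij|v> with the same vector on both sides, and polarizing
    them would lose a constant. Pairing W_ij with a unitary keeps the sharp constant: a unitary is
    diagonal in an orthonormal basis, so only such forms occur. In the bound on the smallest
    eigenvalue, the phases on the second factor are conjugate to those on the first so that, besides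
    diagonal terms, exactly the entries of W between |ii> and |jj> survive the average. The partial
    transpose used for -1/2 and (m - 1)/2 is itself decomposable, but it lies on a face of the
    decomposable cone where some PPT state vanishes; any positive multiple of a witness detected by
    that state then leaves the cone. Hence each explicit witness comes with its detecting state and
    with a vector in the kernel of that state, of Schmidt rank 2 for -1/2 and n for (n - 1)/2.
    Non-attainment has three sources: classified equality cases, the mere presence of a negative
    eigenvalue, and the openness of nondecomposability. *)

Lemma cauchy_schwarz_sum (I : finType) (a b c : I -> C) :
  (forall k, 0 <= a k) -> (forall k, 0 <= b k) -> (forall k, 0 <= c k) ->
  (forall k, b k ^+ 2 <= a k * c k) ->
  (\sum_k b k) ^+ 2 <= (\sum_k a k) * (\sum_k c k).
Proof.
move=> a0 b0 c0 bac.
(* Symmetrizing in the two indices reduces the claim to AM-GM for a_k c_l and a_l c_k, without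
   square roots. *)
have key k l : b k * b l *+ 2 <= a k * c l + a l * c k.
  have x0 : 0 <= a k * c l by rewrite mulr_ge0.
  have y0 : 0 <= a l * c k by rewrite mulr_ge0.
  have bb0 : 0 <= b k * b l by rewrite mulr_ge0.
  rewrite -(@ler_pXn2r _ 2) ?nnegrE ?addr_ge0 ?mulrn_wge0 //.
  apply: (@le_trans _ _ ((a k * c l) * (a l * c k) *+ 4)).
    rewrite exprMn_n lerMn2r /=.
    have -> : a k * c l * (a l * c k) = (a k * c k) * (a l * c l) by ring.
    by rewrite exprMn ler_pM ?exprn_ge0.
  set x := a k * c l in x0 *; set y := a l * c k in y0 *.
  rewrite -subr_ge0 [X in 0 <= X](_ : _ = (x - y) ^+ 2); last by ring.
  by rewrite real_exprn_even_ge0 // rpredB ?ger0_real.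
rewrite -(@ler_pMn2r _ 2) //.
have -> : ((\sum_k a k) * (\sum_k c k)) *+ 2 =
    \sum_k \sum_l (a k * c l + a l * c k).
  under [RHS]eq_bigr do rewrite big_split /=.
  rewrite big_split /= mulr2n; congr (_ + _).
    by rewrite mulr_suml; apply: eq_bigr => k _; rewrite mulr_sumr.
  rewrite exchange_big mulr_suml; apply: eq_bigr => k _.
  by rewrite mulr_sumr.
rewrite expr2 mulr_suml -sumrMnl; apply: ler_sum => k _.
by rewrite mulr_sumr -sumrMnl; apply: ler_sum.
Qed.

(** Vectors are plain functions on the index set, so that product, compressed and Schmidt vectors
    need no column matrices. *)
Definition sesq n (B : 'M[C]_n) (u v : 'I_n -> C) :=
  \sum_k \sum_l (u k)^* * B k l * v l.

Lemma unitary_rowE n (V : 'M[C]_n) i j : V \is unitarymx ->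
  \sum_k V i k * (V j k)^* = (i == j)%:R.
Proof.
move=> /unitarymxP /matrixP /(_ i j); rewrite !mxE => <-.
by apply: eq_bigr => k _; rewrite !mxE.
Qed.

Lemma unitary_colE n (V : 'M[C]_n) i j : V \is unitarymx ->
  \sum_k (V k i)^* * V k j = (i == j)%:R.
Proof.
move=> uV; have := uV; rewrite -trmxC_unitary => uV'; rewrite -(unitary_rowE i j uV').
by apply: eq_bigr => k _; rewrite !mxE conjCK.
Qed.

Lemma normal_spectralP n (M : 'M[C]_n) : M \is normalmx ->
  exists (V : 'M[C]_n) (d : 'rV[C]_n), V \is unitarymx /\ M = V^t* *m diag_mx d *m V.
Proof.
move=> /orthomx_spectralP eM; exists (spectralmx M), (spectral_diag M).
by rewrite spectral_unitarymx -invmx_unitary ?spectral_unitarymx.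
Qed.

Lemma conj_diagE n (V : 'M[C]_n) d i j :
  (V^t* *m diag_mx d *m V) i j = \sum_k (V k i)^* * d 0 k * V k j.
Proof.
rewrite mxE; apply: eq_bigr => k _; rewrite mxE; congr (_ * _).
rewrite (bigD1 k) //= big1 ?addr0 => [|l lk]; first by rewrite !mxE eqxx mulr1n.
by rewrite !mxE (negbTE lk) mulr0n mulr0.
Qed.

Lemma unitary_normal n (T : 'M[C]_n) : T \is unitarymx -> T \is normalmx.
Proof.
move=> uT; apply/normalmxP; rewrite (unitarymxP uT).
by have := uT; rewrite -trmxC_unitary => /unitarymxP; rewrite trmxCK.
Qed.

Lemma unitary_diag_norm n (V : 'M[C]_n) d k : V \is unitarymx ->
  V^t* *m diag_mx d *m V \is unitarymx -> `|d 0 k| = 1.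
Proof.
move=> uV uT.
have uV' : V^t* \is unitarymx by rewrite trmxC_unitary.
have uD : diag_mx d \is unitarymx.
  have -> : diag_mx d = V *m (V^t* *m diag_mx d *m V) *m V^t*.
    by rewrite !mulmxA (unitarymxP uV) mul1mx mulmxtVK.
  by apply: mul_unitarymx => //; apply: mul_unitarymx.
have := unitary_rowE k k uD; rewrite eqxx (bigD1 k) //= big1 => [|l lk]; last first.
  by rewrite !mxE eq_sym (negbTE lk) mulr0n mul0r.
by rewrite !mxE eqxx !mulr1n addr0 -normCK => /eqP; rewrite sqrp_eq1 // => /eqP.
Qed.

(* A compression of a unitary is a sum of multiples, by phases, of projectors
   on the compressed eigenvectors; this is the Russo-Dye argument. *)
Lemma compressed_unitary_bound n N (f : 'I_n -> 'I_N) (T : 'M[C]_N)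
    (A B D : 'M[C]_n) :
  injective f -> T \is unitarymx ->
  (forall v, 0 <= sesq A v v) -> (forall v, 0 <= sesq D v v) ->
  (forall v, `|sesq B v v| ^+ 2 <= sesq A v v * sesq D v v) ->
  `|\sum_k \sum_l B k l * T (f l) (f k)| ^+ 2 <= \tr A * \tr D.
Proof.
move=> injf uT A0 D0 BAD.
have [V [d [uV eT]]] := normal_spectralP (unitary_normal uT).
pose w k : 'I_n -> C := fun l => (V k (f l))^*.
(* The compressed eigenvectors are no longer orthogonal, but their projectors still resolve the
   identity, so the forms add up to the trace. *)
have sumw (M : 'M[C]_n) : \sum_k sesq M (w k) (w k) = \tr M.
  rewrite /sesq exchange_big; apply: eq_bigr => i _ /=.
  rewrite exchange_big (bigD1 i) //= [X in _ + X]big1 ?addr0 => [|j ji].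
    rewrite (eq_bigr (fun k => (V k (f i))^* * V k (f i) * M i i)).
      by rewrite -mulr_suml unitary_colE // eqxx mul1r.
    by move=> k _; rewrite /w conjCK mulrC mulrA.
  rewrite (eq_bigr (fun k => (V k (f j))^* * V k (f i) * M i j)).
    by rewrite -mulr_suml unitary_colE // (inj_eq injf) (negbTE ji) mul0r.
  by move=> k _; rewrite /w conjCK mulrC mulrA.
have -> : \sum_k \sum_l B k l * T (f l) (f k) = \sum_c d 0 c * sesq B (w c) (w c).
  under [RHS]eq_bigr => c _ do rewrite /sesq mulr_sumr.
  rewrite [RHS]exchange_big; apply: eq_bigr => k _ /=.
  under [RHS]eq_bigr => c _ do rewrite mulr_sumr.
  rewrite [RHS]exchange_big; apply: eq_bigr => l _ /=.
  rewrite eT conj_diagE mulr_sumr; apply: eq_bigr => c _.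
  by rewrite /w conjCK; ring.
have nd c : `|d 0 c| = 1 by apply: (@unitary_diag_norm _ V) => //; rewrite -eT.
rewrite -(sumw A) -(sumw D).
apply: (@le_trans _ _ ((\sum_c `|sesq B (w c) (w c)|) ^+ 2)).
  rewrite ler_pXn2r ?nnegrE ?sumr_ge0 //.
  by apply: (le_trans (ler_norm_sum _ _ _)); apply: ler_sum => c _; rewrite normrM nd mul1r.
exact: cauchy_schwarz_sum.
Qed.

(** Zero rows are the obstacle to normalizing. By induction on their number, each is replaced by a
    nonzero vector orthogonal to all rows, and its scale in [s] is afterwards set to 0. *)
Lemma orthogonal_rows_normalize n (F : 'M[C]_n) :
  (forall i j, i != j -> \sum_k F i k * (F j k)^* = 0) ->
  exists G (s : 'I_n -> C), [/\ G \is unitarymx, forall i, 0 <= s i &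
    forall i k, F i k = s i * G i k].
Proof.
have [c] := ubnP #|[set i | row i F == 0]|.
elim: c F => // c IH F cF oF.
have [i0 z0|nz] := pickP [pred i | row i F == 0]; last first.
  pose s i := sqrtC (\sum_k F i k * (F i k)^*).
  have ns i : 0 <= \sum_k F i k * (F i k)^*.
    by apply: sumr_ge0 => k _; apply: mul_conjC_ge0.
  have s0 i : s i != 0.
    rewrite sqrtC_eq0; apply/negP => /eqP e0; have /negP := nz i; apply.
    apply/eqP/rowP => k; rewrite !mxE.
    have /eqP := e0; rewrite psumr_eq0 => [/allP/(_ k)|l _]; last exact: mul_conjC_ge0.
    by rewrite mem_index_enum mul_conjC_eq0 => /(_ isT) /eqP.
  exists (\matrix_(i, k) (F i k / s i)), s; split.
  - apply/unitarymxP/matrixP => i j; rewrite !mxE.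
    have sr x : (s x)^* = s x by rewrite conj_Creal // ger0_real // sqrtC_ge0.
    transitivity ((\sum_k F i k * (F j k)^*) / (s i * s j)).
      rewrite mulr_suml; apply: eq_bigr => k _.
      by rewrite !mxE rmorphM /= fmorphV /= sr mulrACA -invfM.
    have [<-|ij] := eqVneq i j; last by rewrite oF // mul0r.
    have <- : s i * s i = \sum_k F i k * (F i k)^* by rewrite -expr2 sqrtCK.
    by rewrite mulfV // mulf_neq0.
  - by move=> i; rewrite sqrtC_ge0.
  - by move=> i k; rewrite !mxE mulrC mulfVK.
(* A zero row makes [F] singular, so some nonzero vector is orthogonal to every row. *)
have : kermx (F^t*) != 0.
  rewrite kermx_eq0 -row_leq_rank -ltnNge mxrank_map mxrank_tr.
  rewrite ltn_neqAle rank_leq_row andbT; apply/negP => /row_freeP [F' FF'].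
  have /rowP /(_ i0) : row i0 (F *m F') = row i0 1%:M by rewrite FF'.
  by rewrite row_mul (eqP z0) mul0mx !mxE eqxx => /eqP; rewrite eq_sym oner_eq0.
case/rowV0Pn => u uF u0; have {}uF : u *m F^t* = 0 by apply/sub_kermxP.
have ou j : \sum_k u 0 k * (F j k)^* = 0.
  move/rowP: uF => /(_ j); rewrite !mxE => e; rewrite -[RHS]e.
  by apply: eq_bigr => k _; rewrite !mxE.
pose F' := \matrix_(i, k) (if i == i0 then u 0 k else F i k).
have [||G [s [uG s0 e]]] := IH F'.
- rewrite -ltnS (leq_trans _ cF) // ltnS; apply: proper_card.
  rewrite properE; apply/andP; split.
    apply/subsetP => i; rewrite !inE => /eqP/rowP iz; apply/eqP/rowP => k.
    have := iz k; rewrite !mxE; case: eqP => // -> _.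
    by have /eqP/rowP/(_ k) := z0; rewrite !mxE.
  apply/subsetPn; exists i0; rewrite !inE //.
  apply: contra u0 => /eqP /rowP iz; apply/eqP/rowP => k.
  by have := iz k; rewrite !mxE eqxx.
- move=> i j ij; under eq_bigr do rewrite !mxE.
  have [ii0|ni] := eqVneq i i0; have [jj0|nj] := eqVneq j i0.
  + by rewrite ii0 jj0 eqxx in ij.
  + exact: ou.
  + have /(congr1 Num.conj) := ou i; rewrite conjC0 rmorph_sum => e.
    rewrite -[RHS]e; apply: eq_bigr => k _.
    by rewrite rmorphM /= conjCK mulrC.
  + exact: oF.
exists G, (fun i => if i == i0 then 0 else s i); split => //.
  by move=> i; case: ifP.
move=> i k; have := e i k; rewrite !mxE; case: eqP => // -> _.
by have /eqP/rowP/(_ k) := z0; rewrite !mxE mul0r.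
Qed.

(** Diagonalizing M times its adjoint makes the rows of V M orthogonal; padded with zero rows to a
    square matrix, they normalize to a unitary. The singular values are left unsorted. *)
Lemma svd m n (M : 'M[C]_(m, n)) : (m <= n)%N ->
  exists (A : 'M[C]_m) (G : 'M[C]_n) (s : 'I_m -> C),
  [/\ A \is unitarymx, G \is unitarymx, forall i, 0 <= s i &
      M = A *m (\matrix_(i, k) (s i *+ (i == k :> nat))) *m G].
Proof.
move=> mn.
have hH : M *m M^t* \is normalmx.
  by apply/normalmxP; rewrite trmx_mul map_mxM trmxCK.
have [V [d [uV eM]]] := normal_spectralP hH.
have [R eR] : exists R, R = V *m M by exists (V *m M).
have RR : R *m R^t* = diag_mx d.
  rewrite eR trmx_mul map_mxM mulmxA -(mulmxA V) eM !mulmxA (unitarymxP uV) mul1mx.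
  by rewrite mulmxtVK.
pose F : 'M[C]_n := \matrix_(i, k) (if insub (val i) is Some j then R j k else 0).
have [|G [s [uG s0 eF]]] := @orthogonal_rows_normalize _ F.
  move=> i j ij; under eq_bigr do rewrite !mxE.
  case: insubP => [i' _ ei|_]; last by rewrite big1 // => k _; rewrite mul0r.
  case: insubP => [j' _ ej|_]; last by rewrite big1 // => k _; rewrite conjC0 mulr0.
  move/matrixP: RR => /(_ i' j'); rewrite !mxE.
  have -> : i' == j' = false by rewrite -val_eqE /= ei ej; apply/negbTE.
  rewrite mulr0n => e; rewrite -[RHS]e; apply: eq_bigr => k _; by rewrite !mxE.
exists (V^t*), G, (fun i => s (widen_ord mn i)); split => //.
  by rewrite trmxC_unitary.
have -> : M = V^t* *m R.
  have := uV; rewrite -trmxC_unitary => /unitarymxP; rewrite trmxCK => e.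
  by rewrite eR mulmxA e mul1mx.
rewrite -mulmxA; congr (_ *m _); apply/matrixP => i k; rewrite [RHS]mxE.
rewrite (bigD1 (widen_ord mn i)) //= big1 ?addr0 => [|l li]; last first.
  rewrite !mxE; case: eqP => [e|_]; last by rewrite mulr0n mul0r.
  by case/eqP: li; apply: val_inj.
rewrite mxE eqxx mulr1n -eF mxE; case: insubP => [j _ ej|]; last first.
  by rewrite /= ltn_ord.
by congr (R _ _); apply: val_inj; rewrite ej.
Qed.

(** The unitary that undoes both singular bases pairs with B to the sum of the singular values, and
    that sum squared dominates the sum of their squares. *)
Lemma frobenius_block_bound n (A B D : 'M[C]_n) :
  (forall v, 0 <= sesq A v v) -> (forall v, 0 <= sesq D v v) ->
  (forall v, `|sesq B v v| ^+ 2 <= sesq A v v * sesq D v v) ->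
  \sum_k \sum_l `|B k l| ^+ 2 <= \tr A * \tr D.
Proof.
move=> A0 D0 BAD.
have [U [G [s [uU uG s0 eB]]]] := svd B (leqnn n).
have {}eB : B = U *m diag_mx (\row_i s i) *m G.
  rewrite eB; congr (_ *m _ *m _); apply/matrixP => i k.
  by rewrite !mxE -val_eqE.
have sr i : (s i)^* = s i by rewrite conj_Creal // ger0_real.
have uT : G^t* *m U^t* \is unitarymx by rewrite mul_unitarymx ?trmxC_unitary.
have trBT : \sum_k \sum_l B k l * (G^t* *m U^t*) l k = \sum_i s i.
  transitivity (\tr (B *m (G^t* *m U^t*))).
    by rewrite /mxtrace; apply: eq_bigr => k _; rewrite [RHS]mxE.
  rewrite eB !mulmxA mulmxtVK // -mulmxA mxtrace_mulC -mulmxA.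
  have := uU; rewrite -trmxC_unitary => /unitarymxP; rewrite trmxCK => ->.
  by rewrite mulmx1 mxtrace_diag; apply: eq_bigr => i _; rewrite mxE.
have trBB : \sum_k \sum_l `|B k l| ^+ 2 = \sum_i s i ^+ 2.
  transitivity (\tr (B *m B^t*)).
    rewrite /mxtrace; apply: eq_bigr => k _; rewrite [RHS]mxE; apply: eq_bigr => l _.
    by rewrite !mxE normCK.
  rewrite eB trmx_mul map_mxM !mulmxA mulmxtVK // trmx_mul map_mxM !mulmxA.
  rewrite mxtrace_mulC !mulmxA.
  have := uU; rewrite -trmxC_unitary => /unitarymxP; rewrite trmxCK => ->.
  rewrite mul1mx tr_diag_mx map_diag_mx mulmx_diag mxtrace_diag.
  by apply: eq_bigr => i _; rewrite !mxE /= sr expr2.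
have := compressed_unitary_bound (@inj_id _) uT A0 D0 BAD.
rewrite /= trBT trBB ger0_norm ?sumr_ge0 //; apply: le_trans.
rewrite expr2 mulr_suml; apply: ler_sum => i _.
by rewrite expr2 ler_wpM2l // (bigD1 i) //= lerDl sumr_ge0.
Qed.

End Unitary.

(** * Block-positive matrices *)

Section Indexing.
Variables (R : realType) (m n : nat).
Local Notation C := R[i].
Local Notation ix := (@mxvec_index m n).

Lemma idxE i k : idx (ix i k) = (i, k).
Proof. by rewrite /idx /mxvec_index cast_ordK enum_rankK. Qed.

Lemma ixE p : ix (idx p).1 (idx p).2 = p.
Proof. by rewrite /idx /mxvec_index -surjective_pairing enum_valK cast_ordKV. Qed.

Lemma ix_inj i k j l : (ix i k == ix j l) = (i == j) && (k == l).
Proof.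
apply/eqP/andP => [/(congr1 (@idx m n))|[/eqP-> /eqP->] //].
by rewrite !idxE => -[-> ->].
Qed.

Lemma sum_ix (V : nmodType) (F : 'I_(m * n) -> V) :
  \sum_p F p = \sum_i \sum_k F (ix i k).
Proof.
rewrite pair_big /= (reindex (fun q : 'I_m * 'I_n => ix q.1 q.2)) //.
by exists (@idx m n) => [[i k] _|p _]; rewrite ?idxE ?ixE.
Qed.

Lemma matrix_ixP (W W' : 'M[C]_(m * n)) :
  (forall i k j l, W (ix i k) (ix j l) = W' (ix i k) (ix j l)) -> W = W'.
Proof. by move=> e; apply/matrixP => p q; rewrite -(ixE p) -(ixE q). Qed.

Lemma ptransE (W : 'M[C]_(m * n)) i k j l :
  ptrans W (ix i k) (ix j l) = W (ix j k) (ix i l).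
Proof. by rewrite mxE !idxE. Qed.

Lemma hermitianP (W : 'M[C]_(m * n)) :
  Defs.hermitian W <-> forall p q, (W q p)^* = W p q.
Proof.
split=> [/matrixP e p q|e]; first by rewrite -[RHS]e !mxE.
by apply/matrixP => p q; rewrite !mxE.
Qed.

Lemma adj_sesq N (W : 'M[C]_N) (v : 'cV[C]_N) :
  (adjmx v *m W *m v) 0 0 = sesq W (fun p => v p 0) (fun p => v p 0).
Proof.
rewrite mxE /sesq exchange_big; apply: eq_bigr => q _ /=.
by rewrite mxE mulr_suml; apply: eq_bigr => p _; rewrite !mxE.
Qed.

Lemma psdP (W : 'M[C]_(m * n)) : psdmx W <->
  (forall p q, (W q p)^* = W p q) /\ (forall v, 0 <= sesq W v v).
Proof.
rewrite /psdmx hermitianP; split=> -[h p]; split=> // v; last by rewrite adj_sesq.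
have := p (\col_q v q); rewrite adj_sesq.
by congr (0 <= _); apply: eq_bigr => q _; apply: eq_bigr => r _; rewrite !mxE.
Qed.

Definition block (W : 'M[C]_(m * n)) i j : 'M[C]_n :=
  \matrix_(k, l) W (ix i k) (ix j l).

Lemma sesq_prod (W : 'M[C]_(m * n)) (a : 'I_m -> C) (b : 'I_n -> C) :
  sesq W (fun p => a (idx p).1 * b (idx p).2) (fun p => a (idx p).1 * b (idx p).2)
  = \sum_i \sum_j (a i)^* * a j * sesq (block W i j) b b.
Proof.
rewrite /sesq sum_ix; apply: eq_bigr => i _.
under eq_bigr do rewrite sum_ix.
rewrite exchange_big; apply: eq_bigr => j _ /=; rewrite mulr_sumr.
apply: eq_bigr => k _; rewrite mulr_sumr; apply: eq_bigr => l _.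
by rewrite !idxE /= mxE rmorphM /=; ring.
Qed.

Lemma block_positiveP (W : 'M[C]_(m * n)) : block_positive W <->
  (forall p q, (W q p)^* = W p q) /\
  (forall a b, 0 <= \sum_i \sum_j (a i)^* * a j * sesq (block W i j) b b).
Proof.
rewrite /block_positive hermitianP; split=> -[h p]; split=> // a b; last first.
  rewrite adj_sesq.
  have := p (fun i => a i 0) (fun k => b k 0); rewrite -sesq_prod.
  by congr (0 <= _); apply: eq_bigr => q _; apply: eq_bigr => r _; rewrite !mxE.
have := p (\col_i a i) (\col_k b k); rewrite adj_sesq -sesq_prod.
by congr (0 <= _); apply: eq_bigr => q _; apply: eq_bigr => r _; rewrite !mxE.
Qed.

End Indexing.

Lemma two_by_two_psd (C : numClosedFieldType) (al be ga : C) :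
  0 <= al -> 0 <= ga ->
  (forall x y, 0 <= x^* * x * al + x^* * y * be + y^* * x * be^* + y^* * y * ga) ->
  `|be| ^+ 2 <= al * ga.
Proof.
move=> al0 ga0 H; have gr : ga^* = ga by rewrite conj_Creal // ger0_real.
have := ga0; rewrite le0r => /orP[/eqP ga00|gap].
  have [->|b0] := eqVneq be 0; first by rewrite normr0 expr0n mulr_ge0.
  have sp : 0 < (al + 1)^-1 by rewrite invr_gt0 ltr_wpDl.
  (* Any s > 0 with s al < 2 makes the form at (- s be, 1) negative unless be = 0. *)
  set s := (al + 1)^-1 in sp.
  have sr : s^* = s by rewrite conj_Creal // gtr0_real.
  have := H (- (s * be)) 1; rewrite ga00 rmorphN /= rmorphM /= sr conjC1.
  rewrite [X in 0 <= X](_ : _ = be * be^* * s * (s * al - 2)); last by ring.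
  rewrite -normCK pmulr_rge0 ?mulr_gt0 ?exprn_gt0 ?normr_gt0 //.
  rewrite subr_ge0 => h; have : s * al < 2.
    by rewrite /s mulrC ltr_pdivrMr ?ltr_wpDl // mulrDr mulr1 ltr_pwDr // mulr2n mulrDl mul1r lerDl.
  by move/(le_lt_trans h); rewrite ltxx.
(* At the vector (ga, - conj be) the form equals ga times the determinant. *)
have := H ga (- be^*); rewrite rmorphN /= conjCK gr.
rewrite [X in 0 <= X](_ : _ = ga * (al * ga - be * be^*)); last by ring.
by rewrite -normCK pmulr_rge0 // subr_ge0.
Qed.

(** * Trace and Frobenius bounds for blocks *)

Section Blocks.
Variables (R : realType) (m n : nat) (W : 'M[R[i]]_(m * n)).
Local Notation C := R[i].
Local Notation ix := (@mxvec_index m n).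
Hypothesis bpW : block_positive W.

Lemma bp_herm p q : (W q p)^* = W p q.
Proof. by case/block_positiveP: bpW. Qed.

Lemma sesq_block_conj i j b : sesq (block W j i) b b = (sesq (block W i j) b b)^*.
Proof.
rewrite /sesq exchange_big rmorph_sum; apply: eq_bigr => k _ /=.
rewrite rmorph_sum; apply: eq_bigr => l _.
by rewrite !mxE !rmorphM /= conjCK bp_herm; ring.
Qed.

Lemma diag_block_ge0 i b : 0 <= sesq (block W i i) b b.
Proof.
have [_ /(_ (fun j => (j == i)%:R) b)] := (block_positiveP W).1 bpW.
rewrite (bigD1 i) //= (bigD1 i) //= eqxx conjC1 !mul1r.
rewrite big1 => [|j ji]; last by rewrite (negbTE ji) !(mulr0, mul0r).
rewrite addr0 big1 ?addr0 // => j ji; rewrite (negbTE ji) conjC0.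
by apply: big1 => k _; rewrite !mul0r.
Qed.

Lemma block_cs i j b : `|sesq (block W i j) b b| ^+ 2 <=
  sesq (block W i i) b b * sesq (block W j j) b b.
Proof.
have [->|ij] := eqVneq i j.
  by rewrite ger0_norm ?diag_block_ge0 // expr2.
apply: two_by_two_psd; rewrite ?diag_block_ge0 // => x y.
have [_ /(_ (fun l => if l == i then x else if l == j then y else 0) b)] :=
  (block_positiveP W).1 bpW.
have ji : j != i by rewrite eq_sym.
rewrite (bigD1 i) //= (bigD1 i) //= (bigD1 j) //= eqxx (negbTE ji) eqxx.
rewrite [X in _ + (_ + X)]big1 ?addr0 => [|l /andP[/negbTE-> /negbTE->]]; last first.
  by rewrite mulr0 mul0r.
rewrite (bigD1 j) //= (bigD1 i) //= (bigD1 j) //= eqxx (negbTE ji) eqxx.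
rewrite [X in _ + (_ + (_ + X) + _)]big1 ?addr0 => [|l /andP[/negbTE-> /negbTE->]]; last first.
  by rewrite mulr0 mul0r.
rewrite [X in _ + (_ + X)]big1 ?addr0 => [|l /andP[/negbTE-> /negbTE->]]; last first.
  by apply: big1 => k _; rewrite conjC0 !mul0r.
by rewrite (sesq_block_conj i j) addrA.
Qed.

Lemma block_frobenius i j :
  \sum_k \sum_l `|W (ix i k) (ix j l)| ^+ 2 <= \tr (block W i i) * \tr (block W j j).
Proof.
have := frobenius_block_bound (diag_block_ge0 i) (diag_block_ge0 j) (block_cs i j).
by under eq_bigr do under eq_bigr do rewrite mxE.
Qed.

Lemma tr_block i : \tr (block W i i) = \sum_k W (ix i k) (ix i k).
Proof. by apply: eq_bigr => k _; rewrite mxE. Qed.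

Lemma tr_blocks : \tr W = \sum_i \tr (block W i i).
Proof. by rewrite /mxtrace sum_ix; apply: eq_bigr => i _; rewrite -tr_block. Qed.

Lemma diag_ge0 i k : 0 <= W (ix i k) (ix i k).
Proof.
have := diag_block_ge0 i (fun l => (l == k)%:R); rewrite /sesq.
rewrite (bigD1 k) //= (bigD1 k) //= eqxx conjC1 mul1r mulr1 mxE.
rewrite big1 => [|l lk]; last by rewrite (negbTE lk) mulr0.
rewrite big1 ?addr0 // => l lk; rewrite (negbTE lk) conjC0.
by apply: big1 => q _; rewrite !mul0r.
Qed.

Lemma diagp_ge0 p : 0 <= W p p.
Proof. by rewrite -(ixE p) diag_ge0. Qed.

Lemma tr_block_ge0 i : 0 <= \tr (block W i i).
Proof. by rewrite tr_block sumr_ge0 // => k _; apply: diag_ge0. Qed.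

Lemma trsq_normE : \tr (W *m W) = \sum_p \sum_q `|W p q| ^+ 2.
Proof.
apply: eq_bigr => p _; rewrite mxE; apply: eq_bigr => q _.
by rewrite normCK bp_herm.
Qed.

Lemma trsq_blocks : \tr (W *m W) =
  \sum_i \sum_j \sum_k \sum_l `|W (ix i k) (ix j l)| ^+ 2.
Proof.
rewrite trsq_normE sum_ix; apply: eq_bigr => i _.
under eq_bigr do rewrite sum_ix.
by rewrite exchange_big.
Qed.

Lemma trsq_le : \tr (W *m W) <= (\tr W) ^+ 2.
Proof.
rewrite trsq_blocks tr_blocks expr2 mulr_suml; apply: ler_sum => i _.
by rewrite mulr_sumr; apply: ler_sum => j _; apply: block_frobenius.
Qed.

(** [compressed_unitary_bound] compresses rows and columns along the same injection. Exchanging the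
    block columns i and j turns the block (j, i) of a unitary into such a compression of another
    unitary. *)
Definition block_swap i j (q : 'I_(m * n)) := ix (tperm i j (idx q).1) (idx q).2.

Lemma block_swapK i j : involutive (block_swap i j).
Proof. by move=> q; rewrite /block_swap idxE /= tpermK ixE. Qed.

Lemma block_unitary_bound (M : 'M[C]_(m * n)) i j : M \is unitarymx ->
  `|\sum_k \sum_l W (ix i k) (ix j l) * M (ix j l) (ix i k)| ^+ 2 <=
  \tr (block W i i) * \tr (block W j j).
Proof.
move=> uM; pose T := \matrix_(p, q) M p (block_swap i j q).
have uT : T \is unitarymx.
  apply/unitarymxP/matrixP => p q; rewrite !mxE -(unitary_rowE p q uM).
  rewrite [RHS](reindex_inj (can_inj (block_swapK i j))).
  by apply: eq_bigr => r _; rewrite !mxE.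
have injf : injective (ix j) by move=> k l /eqP; rewrite ix_inj eqxx => /eqP.
have := compressed_unitary_bound injf uT (diag_block_ge0 i) (diag_block_ge0 j)
  (block_cs i j).
congr (`|_| ^+ 2 <= _); apply: eq_bigr => k _; apply: eq_bigr => l _.
by rewrite !mxE /block_swap idxE /= tpermR.
Qed.

(** Summing the block bounds gives the square of the sum of sqrt t_i, where t_i is the trace of
    block i; Cauchy-Schwarz against the constant 1 then produces the factor m. *)
Lemma unitary_trace_bound (M : 'M[C]_(m * n)) : M \is unitarymx ->
  `|\tr (W *m M)| <= m%:R * \tr W.
Proof.
move=> uM; pose t i := \tr (block W i i).
have -> : \tr (W *m M) =
    \sum_i \sum_j \sum_k \sum_l W (ix i k) (ix j l) * M (ix j l) (ix i k).
  rewrite /mxtrace sum_ix; apply: eq_bigr => i _; rewrite [RHS]exchange_big.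
  by apply: eq_bigr => k _; rewrite mxE sum_ix.
apply: (@le_trans _ _ ((\sum_i sqrtC (t i)) ^+ 2)).
  apply: (le_trans (ler_norm_sum _ _ _)); rewrite expr2 mulr_suml.
  apply: ler_sum => i _; apply: (le_trans (ler_norm_sum _ _ _)); rewrite mulr_sumr.
  apply: ler_sum => j _.
  rewrite -(@ler_pXn2r _ 2) ?nnegrE ?mulr_ge0 ?sqrtC_ge0 ?tr_block_ge0 //.
  by rewrite exprMn !sqrtCK block_unitary_bound.
rewrite tr_blocks.
have := @cauchy_schwarz_sum C _ (fun=> 1) (fun i => sqrtC (t i)) t.
rewrite sumr_const card_ord; apply => // k; rewrite ?sqrtC_ge0 ?tr_block_ge0 //.
by rewrite sqrtCK mul1r.
Qed.

End Blocks.

(** * Spectra of Hermitian matrices *)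

Section Eigen.
Variables (R : realType) (N : nat).
Local Notation C := R[i].
Local Notation "x %:C" := (real_complex R x).
Local Open Scope sesquilinear_scope.

(** The eigenvectors are the conjugated rows of [V]; the eigenvalues are real by type and come in no
    particular order. *)
Definition eigensystem (W V : 'M[C]_N) (d : 'I_N -> R) :=
  V \is unitarymx /\ W = V^t* *m diag_mx (\row_k (d k)%:C) *m V.

Lemma hermitian_eigensystem (W : 'M[C]_N) :
  (forall p q, (W q p)^* = W p q) -> exists V d, eigensystem W V d.
Proof.
move=> hW; have tW : W^t* = W by apply/matrixP => p q; rewrite !mxE hW.
have nW : W \is normalmx by apply/normalmxP; rewrite tW.
have [V [d [uV eW]]] := normal_spectralP nW.
have dV : diag_mx d = V *m W *m V^t*.
  by rewrite eW !mulmxA (unitarymxP uV) mul1mx mulmxtVK.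
have dr k : (complex.Re (d 0 k))%:C = d 0 k.
  apply: RRe_real; apply/CrealP; have : (diag_mx d)^t* = diag_mx d.
    by rewrite dV trmx_mul map_mxM trmx_mul map_mxM trmxCK tW mulmxA.
  by move/matrixP => /(_ k k); rewrite !mxE eqxx !mulr1n.
exists V, (fun k => complex.Re (d 0 k)); split=> //.
by rewrite {1}eW; congr (_ *m diag_mx _ *m _); apply/rowP => k; rewrite mxE dr.
Qed.

Section Facts.
Variables (W V : 'M[C]_N) (d : 'I_N -> R).
Hypothesis eW : eigensystem W V d.

Lemma eigen_unitary : V \is unitarymx. Proof. by case: eW. Qed.
Lemma eigen_eq : W = V^t* *m diag_mx (\row_k (d k)%:C) *m V. Proof. by case: eW. Qed.

Lemma eigen_diag : V *m W *m V^t* = diag_mx (\row_k (d k)%:C).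
Proof.
by rewrite eigen_eq !mulmxA (unitarymxP eigen_unitary) mul1mx mulmxtVK // eigen_unitary.
Qed.

Lemma adj_unitaryK : V^t* *m V = 1%:M.
Proof.
by have := eigen_unitary; rewrite -trmxC_unitary => /unitarymxP; rewrite trmxCK.
Qed.

Lemma eigen_tr_mul (M : 'M[C]_N) :
  \tr (W *m M) = \sum_k (d k)%:C * (V *m M *m V^t*) k k.
Proof.
rewrite eigen_eq -!mulmxA mxtrace_mulC -!mulmxA [V *m _]mulmxA.
rewrite /mxtrace; apply: eq_bigr => k _; rewrite mul_diag_mx !mxE; congr (_ * _).
Qed.

Lemma eigen_tr : \tr W = (\sum_k d k)%:C.
Proof.
rewrite -[W]mulmx1 eigen_tr_mul mulmx1 (unitarymxP eigen_unitary) rmorph_sum.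
by apply: eq_bigr => k _; rewrite mxE eqxx mulr1.
Qed.

Lemma eigen_trsq : \tr (W *m W) = (\sum_k d k ^+ 2)%:C.
Proof.
rewrite eigen_tr_mul eigen_diag rmorph_sum; apply: eq_bigr => k _.
by rewrite !mxE eqxx mulr1n rmorphXn expr2.
Qed.

Lemma eigen_sesq v : sesq W v v =
  \sum_k (d k)%:C * `|\sum_q V k q * v q| ^+ 2.
Proof.
rewrite eigen_eq /sesq.
under eq_bigr do under eq_bigr do rewrite conj_diagE mulr_sumr mulr_suml.
under eq_bigr do rewrite exchange_big.
rewrite exchange_big; apply: eq_bigr => k _ /=.
rewrite normCK rmorph_sum mulr_suml mulr_sumr exchange_big /=.
apply: eq_bigr => q _; rewrite !mulr_sumr; apply: eq_bigr => p _.
by rewrite !mxE !rmorphM /=; ring.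
Qed.

Lemma eigen_norm (v : 'I_N -> C) :
  \sum_k `|\sum_q V k q * v q| ^+ 2 = \sum_p `|v p| ^+ 2.
Proof.
transitivity (\sum_p \sum_q (\sum_k (V k q)^* * V k p) * (v p * (v q)^*)).
  under [RHS]eq_bigr do under eq_bigr do rewrite mulr_suml.
  under [RHS]eq_bigr do rewrite exchange_big.
  rewrite [RHS]exchange_big; apply: eq_bigr => k _ /=.
  rewrite normCK rmorph_sum mulr_suml; apply: eq_bigr => q _.
  rewrite mulr_sumr; apply: eq_bigr => p _.
  by rewrite !rmorphM /=; ring.
apply: eq_bigr => p _; rewrite (bigD1 p) //= [X in _ + X]big1 ?addr0 => [|q qp].
  by rewrite unitary_colE ?eigen_unitary // eqxx mul1r normCK.
by rewrite unitary_colE ?eigen_unitary // (negbTE qp) mul0r.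
Qed.

Lemma eigen_lower x v : (forall k, x <= d k) ->
  x%:C * \sum_p `|v p| ^+ 2 <= sesq W v v.
Proof.
move=> xd; rewrite eigen_sesq -eigen_norm mulr_sumr; apply: ler_sum => k _.
by rewrite ler_wpM2r ?exprn_ge0 // lecR.
Qed.

Lemma eigen_upper x v : (forall k, d k <= x) ->
  sesq W v v <= x%:C * \sum_p `|v p| ^+ 2.
Proof.
move=> xd; rewrite eigen_sesq -eigen_norm mulr_sumr; apply: ler_sum => k _.
by rewrite ler_wpM2r ?exprn_ge0 // lecR.
Qed.

Lemma eigen_vector k : exists v,
  sesq W v v = (d k)%:C /\ \sum_p `|v p| ^+ 2 = 1.
Proof.
exists (fun q => (V k q)^*); split.
  rewrite eigen_sesq (bigD1 k) //= unitary_rowE ?eigen_unitary // eqxx.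
  rewrite normr1 expr1n mulr1 big1 ?addr0 // => l lk.
  by rewrite unitary_rowE ?eigen_unitary // (negbTE lk) normr0 expr0n mulr0.
have := unitary_rowE k k eigen_unitary; rewrite eqxx => e; rewrite -[RHS]e.
by apply: eq_bigr => p _; rewrite normCK conjCK mulrC.
Qed.

Lemma unitary_diag_le1 (M : 'M[C]_N) k : M \is unitarymx -> `|M k k| <= 1.
Proof.
move=> uM; rewrite -(@ler_pXn2r _ 2) ?nnegrE //.
have := unitary_rowE k k uM; rewrite eqxx => e; rewrite expr1n -[X in _ <= X]e.
rewrite (bigD1 k) //= -normCK lerDl sumr_ge0 // => l _; exact: mul_conjC_ge0.
Qed.

(** In the eigenbasis only the diagonal of the conjugated unitary counts, and its entries have
    modulus at most 1. Together with [eigen_sign] this is the duality between trace norm and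
    unitaries. *)
Lemma eigen_unitary_trace (M : 'M[C]_N) : M \is unitarymx ->
  `|\tr (W *m M)| <= (\sum_k `|d k|)%:C.
Proof.
move=> uM; rewrite eigen_tr_mul rmorph_sum; apply: (le_trans (ler_norm_sum _ _ _)).
apply: ler_sum => k _; rewrite normrM -[X in _ <= X]mulr1; apply: ler_pM => //.
  by rewrite normc_def /= expr0n addr0 sqrtr_sqr.
have uV : V^t* \is unitarymx by rewrite trmxC_unitary eigen_unitary.
exact: (unitary_diag_le1 k (mul_unitarymx (mul_unitarymx eigen_unitary uM) uV)).
Qed.

Lemma eigen_sign : exists2 M : 'M[C]_N, M \is unitarymx &
  \tr (W *m M) = (\sum_k `|d k|)%:C.
Proof.
(* Zero eigenvalues get the sign 1, which keeps the sign matrix unitary. *)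
pose g k : R := if d k < 0 then -1 else 1.
have gg k : g k * g k = 1 by rewrite /g; case: ifP; rewrite ?mulrNN mulr1.
pose G := diag_mx (\row_k (g k)%:C).
have uG : G \is unitarymx.
  apply/unitarymxP/matrixP => p q; rewrite mul_diag_mx !mxE.
  have [->|_] := eqVneq p q; last by rewrite mulr0n conjC0 mulr0.
  by rewrite mulr1n conj_Creal ?complex_real //= -rmorphM gg.
exists (V^t* *m G *m V).
  have uV : V^t* \is unitarymx by rewrite trmxC_unitary eigen_unitary.
  exact: (mul_unitarymx (mul_unitarymx uV uG) eigen_unitary).
clear uG; rewrite eigen_tr_mul !mulmxA (unitarymxP eigen_unitary) mul1mx.
rewrite mulmxtVK ?eigen_unitary // rmorph_sum; apply: eq_bigr => k _.
rewrite !mxE eqxx mulr1n -rmorphM; congr (_ %:C); rewrite /g.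
by case: ltrP => [/ltr0_norm->|/ger0_norm->]; rewrite ?mulrN1 ?mulr1.
Qed.

Lemma eigen_char_poly : char_poly W = \prod_k ('X - ((d k)%:C)%:P).
Proof.
have -> : char_poly W = char_poly (diag_mx (\row_k (d k)%:C)).
  rewrite -eigen_diag /char_poly /char_poly_mx.
  pose f : 'M[C]_N -> 'M[{poly C}]_N := map_mx (@polyC C).
  have -> : 'X%:M - f (V *m W *m V^t*) = f V *m ('X%:M - f W) *m f (V^t*).
    rewrite /f !map_mxM mulmxBr mulmxBl; congr (_ - _).
    rewrite scalar_mxC -mulmxA -map_mxM (unitarymxP eigen_unitary).
    by rewrite map_scalar_mx /= polyC1 mulmx1.
  rewrite !det_mulmx mulrAC -det_mulmx /f -map_mxM (unitarymxP eigen_unitary).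
  by rewrite map_scalar_mx /= polyC1 det1 mul1r.
rewrite char_poly_trig; first by apply: eq_bigr => k _; rewrite !mxE eqxx.
by apply/is_trig_mxP => p q pq; rewrite !mxE -val_eqE /= ltn_eqF.
Qed.

Lemma eigen_square_scalar c : (forall k, d k ^+ 2 = c) -> W *m W = (c%:C)%:M.
Proof.
move=> dc; rewrite eigen_eq; set D := diag_mx _.
have DD : D *m D = (c%:C)%:M.
  rewrite mulmx_diag; apply/matrixP => p q.
  by rewrite !mxE -rmorphM -expr2 dc.
rewrite !mulmxA mulmxtVK ?eigen_unitary // -(mulmxA _ D D) DD scalar_mxC.
by rewrite -mulmxA adj_unitaryK mulmx1.
Qed.

End Facts.
End Eigen.

(** * Sorted spectra against eigensystems *)

Section Spectrum.
Variables (R : realType) (m n : nat).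
Local Notation C := R[i].
Local Notation "x %:C" := (real_complex R x).
Implicit Type W : 'M[C]_(m * n).

Lemma eigen_spectrum W V d : eigensystem W V d ->
  spectrum W (sort (fun x y : R => y <= x) (codom d)).
Proof.
move=> e; split; first by apply: sort_sorted => x y; exact: le_total.
rewrite (eigen_char_poly e) (perm_big _ (permEl (perm_sort _ _))) /=.
by rewrite big_image.
Qed.

(** Unique factorization of the characteristic polynomial. It ties the sorted lists of the statement
    to an arbitrary diagonalization. *)
Lemma spectrum_perm W V d s : eigensystem W V d -> spectrum W s ->
  perm_eq s (codom d).
Proof.
move=> e [_]; rewrite (eigen_char_poly e).
have -> : \prod_k ('X - ((d k)%:C)%:P) =
    \prod_(x <- [seq x%:C | x <- codom d]) ('X - x%:P).
  by rewrite big_map big_image.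
rewrite -(big_map (real_complex R) xpredT (fun z => 'X - z%:P)).
move/prod_XsubC_eq; rewrite perm_sym; apply: perm_map_inj.
exact: complexI.
Qed.

Lemma spectrum_size W V d s : eigensystem W V d -> spectrum W s ->
  size s = (m * n)%N.
Proof. by move=> e /(spectrum_perm e)/perm_size->; rewrite size_codom card_ord. Qed.

Lemma spectrum_nth W V d s i : eigensystem W V d -> spectrum W s ->
  (i < m * n)%N -> exists k, d k = nth 0 s i.
Proof.
move=> e sp iN; have : nth 0 s i \in codom d.
  by rewrite -(perm_mem (spectrum_perm e sp)) mem_nth // (spectrum_size e sp).
by case/codomP => k ->; exists k.
Qed.

Lemma spectrum_min W V d s k : eigensystem W V d -> spectrum W s ->
  nth 0 s (m * n).-1 <= d k.
Proof.
move=> e sp; have : d k \in s by rewrite (perm_mem (spectrum_perm e sp)) codom_f.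
move/(nthP 0) => [i iN <-]; have [srt _] := sp.
have ge_trans : transitive (fun x y : R => y <= x) by move=> x y z /[swap]; exact: le_trans.
have := sorted_leq_nth ge_trans (@lexx _ _) 0 srt; rewrite -(spectrum_size e sp).
apply; rewrite ?inE //; last by rewrite -ltnS prednK // (leq_ltn_trans _ iN).
by rewrite prednK // (leq_ltn_trans _ iN).
Qed.

Lemma spectrum_max W V d s k : eigensystem W V d -> spectrum W s ->
  d k <= nth 0 s 0.
Proof.
move=> e sp; have : d k \in s by rewrite (perm_mem (spectrum_perm e sp)) codom_f.
move/(nthP 0) => [i iN <-]; have [srt _] := sp.
have ge_trans : transitive (fun x y : R => y <= x) by move=> x y z /[swap]; exact: le_trans.
have := sorted_leq_nth ge_trans (@lexx _ _) 0 srt.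
by apply; rewrite ?inE // (leq_ltn_trans _ iN).
Qed.

Lemma spectrum_negativity W V d s : eigensystem W V d -> spectrum W s ->
  negativity s = - \sum_(k | d k < 0) d k.
Proof.
move=> e sp; rewrite /negativity (perm_big _ (spectrum_perm e sp)) /=.
by rewrite big_image_cond.
Qed.

Lemma spectrum_norm1 W V d s : eigensystem W V d -> spectrum W s -> \tr W = 1 ->
  \sum_k `|d k| = 1 + 2 * negativity s.
Proof.
move=> e sp; rewrite (eigen_tr e) => /complexI s1.
rewrite (spectrum_negativity e sp) -{1}s1.
rewrite (bigID (fun k => d k < 0)) [X in X + _ * _](bigID (fun k => d k < 0)) /=.
rewrite (eq_bigr (fun k => - d k)); last by move=> k /ltr0_norm.
rewrite [X in _ + X](eq_bigr (fun k => d k)); last by move=> k; rewrite -leNgt => /ger0_norm.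
by rewrite sumrN; ring.
Qed.

End Spectrum.

(** * Local operations *)

Section Local.
Variables (R : realType) (m n : nat).
Local Notation C := R[i].
Local Notation ix := (@mxvec_index m n).
Local Open Scope sesquilinear_scope.
Implicit Types (A : 'M[C]_m) (B : 'M[C]_n) (W : 'M[C]_(m * n)).

Definition tensor A B : 'M[C]_(m * n) :=
  \matrix_(p, q) (A (idx p).1 (idx q).1 * B (idx p).2 (idx q).2).

Definition local A B W := tensor A B *m W *m (tensor A B)^t*.

Lemma tensorE A B i k j l : tensor A B (ix i k) (ix j l) = A i j * B k l.
Proof. by rewrite mxE !idxE. Qed.

Lemma tensor_mul A B A' B' : tensor A B *m tensor A' B' = tensor (A *m A') (B *m B').
Proof.
apply: matrix_ixP => i k j l; rewrite tensorE !mxE sum_ix mulr_suml.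
apply: eq_bigr => a _; rewrite mulr_sumr; apply: eq_bigr => b _.
by rewrite !tensorE; ring.
Qed.

Lemma tensor1 : tensor 1%:M 1%:M = 1%:M.
Proof.
by apply: matrix_ixP => i k j l; rewrite tensorE !mxE ix_inj -natrM mulnb.
Qed.

Lemma tensor_adj A B : (tensor A B)^t* = tensor (A^t*) (B^t*).
Proof. by apply: matrix_ixP => i k j l; rewrite tensorE !mxE !idxE /= rmorphM. Qed.

Lemma tensor_unitary A B : A \is unitarymx -> B \is unitarymx ->
  tensor A B \is unitarymx.
Proof.
move=> uA uB; apply/unitarymxP.
by rewrite tensor_adj tensor_mul (unitarymxP uA) (unitarymxP uB) tensor1.
Qed.

Lemma localM A B A' B' W : local A B (local A' B' W) = local (A *m A') (B *m B') W.
Proof.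
by rewrite /local !mulmxA tensor_mul -!mulmxA -map_mxM -trmx_mul tensor_mul.
Qed.

Lemma local1 W : local 1%:M 1%:M W = W.
Proof. by rewrite /local tensor1 mul1mx trmx1 map_mx1 mulmx1. Qed.

Lemma local_unitaryK A B W : A \is unitarymx -> B \is unitarymx ->
  local (A^t*) (B^t*) (local A B W) = W.
Proof.
rewrite -trmxC_unitary => /unitarymxP; rewrite trmxCK => uA.
rewrite -trmxC_unitary => /unitarymxP; rewrite trmxCK => uB.
by rewrite localM uA uB local1.
Qed.

Lemma localE A B W i k j l : local A B W (ix i k) (ix j l) =
  \sum_a \sum_b \sum_c \sum_d
    A i a * B k b * W (ix a b) (ix c d) * ((A j c)^* * (B l d)^*).
Proof.
rewrite mxE sum_ix.
transitivity (\sum_c \sum_d \sum_a \sum_b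
    A i a * B k b * W (ix a b) (ix c d) * ((A j c)^* * (B l d)^*)).
  apply: eq_bigr => c _; apply: eq_bigr => d _.
  rewrite !mxE !idxE /= rmorphM sum_ix mulr_suml; apply: eq_bigr => a _.
  by rewrite mulr_suml; apply: eq_bigr => b _; rewrite tensorE.
under eq_bigr do rewrite exchange_big.
rewrite exchange_big; apply: eq_bigr => a _ /=.
under eq_bigr do rewrite exchange_big.
by rewrite exchange_big.
Qed.

Lemma local_sesq A B W v : sesq (local A B W) v v =
  sesq W (fun q => \sum_p (tensor A B p q)^* * v p)
         (fun q => \sum_p (tensor A B p q)^* * v p).
Proof.
rewrite /local; move: (tensor A B) => T.
transitivity (\sum_p \sum_q \sum_r \sum_s
    (v p)^* * (T p r * W r s * (T q s)^*) * v q).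
  apply: eq_bigr => p _; apply: eq_bigr => q _.
  rewrite mxE mulr_sumr mulr_suml exchange_big /=.
  apply: eq_bigr => s _; rewrite !mxE mulr_suml mulr_sumr mulr_suml.
  by apply: eq_bigr.
under eq_bigr do rewrite exchange_big.
rewrite exchange_big; apply: eq_bigr => r _ /=.
under eq_bigr do rewrite exchange_big.
rewrite exchange_big; apply: eq_bigr => s _ /=.
rewrite rmorph_sum !mulr_suml; apply: eq_bigr => p _.
rewrite mulr_sumr; apply: eq_bigr => q _.
by rewrite rmorphM /= conjCK; ring.
Qed.

Lemma local_herm A B W : (forall p q, (W q p)^* = W p q) ->
  forall p q, (local A B W q p)^* = local A B W p q.
Proof.
move=> hW p q; have tW : W^t* = W by apply/matrixP => a b; rewrite !mxE hW.
have : (local A B W)^t* = local A B W.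
  by rewrite /local trmx_mul map_mxM trmxCK trmx_mul map_mxM tW mulmxA.
by move/matrixP/(_ p q); rewrite !mxE.
Qed.

Lemma local_psd A B W : psdmx W -> psdmx (local A B W).
Proof.
move=> /psdP[hW pW]; apply/psdP; split; first exact: local_herm.
by move=> v; rewrite local_sesq.
Qed.

Lemma local_block_positive A B W : block_positive W -> block_positive (local A B W).
Proof.
move=> /block_positiveP[hW pW]; apply/block_positiveP.
split=> [|a b]; first exact: local_herm.
rewrite -sesq_prod local_sesq.
have := pW (fun j => \sum_i (A i j)^* * a i) (fun l => \sum_k (B k l)^* * b k).
rewrite -sesq_prod /sesq.
have e q : \sum_p (tensor A B p q)^* * (a (idx p).1 * b (idx p).2) =
    (\sum_i (A i (idx q).1)^* * a i) * (\sum_k (B k (idx q).2)^* * b k).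
  rewrite sum_ix mulr_suml; apply: eq_bigr => i _; rewrite mulr_sumr.
  by apply: eq_bigr => k _; rewrite mxE !idxE rmorphM /=; ring.
by congr (0 <= _); apply: eq_bigr => p _; apply: eq_bigr => q _; rewrite !e.
Qed.

(** Transposing the first factor replaces a left filter by its complex conjugate; this carries the
    [ptrans] summand of a decomposition through a filter. *)
Lemma local_ptrans A B W :
  local A B (ptrans W) = ptrans (local (map_mx Num.conj A) B W).
Proof.
apply: matrix_ixP => i k j l; rewrite ptransE !localE.
under [RHS]eq_bigr do rewrite exchange_big.
rewrite [RHS]exchange_big /=.
under [RHS]eq_bigr do rewrite exchange_big.
apply: eq_bigr => a _; apply: eq_bigr => b _; apply: eq_bigr => c _.
by apply: eq_bigr => d _; rewrite !mxE !idxE /= conjCK; ring.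
Qed.

Lemma local_decomposable A B W : decomposable W -> decomposable (local A B W).
Proof.
move=> [P [Q [pP pQ ->]]].
exists (local A B P), (local (map_mx Num.conj A) B Q).
split; [exact: local_psd|exact: local_psd|].
by rewrite -local_ptrans /local mulmxDr mulmxDl.
Qed.

End Local.

(** * Averaging over phases *)

Section PhaseAverage.
Variable C : numClosedFieldType.

Lemma sum_fourth_roots (z : C) : z ^+ 4 = 1 -> z != 1 -> \sum_(t < 4) z ^+ t = 0.
Proof.
move=> z4 z1; have z10 : z - 1 != 0 by rewrite subr_eq0.
by apply: (mulfI z10); rewrite -subrX1 z4 subrr mulr0.
Qed.

Lemma i_neq1 : ('i : C) != 1.
Proof.
apply/eqP => e; have := sqrCi C; rewrite e expr1n => /eqP.
by rewrite -subr_eq0 opprK (eqr_nat _ 2 0).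
Qed.

(** Fourth roots of unity stand in for the circle: they already average z, its conjugate and the
    square of the conjugate to 0, and the average is a finite sum. *)
Definition phase (t : 'I_4) : C := 'i ^+ t.

Lemma phase_norm t : (phase t)^* * phase t = 1.
Proof.
by rewrite mulrC -normCK /phase normrX normCi !expr1n.
Qed.

Lemma sum_phase : \sum_t phase t = 0.
Proof. by apply: sum_fourth_roots; rewrite ?i_neq1 // (exprM _ 2 2) sqrCi sqrrN expr1n. Qed.

Lemma sum_phase_conj : \sum_t (phase t)^* = 0.
Proof.
transitivity ((\sum_t phase t)^*); first by rewrite rmorph_sum.
by rewrite sum_phase conjC0.
Qed.

Lemma sum_phase_conj2 : \sum_t (phase t)^* * (phase t)^* = 0.
Proof.
transitivity ((\sum_(t < 4) (-1 : C) ^+ t)^*).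
  rewrite rmorph_sum; apply: eq_bigr => t _.
  by rewrite /phase -rmorphM -expr2 -exprM mulnC exprM sqrCi.
have n1 : (-1 : C) != 1 by rewrite eq_sym -subr_eq0 opprK (eqr_nat _ 2 0).
by rewrite sum_fourth_roots ?conjC0 // (exprM _ 2 2) sqrrN !expr1n.
Qed.

Variable m : nat.

(** The sum factors over coordinates, and a coordinate contributes 0 as soon as its phases do not
    cancel. So the conjugated indices i, l must match j, k, in one of two ways. *)
Lemma phase_average (i j k l : 'I_m) :
  \sum_(th : {ffun 'I_m -> 'I_4})
     (phase (th i))^* * phase (th j) * (phase (th k) * (phase (th l))^*) =
  (4 ^ m)%:R * (((i == j) && (k == l)) || ((i == k) && (j == l)))%:R.
Proof.
pose G c t := (if c == i then (phase t)^* else 1) * (if c == j then phase t else 1)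
  * ((if c == k then phase t else 1) * (if c == l then (phase t)^* else 1)).
have one (c0 : 'I_m) (f : 'I_m -> C) : \prod_c (if c == c0 then f c else 1) = f c0.
  by rewrite -big_mkcond big_pred1_eq.
transitivity (\prod_c \sum_t G c t).
  rewrite bigA_distr_bigA; apply: eq_bigr => th _ /=; rewrite /G !big_split /=.
  by rewrite !(one _ (fun c => phase (th c))) !(one _ (fun c => (phase (th c))^*)).
have pn t : phase t * (phase t)^* = 1 by rewrite mulrC phase_norm.
have [cond|] := boolP ((i == j) && (k == l) || (i == k) && (j == l));
  rewrite ?mulr1 ?mulr0.
  rewrite natrX -[in RHS](card_ord m) -prodr_const; apply: eq_bigr => c _.
  transitivity (\sum_(t < 4) (1 : C)); last by rewrite sumr_const card_ord.
  apply: eq_bigr => t _; rewrite /G; case/orP: cond => /andP[/eqP-> /eqP->].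
    by do 2!case: (_ == _); rewrite ?mulr1 ?mul1r ?phase_norm ?pn ?mulr1.
  by case: (c == k); case: (c == l); rewrite ?mulr1 ?mul1r ?phase_norm ?pn ?mulr1.
have zero c : \sum_t G c t = 0 -> \prod_c \sum_t G c t = 0.
  by move=> e; rewrite (bigD1 c) //= e mul0r.
rewrite negb_or !negb_and => /andP[].
have [eij|ij] /= := eqVneq i j.
  subst j; move=> kl _; apply: (zero k); rewrite -[RHS]sum_phase; apply: eq_bigr => t _.
  rewrite /G eqxx (negbTE kl) mulr1; case: eqP; rewrite ?mul1r //.
  by rewrite phase_norm mul1r.
move=> _; have [eik|ik] /= := eqVneq i k.
  subst k; move=> jl; apply: (zero j); rewrite -[RHS]sum_phase; apply: eq_bigr => t _.
  by rewrite /G eqxx (negbTE jl) eq_sym (negbTE ij) !mul1r mulr1.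
move=> _; apply: (zero i).
have [eil|il] := eqVneq i l.
  subst l; rewrite -[RHS]sum_phase_conj2; apply: eq_bigr => t _.
  by rewrite /G eqxx (negbTE ij) (negbTE ik) mulr1 mul1r.
rewrite -[RHS]sum_phase_conj; apply: eq_bigr => t _.
by rewrite /G eqxx (negbTE ij) (negbTE ik) (negbTE il) !mulr1.
Qed.

End PhaseAverage.

(** * Elementary sources of decomposable matrices *)

Section Decomposability.
Variables (R : realType) (m n : nat).
Local Notation C := R[i].
Local Notation ix := (@mxvec_index m n).
Implicit Type W : 'M[C]_(m * n).

Lemma ptransK W : ptrans (ptrans W) = W.
Proof. by apply: matrix_ixP => i k j l; rewrite !ptransE. Qed.

Lemma psd0 : psdmx (0 : 'M[C]_(m * n)).
Proof.
apply/psdP; split=> [p q|v]; first by rewrite !mxE conjC0.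
by rewrite /sesq big1 // => p _; rewrite big1 // => q _; rewrite mxE mulr0 mul0r.
Qed.

Lemma psd_decomposable W : psdmx W -> decomposable W.
Proof.
move=> pW; exists W, 0; split; [done|exact: psd0|].
have -> : ptrans (0 : 'M[C]_(m * n)) = 0 by apply/matrixP => p q; rewrite !mxE.
by rewrite addr0.
Qed.

Lemma ptrans_psd_decomposable W : psdmx (ptrans W) -> decomposable W.
Proof.
move=> pW; exists 0, (ptrans W); split; [exact: psd0|done|].
by rewrite ptransK add0r.
Qed.

Lemma outer_psd (u : 'I_(m * n) -> C) (c : C) : 0 <= c ->
  psdmx (\matrix_(p, q) (c * (u p * (u q)^*)) : 'M[C]_(m * n)).
Proof.
move=> c0; apply/psdP; split=> [p q|v].
  by rewrite !mxE !rmorphM /= conjCK (conj_Creal (ger0_real c0)) [u p * _]mulrC.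
suff -> : sesq (\matrix_(p, q) (c * (u p * (u q)^*)) : 'M[C]_(m * n)) v v =
    c * ((\sum_q (u q)^* * v q) * (\sum_q (u q)^* * v q)^*).
  by rewrite mulr_ge0 ?mul_conjC_ge0.
rewrite /sesq rmorph_sum mulr_sumr mulr_sumr; apply: eq_bigr => p _.
rewrite mulr_suml mulr_sumr; apply: eq_bigr => q _.
by rewrite mxE rmorphM /= conjCK; ring.
Qed.

End Decomposability.

(** * Vectors in Schmidt form *)

Section Schmidt.
Variables (R : realType) (m n : nat) (mn : (m <= n)%N).
Local Notation C := R[i].
Local Notation ix := (@mxvec_index m n).
Local Notation w := (widen_ord mn).
Local Open Scope sesquilinear_scope.
Implicit Type W : 'M[C]_(m * n).

Definition schmidt_vec (s : 'I_m -> C) (p : 'I_(m * n)) : C :=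
  s (idx p).1 *+ ((idx p).1 == (idx p).2 :> nat).

Lemma sum_widen (F : 'I_n -> C) : (forall k : 'I_n, (m <= k)%N -> F k = 0) ->
  \sum_k F k = \sum_c F (w c).
Proof.
move=> F0; rewrite [LHS](bigID (fun k : 'I_n => (k < m)%N)) /=.
rewrite [X in _ + X]big1 ?addr0 => [|k]; last by rewrite -leqNgt => /F0.
by rewrite (big_ord_narrow mn).
Qed.

Lemma sum_schmidt_vec s (F : 'I_(m * n) -> C) :
  \sum_p F p * schmidt_vec s p = \sum_i F (ix i (w i)) * s i.
Proof.
rewrite sum_ix; apply: eq_bigr => i _; rewrite (bigD1 (w i)) //=.
rewrite /schmidt_vec idxE /= eqxx mulr1n big1 ?addr0 // => k ki.
rewrite idxE /=; case: eqP => [e|_]; last by rewrite mulr0.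
by case/eqP: ki; apply: val_inj.
Qed.

Lemma sesq_schmidt W s : (forall i, 0 <= s i) ->
  sesq W (schmidt_vec s) (schmidt_vec s) =
  \sum_i \sum_j s i * s j * W (ix i (w i)) (ix j (w j)).
Proof.
move=> s0.
have sr i : (s i)^* = s i by rewrite conj_Creal // ger0_real.
have vr p : (schmidt_vec s p)^* = schmidt_vec s p.
  by rewrite /schmidt_vec; case: eqP; rewrite ?sr ?conjC0.
transitivity (\sum_p (\sum_q W p q * schmidt_vec s q) * schmidt_vec s p).
  apply: eq_bigr => p _; rewrite mulr_suml; apply: eq_bigr => q _.
  by rewrite [in LHS]vr; ring.
rewrite sum_schmidt_vec; apply: eq_bigr => i _; rewrite sum_schmidt_vec mulr_suml.
by apply: eq_bigr => j _; ring.
Qed.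

(** The coefficient that the phase average puts on a diagonal entry outside the Schmidt form: 0 on
    |ii> and for second indices beyond m. *)
Definition schmidt_weight (s : 'I_m -> C) (i : 'I_m) (k : 'I_n) : C :=
  if insub (val k) is Some c then (if i == c then 0 else s i * s c) else 0.

Lemma schmidt_weightE s i c :
  schmidt_weight s i (w c) = if i == c then 0 else s i * s c.
Proof. by rewrite /schmidt_weight /= valK. Qed.

Lemma schmidt_weight_out s i (k : 'I_n) : (m <= k)%N -> schmidt_weight s i k = 0.
Proof. by move=> mk; rewrite /schmidt_weight insubF // ltnNge mk. Qed.

(* The product vector with components [sqrt (s i) * th i] on the left and
   [sqrt (s k) * conj (th k)] on the right, averaged over the phases [th]. *)
Lemma schmidt_lower W s : block_positive W -> (forall i, 0 <= s i) ->
  0 <= sesq W (schmidt_vec s) (schmidt_vec s) +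
       \sum_i \sum_k schmidt_weight s i k * W (ix i k) (ix i k).
Proof.
move=> bW s0; pose r i := sqrtC (s i).
have rr i : r i * r i = s i by rewrite -expr2 sqrtCK.
have rc i : (r i)^* = r i by rewrite conj_Creal // ger0_real // sqrtC_ge0.
pose E i j k l := r i * r j * (r k * r l) * W (ix i (w k)) (ix j (w l)).
have pos (th : {ffun 'I_m -> 'I_4}) : 0 <= \sum_i \sum_j \sum_k \sum_l
    (phase C (th i))^* * phase C (th j) * (phase C (th k) * (phase C (th l))^*) * E i j k l.
  pose ext (k : 'I_n) : C :=
    if insub (val k) is Some c then r c * (phase C (th c))^* else 0.
  have extE c : ext (w c) = r c * (phase C (th c))^* by rewrite /ext /= valK.
  have ext0 (k : 'I_n) : (m <= k)%N -> ext k = 0 by move=> mk; rewrite /ext insubF // ltnNge mk.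
  have [_ /(_ (fun i => r i * phase C (th i)) ext)] := (block_positiveP W).1 bW.
  congr (0 <= _); apply: eq_bigr => i _; apply: eq_bigr => j _.
  rewrite /sesq sum_widen => [|k mk]; last first.
    by rewrite big1 // => l _; rewrite ext0 // conjC0 !mul0r.
  rewrite mulr_sumr; apply: eq_bigr => k _.
  rewrite sum_widen => [|l ml]; last by rewrite (ext0 l) // mulr0.
  rewrite mulr_sumr; apply: eq_bigr => l _.
  by rewrite !extE /E mxE !rmorphM /= conjCK !rc; ring.
have: 0 <= \sum_i \sum_j \sum_k \sum_l
    ((4 ^ m)%:R * (((i == j) && (k == l)) || ((i == k) && (j == l)))%:R) * E i j k l.
  rewrite [X in 0 <= X](_ : _ = \sum_(th : {ffun 'I_m -> 'I_4}) \sum_i \sum_j \sum_k \sum_l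
    (phase C (th i))^* * phase C (th j) * (phase C (th k) * (phase C (th l))^*) * E i j k l).
    by apply: sumr_ge0 => th _.
  rewrite [RHS]exchange_big; apply: eq_bigr => i _ /=.
  rewrite [RHS]exchange_big; apply: eq_bigr => j _ /=.
  rewrite [RHS]exchange_big; apply: eq_bigr => k _ /=.
  rewrite [RHS]exchange_big; apply: eq_bigr => l _ /=.
  by rewrite -phase_average mulr_suml.
have -> : \sum_i \sum_j \sum_k \sum_l
    ((4 ^ m)%:R * (((i == j) && (k == l)) || ((i == k) && (j == l)))%:R) * E i j k l
  = (4 ^ m)%:R * \sum_i \sum_j \sum_k \sum_l
     ((((i == j) && (k == l)) || ((i == k) && (j == l)))%:R * E i j k l).
  do 4! (rewrite mulr_sumr; apply: eq_bigr => ? _).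
  by rewrite mulrA.
rewrite pmulr_rge0 ?ltr0n ?expn_gt0 //; congr (0 <= _).
(* The two surviving patterns overlap when all four indices agree; the factor [i != j] prevents
   double counting. The terms with k = i of the first pattern complete the second to the Schmidt
   form, the others carry the weights. *)
transitivity (\sum_i (\sum_k E i i k k + \sum_j (i != j)%:R * E i j i j)).
  apply: eq_bigr => i _; have delta (c : 'I_m) (F : 'I_m -> C) :
      \sum_j (c == j)%:R * F j = F c.
    rewrite (bigD1 c) //= eqxx mul1r big1 ?addr0 // => j jc.
    by rewrite eq_sym (negbTE jc) mul0r.
  transitivity (\sum_j (i == j)%:R * (\sum_k \sum_l (k == l)%:R * E i j k l) +
     \sum_j (i != j)%:R * (\sum_k (i == k)%:R * (\sum_l (j == l)%:R * E i j k l))).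
    rewrite -big_split; apply: eq_bigr => j _ /=.
    rewrite mulr_sumr mulr_sumr -big_split; apply: eq_bigr => k _ /=.
    rewrite !mulr_sumr -big_split; apply: eq_bigr => l _ /=.
    have [<-|ij] := eqVneq i j; rewrite /= ?mul0r ?mul1r ?addr0 ?add0r.
      have [//|kl] := eqVneq k l; have [eik|//] := eqVneq i k.
      by rewrite eik (negbTE kl).
    by case: (i == k); case: (j == l); rewrite /= ?mul0r ?mul1r ?mulr0.
  rewrite delta; congr (_ + _).
    by apply: eq_bigr => k _; rewrite delta.
  by apply: eq_bigr => j _; rewrite !delta.
rewrite big_split /= sesq_schmidt // addrC.
have -> : \sum_i \sum_k schmidt_weight s i k * W (ix i k) (ix i k) =
    \sum_i \sum_c (i != c)%:R * (s i * s c) * W (ix i (w c)) (ix i (w c)).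
  apply: eq_bigr => i _; rewrite sum_widen => [|k mk]; last first.
    by rewrite schmidt_weight_out // mul0r.
  apply: eq_bigr => c _; rewrite schmidt_weightE.
  by case: eqP; rewrite ?mul0r ?mul1r.
rewrite -!big_split; apply: eq_bigr => i _ /=; rewrite -!big_split.
apply: eq_bigr => j _ /=; have [<-|ij] := eqVneq i j.
  by rewrite /= !mul0r add0r addr0 /E !rr.
by rewrite /= !mul1r /E !rr; congr (_ + _); rewrite mulrACA !rr.
Qed.

End Schmidt.

(** * The smallest eigenvalue *)

Section MinEigenvalue.
Variables (R : realType) (m n : nat) (mn : (m <= n)%N).
Local Notation C := R[i].
Local Notation ix := (@mxvec_index m n).
Local Notation w := (widen_ord mn).
Local Open Scope sesquilinear_scope.
Implicit Type W : 'M[C]_(m * n).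

Lemma local_tr A B W : A \is unitarymx -> B \is unitarymx ->
  \tr (local A B W) = \tr W.
Proof.
move=> uA uB; rewrite /local mxtrace_mulC mulmxA.
have := tensor_unitary uA uB; rewrite -trmxC_unitary => /unitarymxP.
by rewrite trmxCK => ->; rewrite mul1mx.
Qed.

Lemma sesq1 (v : 'I_(m * n) -> C) : sesq 1%:M v v = \sum_p `|v p| ^+ 2.
Proof.
apply: eq_bigr => p _; rewrite (bigD1 p) //= big1 ?addr0 => [|q qp].
  by rewrite mxE eqxx mulr1 normCK mulrC.
by rewrite mxE eq_sym (negbTE qp) mulr0 mul0r.
Qed.

(** The local unitaries are moved from the vector to the matrix: block positivity, trace and
    decomposability all survive them, so [v] may be taken in Schmidt form. *)
Lemma schmidt_decomposition (v : 'I_(m * n) -> C) : exists A B s,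
  [/\ A \is unitarymx, B \is unitarymx, forall i, 0 <= s i,
      \sum_i s i ^+ 2 = \sum_p `|v p| ^+ 2 &
      forall W, sesq W v v = sesq (local A B W) (schmidt_vec s) (schmidt_vec s)].
Proof.
have [A [G [s [uA uG s0 eM]]]] := svd (\matrix_(i, k) v (ix i k)) mn.
have ev q : v q = \sum_i A (idx q).1 i * G (w i) (idx q).2 * s i.
  rewrite -(ixE q) !idxE /=; move/matrixP: eM => /(_ (idx q).1 (idx q).2).
  rewrite mxE [RHS]mxE => ->.
  transitivity (\sum_(k < n) \sum_(i < m) A (idx q).1 i *
      (\matrix_(i, k) (s i *+ (i == k :> nat))) i k * G k (idx q).2).
    by apply: eq_bigr => k _; rewrite mxE mulr_suml.
  rewrite exchange_big; apply: eq_bigr => i _ /=.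
  rewrite (bigD1 (w i)) //= big1 ?addr0 => [|k ki].
    by rewrite mxE eqxx mulr1n mulrAC.
  rewrite mxE; case: eqP => [e|_]; last by rewrite mulr0 mul0r.
  by case/eqP: ki; apply: val_inj.
have sr i : (s i)^* = s i by rewrite conj_Creal // ger0_real.
have uA' : A^t* \is unitarymx by rewrite trmxC_unitary.
have uG' : map_mx Num.conj G \is unitarymx by rewrite conjC_unitary.
have eW W : sesq W v v =
    sesq (local (A^t*) (map_mx Num.conj G) W) (schmidt_vec s) (schmidt_vec s).
  rewrite local_sesq.
  have e q : v q = \sum_p (tensor (A^t*) (map_mx Num.conj G) p q)^* * schmidt_vec s p.
    rewrite (sum_schmidt_vec mn) ev; apply: eq_bigr => i _.
    by rewrite !mxE !idxE /= rmorphM /= !conjCK.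
  by apply: eq_bigr => p _; apply: eq_bigr => q _; rewrite -!e.
exists (A^t*), (map_mx Num.conj G), s; split=> //.
rewrite -sesq1 eW /local mulmx1 (unitarymxP (tensor_unitary uA' uG')) (sesq_schmidt mn) //.
apply: eq_bigr => i _; rewrite (bigD1 i) //= big1 ?addr0 => [|j ji].
  by rewrite mxE eqxx mulr1 expr2.
by rewrite mxE ix_inj eq_sym (negbTE ji) mulr0.
Qed.

Lemma two_squares_le1 (s : 'I_m -> C) i j : (forall i, 0 <= s i) ->
  \sum_i s i ^+ 2 = 1 -> i != j ->
  s i ^+ 2 + s j ^+ 2 + \sum_(k | (k != i) && (k != j)) s k ^+ 2 = 1.
Proof.
move=> s0 s1 ij; rewrite -[RHS]s1 [RHS](bigD1 i) //= [X in _ = _ + X](bigD1 j) /=.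
  by rewrite addrA.
by rewrite eq_sym.
Qed.

(** 1 - 2 s_i s_c is the square of s_i - s_c plus the remaining squares of the unit vector. *)
Lemma schmidt_weight_le (s : 'I_m -> C) i (k : 'I_n) : (forall i, 0 <= s i) ->
  \sum_i s i ^+ 2 = 1 -> schmidt_weight s i k <= 2^-1.
Proof.
move=> s0 s1; rewrite /schmidt_weight; case: insubP => [c _ _|_]; last by rewrite invr_ge0.
have [_|ic] := eqVneq i c; first by rewrite invr_ge0.
have e := two_squares_le1 s0 s1 ic.
have t0 : 0 <= \sum_(k | (k != i) && (k != c)) s k ^+ 2.
  by apply: sumr_ge0 => a _; apply: exprn_ge0.
have d0 : 0 <= (s i - s c) ^+ 2.
  by rewrite real_exprn_even_ge0 // rpredB ?ger0_real.
rewrite -subr_ge0 [X in 0 <= X](_ : _ = ((s i - s c) ^+ 2 +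
  \sum_(k | (k != i) && (k != c)) s k ^+ 2) / 2); last first.
  by rewrite (canRL (addKr _) e); field.
by rewrite mulr_ge0 ?addr_ge0 ?invr_ge0.
Qed.

Lemma schmidt_weight_half (s : 'I_m -> C) i (k : 'I_n) : (forall i, 0 <= s i) ->
  \sum_i s i ^+ 2 = 1 -> schmidt_weight s i k = 2^-1 ->
  exists c, [/\ k = w c, i != c, s i = s c, s i ^+ 2 = 2^-1 &
                forall a, a != i -> a != c -> s a = 0].
Proof.
move=> s0 s1; rewrite /schmidt_weight.
have h0 : (2^-1 : C) != 0 by rewrite invr_eq0 (eqr_nat _ 2 0).
case: insubP => [c _ ec|_ /esym/eqP]; last by rewrite (negbTE h0).
have [_ /esym/eqP|ic h] := eqVneq i c; first by rewrite (negbTE h0).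
have e := two_squares_le1 s0 s1 ic.
have t0 : 0 <= \sum_(k | (k != i) && (k != c)) s k ^+ 2.
  by apply: sumr_ge0 => a _; apply: exprn_ge0.
have d0 : 0 <= (s i - s c) ^+ 2.
  by rewrite real_exprn_even_ge0 // rpredB ?ger0_real.
have /eqP : (s i - s c) ^+ 2 + \sum_(k | (k != i) && (k != c)) s k ^+ 2 = 0.
  transitivity (1 - 2 * (s i * s c)); first by rewrite (canRL (addKr _) e); ring.
  by rewrite h mulfV ?subrr // (eqr_nat _ 2 0).
rewrite paddr_eq0 // => /andP[]; rewrite sqrf_eq0 subr_eq0 => /eqP eic.
rewrite psumr_eq0 => [/allP z|a _]; last by apply: exprn_ge0.
exists c; split=> //.
- by apply: val_inj.
- by rewrite -h expr2 -eic.
move=> a ai ac; have := z a; rewrite mem_index_enum ai ac /= sqrf_eq0.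
by move=> /(_ isT)/eqP.
Qed.

(** Because the trace is 1, the number 1/2 spreads over the diagonal of W. The middle sum is the
    slack in the bound -1/2; when it vanishes, each of its terms does. *)
Lemma schmidt_defect W s : block_positive W -> \tr W = 1 ->
  (forall i, 0 <= s i) -> \sum_i s i ^+ 2 = 1 ->
  0 <= \sum_i \sum_k (2^-1 - schmidt_weight s i k) * W (ix i k) (ix i k)
    <= sesq W (schmidt_vec s) (schmidt_vec s) + 2^-1.
Proof.
move=> bW tW s0 s1; apply/andP; split.
  apply: sumr_ge0 => i _; apply: sumr_ge0 => k _.
  by rewrite mulr_ge0 ?diag_ge0 // subr_ge0 schmidt_weight_le.
have h := schmidt_lower mn bW s0; rewrite -subr_ge0; congr (0 <= _): h.
have e : 2^-1 = \sum_i \sum_k 2^-1 * W (ix i k) (ix i k).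
  under eq_bigr do rewrite -mulr_sumr.
  have sW : \sum_i \sum_k W (ix i k) (ix i k) = 1 by rewrite -tW /mxtrace sum_ix.
  by rewrite -mulr_sumr sW mulr1.
rewrite [X in _ = _ + X - _]e -addrA; congr (_ + _).
rewrite -sumrB; apply: eq_bigr => i _; rewrite -sumrB; apply: eq_bigr => k _.
by ring.
Qed.

Lemma eigenvalue_ge_mhalf W v : block_positive W -> \tr W = 1 ->
  \sum_p `|v p| ^+ 2 = 1 -> - 2^-1 <= sesq W v v.
Proof.
move=> bW tW v1; have [A [B [s [uA uB s0 s1 ->]]]] := schmidt_decomposition v.
rewrite v1 in s1.
have := schmidt_defect (local_block_positive A B bW).
rewrite local_tr // => /(_ s tW s0 s1)/andP[h1 h2].
by rewrite -subr_ge0 opprK (le_trans h1 h2).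
Qed.

Lemma offdiag_cs W i k l : block_positive W ->
  `|W (ix i k) (ix i l)| ^+ 2 <= W (ix i k) (ix i k) * W (ix i l) (ix i l).
Proof.
move=> bW; have [->|kl] := eqVneq k l; first by rewrite ger0_norm ?diag_ge0 // expr2.
apply: two_by_two_psd; rewrite ?diag_ge0 // => x y.
have := diag_block_ge0 bW i (fun c => if c == k then x else if c == l then y else 0).
have lk : l != k by rewrite eq_sym.
rewrite /sesq (bigD1 k) //= (bigD1 k) //= (bigD1 l) //= eqxx (negbTE lk) eqxx.
rewrite [X in _ + (_ + X)]big1 ?addr0 => [|c /andP[/negbTE-> /negbTE->]]; last first.
  by rewrite mulr0.
rewrite (bigD1 l) //= (bigD1 k) //= (bigD1 l) //= eqxx (negbTE lk) eqxx.
rewrite [X in _ + (_ + (_ + X) + _)]big1 ?addr0 => [|c /andP[/negbTE-> /negbTE->]]; last first.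
  by rewrite mulr0.
rewrite [X in _ + (_ + X)]big1 ?addr0 => [|c /andP[/negbTE-> /negbTE->]]; last first.
  by apply: big1 => q _; rewrite conjC0 !mul0r.
by rewrite !mxE (bp_herm bW); congr (0 <= _); ring.
Qed.

(* Equality forces the diagonal of [W] onto two positions (k, l) and (l, k) with
   [s k = s l = 1/sqrt 2]; the Frobenius bound on the block (k, l) then leaves a
   single possibility for [W], whose partial transpose is positive. *)
Lemma schmidt_mhalf_decomposable W s : block_positive W -> \tr W = 1 ->
  (forall i, 0 <= s i) -> \sum_i s i ^+ 2 = 1 ->
  sesq W (schmidt_vec s) (schmidt_vec s) = - 2^-1 -> decomposable W.
Proof.
move=> bW tW s0 s1 eh; pose D i k := W (ix i k) (ix i k).
have D0 i k : 0 <= D i k by apply: diag_ge0.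
(* Complementary slackness in [schmidt_defect]. *)
have wD i k : D i k != 0 -> schmidt_weight s i k = 2^-1.
  have := schmidt_defect bW tW s0 s1; rewrite eh addNr => /andP[h1 h2].
  have /eqP : \sum_i \sum_k (2^-1 - schmidt_weight s i k) * D i k = 0.
    by apply/eqP; rewrite eq_le h1 h2.
  have t0 a b : 0 <= (2^-1 - schmidt_weight s a b) * D a b.
    by rewrite mulr_ge0 // subr_ge0 schmidt_weight_le.
  rewrite psumr_eq0 => [/allP/(_ i)|a _]; last by apply: sumr_ge0.
  rewrite mem_index_enum => /(_ isT); rewrite psumr_eq0 // => /allP/(_ k).
  rewrite mem_index_enum => /(_ isT) /=; rewrite mulf_eq0 subr_eq0 => /orP[/eqP->//|->//].
have sD : \sum_i \sum_k D i k = 1 by rewrite -tW /mxtrace sum_ix.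
have [[k k'] Dk|nD] := pickP [pred q | D q.1 q.2 != 0]; last first.
  have /eqP := sD; rewrite big1 ?(eq_sym 0) ?oner_eq0 // => i _.
  by apply: big1 => a _; have /negbFE/eqP := nD (i, a).
have [l [/= ek' kl skl sk2 sz]] := schmidt_weight_half s0 s1 (wD _ _ Dk).
have lk : l != k by rewrite eq_sym.
have sk0 : s k != 0 by apply/eqP => z; move: sk2; rewrite z expr0n /= => /esym/eqP; rewrite invr_eq0 (eqr_nat _ 2 0).
have supp i b : D i b != 0 -> (i, b) = (k, w l) \/ (i, b) = (l, w k).
  move=> Db; have [c [-> ic sic si2 _]] := schmidt_weight_half s0 s1 (wD _ _ Db).
  have si0 : s i != 0 by apply/eqP => z; move: si2; rewrite z expr0n /= => /esym/eqP; rewrite invr_eq0 (eqr_nat _ 2 0).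
  have sc0 : s c != 0 by rewrite -sic.
  have [ik|ik] := eqVneq i k; have [ck|ck] := eqVneq c k.
  - by rewrite ik ck eqxx in ic.
  - left; rewrite ik; have [->//|cl] := eqVneq c l.
    by move: sc0; rewrite sz ?eqxx.
  - right; rewrite ck; have [->//|il] := eqVneq i l.
    by move: si0; rewrite sz ?eqxx.
  - have [il|il] := eqVneq i l; last by move: si0; rewrite sz ?eqxx.
    have [cl|cl] := eqVneq c l; last by move: sc0; rewrite sz ?eqxx.
    by rewrite il cl eqxx in ic.
have D00 i b : (i, b) != (k, w l) -> (i, b) != (l, w k) -> D i b = 0.
  by move=> n1 n2; apply/eqP/negPn/negP => /supp[]/eqP e; rewrite e in n1 n2.
have w_inj : injective w by move=> a b /(congr1 val) e; apply: val_inj.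
have wkl : w k != w l by rewrite (inj_eq w_inj).
have wlk : w l != w k by rewrite eq_sym.
set x := D k (w l); set y := D l (w k).
have tk : \tr (block W k k) = x.
  rewrite tr_block (bigD1 (w l)) //= big1 ?addr0 // => b bl.
  by apply: D00; rewrite xpair_eqE ?eqxx ?(negbTE kl) ?(negbTE bl).
have tl : \tr (block W l l) = y.
  rewrite tr_block (bigD1 (w k)) //= big1 ?addr0 // => b bl.
  by apply: D00; rewrite xpair_eqE ?eqxx ?(negbTE lk) ?(negbTE bl).
have tz i : i != k -> i != l -> \tr (block W i i) = 0.
  move=> ik il; rewrite tr_block big1 // => b _.
  by apply: D00; rewrite xpair_eqE ?(negbTE ik) ?(negbTE il).
have xy : x + y = 1.
  rewrite -tW (tr_blocks W) (bigD1 k) //= (bigD1 l) //= big1 ?addr0 ?tk ?tl //.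
  by move=> i /andP[ik il]; apply: tz.
(* The Frobenius bound kills every block with a traceless index, so only the blocks on k and l
   remain. *)
have bz i j a b : \tr (block W i i) * \tr (block W j j) = 0 -> W (ix i a) (ix j b) = 0.
  move=> t0; have := block_frobenius bW i j; rewrite t0 => h.
  have /eqP : \sum_a \sum_b `|W (ix i a) (ix j b)| ^+ 2 = 0.
    apply/eqP; rewrite eq_le h /=; apply: sumr_ge0 => c _; apply: sumr_ge0 => d _.
    exact: exprn_ge0.
  rewrite psumr_eq0 => [/allP/(_ a)|c _]; last by apply: sumr_ge0 => d _; exact: exprn_ge0.
  rewrite mem_index_enum => /(_ isT); rewrite psumr_eq0 => [/allP/(_ b)|c _]; last exact: exprn_ge0.
  by rewrite mem_index_enum => /(_ isT) /=; rewrite sqrf_eq0 normr_eq0 => /eqP.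
set c := W (ix k (w k)) (ix l (w l)).
have cc : c + c^* = -1.
  have : sesq W (schmidt_vec s) (schmidt_vec s) = 2^-1 * (c + c^*).
    rewrite (sesq_schmidt mn) //.
    have Dkk : W (ix k (w k)) (ix k (w k)) = 0.
      by apply: D00; rewrite xpair_eqE ?eqxx ?(negbTE kl) ?(negbTE wkl).
    have Dll : W (ix l (w l)) (ix l (w l)) = 0.
      by apply: D00; rewrite xpair_eqE ?eqxx ?(negbTE lk) ?(negbTE wlk).
    have sum2 (F : 'I_m -> C) : (forall i, i != k -> i != l -> F i = 0) ->
        \sum_i F i = F k + F l.
      move=> F0; rewrite (bigD1 k) //= (bigD1 l) //= big1 ?addr0 //.
      by move=> i /andP[]; exact: F0.
    rewrite sum2 => [|i ik il]; last by apply: big1 => j _; rewrite sz ?mul0r.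
    rewrite sum2 => [|j jk jl]; last by rewrite (sz j) ?mulr0 ?mul0r.
    rewrite sum2 => [|j jk jl]; last by rewrite (sz j) ?mulr0 ?mul0r.
    rewrite Dkk Dll !mulr0 add0r addr0 -skl -expr2 sk2 -/c -(bp_herm bW (ix l (w l))).
    by rewrite -/c mulrDr.
  rewrite eh => /(congr1 (fun z => 2 * z)).
  by rewrite mulrN mulrA !mulfV ?mul1r ?(eqr_nat _ 2 0).
have frob := block_frobenius bW k l; rewrite tk tl in frob.
have sq0 : 0 <= (x - y) ^+ 2 by rewrite real_exprn_even_ge0 // rpredB ?ger0_real ?D0.
have exy : x * y = 4^-1 - (x - y) ^+ 2 / 4.
  transitivity ((x + y) ^+ 2 / 4 - (x - y) ^+ 2 / 4); first by field.
  by rewrite xy expr1n mul1r.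
have rest0 : 0 <= \sum_(a | a != w k) \sum_b `|W (ix k a) (ix l b)| ^+ 2.
  by apply: sumr_ge0 => a _; apply: sumr_ge0 => b _; exact: exprn_ge0.
have rest1 : 0 <= \sum_(b | b != w l) `|W (ix k (w k)) (ix l b)| ^+ 2.
  by apply: sumr_ge0 => b _; exact: exprn_ge0.
have nc : `|c| ^+ 2 = `|c + 2^-1| ^+ 2 + 4^-1.
  rewrite !normCK rmorphD fmorphV /= conjC_nat.
  transitivity (c * c^* + 2^-1 * (c + c^*) + 2^-1); last by field.
  by rewrite cc mulrN1 addrNK.
(* Since x + y = 1 and Re c = - 1/2, both |c|^2 and x y are 1/4 up to squares of opposite sign; the
   block bound by x y therefore forces all these squares to vanish. *)
have: `|c + 2^-1| ^+ 2 + \sum_(b | b != w l) `|W (ix k (w k)) (ix l b)| ^+ 2 +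
   \sum_(a | a != w k) \sum_b `|W (ix k a) (ix l b)| ^+ 2 + (x - y) ^+ 2 / 4 <= 0.
  move: frob; rewrite (bigD1 (w k)) //= (bigD1 (w l)) //= -/c nc exy => frob.
  rewrite -subr_le0 in frob; apply: le_trans frob.
  by rewrite le_eqVlt; apply/orP; left; apply/eqP; ring.
have q0 : 0 <= (x - y) ^+ 2 / 4 by rewrite mulr_ge0 ?invr_ge0.
move=> le0; have /eqP : `|c + 2^-1| ^+ 2 + \sum_(b | b != w l) `|W (ix k (w k)) (ix l b)| ^+ 2 +
   \sum_(a | a != w k) \sum_b `|W (ix k a) (ix l b)| ^+ 2 + (x - y) ^+ 2 / 4 = 0.
  by apply/eqP; rewrite eq_le le0 !addr_ge0 ?exprn_ge0.
rewrite !paddr_eq0 ?addr_ge0 ?exprn_ge0 // => /andP[/andP[/andP[c2 r1] r2] xy0].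
have ec : c = - 2^-1.
  by apply/eqP; rewrite -addr_eq0 -normr_eq0 -sqrf_eq0.
have exyh : x = 2^-1 /\ y = 2^-1.
  move: xy0; rewrite mulf_eq0 invr_eq0 (eqr_nat _ 4 0) orbF sqrf_eq0 subr_eq0.
  move=> /eqP exy'; have h2 : (2 : C) != 0 by rewrite (eqr_nat _ 2 0).
  have ex : x = 2^-1.
    by apply: (mulIf h2); rewrite mulVf // mulr_natr mulr2n [X in _ + X]exy'.
  by rewrite -exy'.
have bkl a b : W (ix k a) (ix l b) = if (a == w k) && (b == w l) then - 2^-1 else 0.
  have [->|ak] /= := eqVneq a (w k).
    have [->//|bl] := eqVneq b (w l).
    move: r1; rewrite psumr_eq0 => [/allP/(_ b)|b' _]; last exact: exprn_ge0.
    by rewrite mem_index_enum bl => /(_ isT) /=; rewrite sqrf_eq0 normr_eq0 => /eqP.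
  move: r2; rewrite psumr_eq0 => [/allP/(_ a)|a' _]; last first.
    by apply: sumr_ge0 => b' _; exact: exprn_ge0.
  rewrite mem_index_enum ak => /(_ isT) /=; rewrite psumr_eq0 => [/allP/(_ b)|b' _]; last exact: exprn_ge0.
  by rewrite mem_index_enum => /(_ isT) /=; rewrite sqrf_eq0 normr_eq0 => /eqP.
have dz i a b : D i a = 0 \/ D i b = 0 -> W (ix i a) (ix i b) = 0.
  move=> h; have := offdiag_cs i a b bW; rewrite -/(D i a) -/(D i b).
  have -> : D i a * D i b = 0 by case: h => ->; rewrite ?mulr0 ?mul0r.
  move=> le; apply/eqP; rewrite -normr_eq0 -sqrf_eq0 eq_le le exprn_ge0 //.
have bkk a b : W (ix k a) (ix k b) = if (a == w l) && (b == w l) then 2^-1 else 0.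
  have Dz a' : a' != w l -> D k a' = 0.
    by move=> al; apply: D00; rewrite xpair_eqE ?eqxx ?(negbTE kl) ?(negbTE al).
  have [->|al] /= := eqVneq a (w l); last by apply: dz; left; apply: Dz.
  have [->|bl] /= := eqVneq b (w l); first by case: exyh.
  by apply: dz; right; apply: Dz.
have bll a b : W (ix l a) (ix l b) = if (a == w k) && (b == w k) then 2^-1 else 0.
  have Dz a' : a' != w k -> D l a' = 0.
    by move=> al; apply: D00; rewrite xpair_eqE ?eqxx ?(negbTE lk) ?(negbTE al).
  have [->|al] /= := eqVneq a (w k); last by apply: dz; left; apply: Dz.
  have [->|bl] /= := eqVneq b (w k); first by case: exyh.
  by apply: dz; right; apply: Dz.
(* The antisymmetric vector on the positions (k, l) and (l, k): W is half the partial transpose of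
   its projector. *)
pose u p : C := (p == ix k (w l))%:R - (p == ix l (w k))%:R.
have ur p : (u p)^* = u p by rewrite rmorphB /= !rmorph_nat.
apply: ptrans_psd_decomposable.
have -> : ptrans W = \matrix_(p, q) (2^-1 * (u p * (u q)^*)); last first.
  by apply: outer_psd; rewrite invr_ge0.
apply: matrix_ixP => i a j b; rewrite ptransE mxE ur /u !ix_inj.
have [->|jk] := eqVneq j k; [|have [->|jl] := eqVneq j l]; last first.
- rewrite /= subrr !mulr0; apply: bz; by rewrite (tz j) ?mul0r.
- have [->|ik] := eqVneq i k; [|have [->|il] := eqVneq i l]; last first.
  + rewrite /= subrr mul0r mulr0; apply: bz; by rewrite (tz i) ?mulr0.
  + rewrite bll ?eqxx ?(negbTE lk) /=.
    by case: (a == w k); case: (b == w k); rewrite /=; ring.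
  + rewrite -(bp_herm bW) bkl ?eqxx ?(negbTE kl) ?(negbTE lk) /=.
    case: (a == w l); case: (b == w k); rewrite /= ?conjC0; try by ring.
    by rewrite rmorphN fmorphV /= rmorph_nat; ring.
- have [->|ik] := eqVneq i k; [|have [->|il] := eqVneq i l]; last first.
  + rewrite /= subrr mul0r mulr0; apply: bz; by rewrite (tz i) ?mulr0.
  + rewrite bkl ?eqxx ?(negbTE kl) ?(negbTE lk) /=.
    by case: (a == w k); case: (b == w l); rewrite /=; ring.
  + rewrite bkk ?eqxx ?(negbTE kl) /=.
    by case: (a == w l); case: (b == w l); rewrite /=; ring.
Qed.

Lemma mhalf_decomposable W v : block_positive W -> \tr W = 1 ->
  \sum_p `|v p| ^+ 2 = 1 -> sesq W v v = - 2^-1 -> decomposable W.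
Proof.
move=> bW tW v1; have [A [B [s [uA uB s0 s1 ->]]]] := schmidt_decomposition v.
rewrite v1 in s1 => eh; rewrite -(local_unitaryK W uA uB); apply: local_decomposable.
apply: (schmidt_mhalf_decomposable _ _ s0 s1 eh); last by rewrite local_tr.
exact: local_block_positive.
Qed.

End MinEigenvalue.

(** * Equality in the trace-norm bound *)

Section Extremal.
Variables (R : realType) (n : nat).
Hypothesis n_gt0 : (0 < n)%N.
Local Notation C := R[i].
Local Notation ix := (@mxvec_index n n).
Local Open Scope sesquilinear_scope.
Implicit Type W : 'M[C]_(n * n).

(* The equality case of [\sum_k |d_k| <= n * sqrt (tr W^2) <= n]: all
   eigenvalues have modulus 1/n. *)
Definition extremal W :=
  [/\ block_positive W, \tr W = 1 & W *m W = (n%:R ^- 2)%:M].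

(** Exchange of the two tensor factors, which transfers results on the first factor to the
    second. *)
Definition flip W : 'M[C]_(n * n) :=
  \matrix_(p, q) W (ix (idx p).2 (idx p).1) (ix (idx q).2 (idx q).1).

Lemma flipE W i k j l : flip W (ix i k) (ix j l) = W (ix k i) (ix l j).
Proof. by rewrite mxE !idxE. Qed.

Lemma unitarymx1 N : (1%:M : 'M[C]_N) \is unitarymx.
Proof. by apply/unitarymxP; rewrite trmx1 map_mx1 mulmx1. Qed.

Lemma flip_extremal W : extremal W -> extremal (flip W).
Proof.
move=> [bW tW W2]; split.
- apply/block_positiveP; split=> [p q|a b].
    by rewrite !mxE (bp_herm bW).
  have [_ /(_ b a)] := (block_positiveP W).1 bW; rewrite -!sesq_prod /sesq.
  rewrite !sum_ix exchange_big; congr (0 <= _).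
  apply: eq_bigr => i _; apply: eq_bigr => k _.
  rewrite !sum_ix exchange_big; apply: eq_bigr => j _; apply: eq_bigr => l _.
  by rewrite flipE !idxE /= !rmorphM /=; ring.
- rewrite -tW /mxtrace !sum_ix exchange_big; apply: eq_bigr => i _.
  by apply: eq_bigr => k _; rewrite flipE.
- apply: matrix_ixP => i k j l; move/matrixP: W2 => /(_ (ix k i) (ix l j)).
  rewrite !mxE !sum_ix !ix_inj andbC => <-; rewrite exchange_big.
  by apply: eq_bigr => a _; apply: eq_bigr => b _; rewrite !flipE.
Qed.

Lemma local_extremal A B W : A \is unitarymx -> B \is unitarymx ->
  extremal W -> extremal (local A B W).
Proof.
move=> uA uB [bW tW W2]; split; [exact: local_block_positive|by rewrite local_tr|].
have uT := tensor_unitary uA uB.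
rewrite /local; move: (tensor A B) uT => T uT.
rewrite !mulmxA mulmxKtV // -(mulmxA T W W) W2 scalar_mxC -mulmxA.
by rewrite (unitarymxP uT) mulmx1.
Qed.

Section Basic.
Variable W : 'M[C]_(n * n).
Hypothesis eW : extremal W.
Let bW : block_positive W. Proof. by case: eW. Qed.
Let tW : \tr W = 1. Proof. by case: eW. Qed.
Let nz : (n%:R : C) != 0. Proof. by rewrite pnatr_eq0 -lt0n. Qed.

Lemma extremal_row p : \sum_q `|W p q| ^+ 2 = n%:R ^- 2.
Proof.
have [_ _ /matrixP/(_ p p)] := eW; rewrite !mxE eqxx mulr1n => <-.
by apply: eq_bigr => q _; rewrite normCK (bp_herm bW).
Qed.

(** Here tr W^2 = 1 = (tr W)^2, so the Frobenius bounds, which add up to this inequality, are all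
    tight. *)
Lemma extremal_block i j : \sum_k \sum_l `|W (ix i k) (ix j l)| ^+ 2 =
  \tr (block W i i) * \tr (block W j j).
Proof.
have e : \tr (W *m W) = 1.
  have [_ _ ->] := eW; rewrite mxtrace_scalar -[LHS]mulr_natr natrM -expr2.
  by rewrite mulVf ?expf_neq0.
have : \sum_i \sum_j (\tr (block W i i) * \tr (block W j j) -
   \sum_k \sum_l `|W (ix i k) (ix j l)| ^+ 2) = 0.
  under eq_bigr do rewrite sumrB -mulr_sumr.
  by rewrite sumrB -mulr_suml -tr_blocks tW mulr1 -(trsq_blocks bW) e subrr.
have ge0 a b : 0 <= \tr (block W a a) * \tr (block W b b) -
   \sum_k \sum_l `|W (ix a k) (ix b l)| ^+ 2.
  by rewrite subr_ge0 block_frobenius.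
move/eqP; rewrite psumr_eq0 => [/allP/(_ i)|a _]; last by apply: sumr_ge0.
rewrite mem_index_enum => /(_ isT); rewrite psumr_eq0 // => /allP/(_ j).
by rewrite mem_index_enum => /(_ isT) /=; rewrite subr_eq0 => /eqP.
Qed.

(** The squared entries of a block row are counted twice: by rows they give n times 1/n^2, by tight
    blocks they give the trace of the diagonal block times tr W. *)
Lemma extremal_tr_block i : \tr (block W i i) = n%:R^-1.
Proof.
have : \sum_k \sum_q `|W (ix i k) q| ^+ 2 = n%:R^-1.
  under eq_bigr do rewrite extremal_row.
  by rewrite sumr_const card_ord -[LHS]mulr_natr expr2 invfM mulfVK.
under eq_bigr do rewrite sum_ix.
rewrite exchange_big /=; under eq_bigr do rewrite extremal_block.
by rewrite -mulr_sumr -tr_blocks tW mulr1.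
Qed.

End Basic.

Lemma extremal_tr_right W k : extremal W -> \sum_i W (ix i k) (ix i k) = n%:R^-1.
Proof.
move=> /flip_extremal/extremal_tr_block/(_ k) <-; rewrite tr_block.
by apply: eq_bigr => i _; rewrite flipE.
Qed.

Lemma local_right_block (B : 'M[C]_n) W i j :
  block (local 1%:M B W) i j = B *m block W i j *m B^t*.
Proof.
apply/matrixP => k l; rewrite mxE localE.
have delta (c : 'I_n) (F : 'I_n -> C) : \sum_j ((c == j)%:R : C) * F j = F c.
  rewrite (bigD1 c) //= eqxx mul1r big1 ?addr0 // => c' jc.
  by rewrite eq_sym (negbTE jc) mul0r.
transitivity (\sum_a ((i == a)%:R : C) * \sum_b \sum_c ((j == c)%:R : C) * \sum_d
    B k b * W (ix a b) (ix c d) * (B l d)^*).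
  apply: eq_bigr => a _; rewrite mulr_sumr; apply: eq_bigr => b _.
  rewrite mulr_sumr; apply: eq_bigr => c _; rewrite !mulr_sumr.
  by apply: eq_bigr => d _; rewrite !mxE rmorph_nat; ring.
rewrite delta mxE; under eq_bigr do rewrite delta.
rewrite exchange_big; apply: eq_bigr => d _ /=.
by rewrite !mxE mulr_suml; apply: eq_bigr => b _; rewrite mxE.
Qed.

(** The marginal has diagonal 1/n after every local unitary, in particular in its own eigenbasis. *)
Lemma extremal_right_marginal W : extremal W ->
  \sum_i block W i i = (n%:R^-1)%:M.
Proof.
move=> eW; have bW : block_positive W by case: eW.
set rho := \sum_i block W i i.
have [V [d [uV erho]]] : exists V (d : 'I_n -> R), eigensystem rho V d.
  apply: hermitian_eigensystem => k l; rewrite /rho !summxE rmorph_sum.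
  by apply: eq_bigr => i _; rewrite /= !mxE (bp_herm bW).
have dV : V *m rho *m V^t* = (n%:R^-1)%:M.
  rewrite (eigen_diag (conj uV erho)); apply/matrixP => k l; rewrite !mxE.
  congr (_ *+ _).
  rewrite -(extremal_tr_right k (local_extremal (unitarymx1 _) uV eW)).
  transitivity ((V *m rho *m V^t*) k k).
    by rewrite (eigen_diag (conj uV erho)) !mxE eqxx mulr1n.
  rewrite /rho mulmx_sumr mulmx_suml summxE; apply: eq_bigr => i _.
  by rewrite -local_right_block mxE.
have K := adj_unitaryK (conj uV erho).
transitivity (V^t* *m (V *m rho *m V^t*) *m V).
  by rewrite !mulmxA K mul1mx -mulmxA K mulmx1.
by rewrite dV scalar_mxC -mulmxA K mulmx1.
Qed.

(** The eigenvalues are nonnegative and the square of their sum equals the sum of their squares, so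
    products of distinct ones vanish and one eigenvalue is left. *)
Lemma rank_one_psd (P : 'M[C]_n) (t : C) : t != 0 ->
  (forall p q, (P q p)^* = P p q) -> (forall v, 0 <= sesq P v v) ->
  \tr P = t -> \tr (P *m P) = t ^+ 2 ->
  exists f : 'I_n -> C, forall k l, P k l = t * ((f k)^* * f l).
Proof.
move=> t0 hP pP tP tP2; have [V [d eP]] := hermitian_eigensystem hP.
have d0 k : 0 <= d k.
  by have [v [h _]] := eigen_vector eP k; have := pP v; rewrite h ler0c.
have et : t = (\sum_k d k)%:C%C by rewrite -tP (eigen_tr eP).
have [k0 /= dk0|z] := pickP [pred k | d k != 0]; last first.
  by move: t0; rewrite et big1 ?eqxx // => k _; have /negbFE/eqP := z k.
have e2 : \sum_k d k ^+ 2 = (\sum_k d k) ^+ 2.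
  by apply: complexI; rewrite -(eigen_trsq eP) tP2 et rmorphXn.
have dz k : k != k0 -> d k = 0.
  move=> kk; apply/eqP/negPn/negP => dk.
  have : 0 < d k * d k0 by rewrite mulr_gt0 // lt0r d0 andbT.
  suff : d k * d k0 <= 0 by move=> h /lt_le_trans/(_ h); rewrite ltxx.
  have : \sum_a \sum_(b | b != a) d a * d b = 0.
    move: e2; rewrite [in RHS]expr2 mulr_suml.
    have -> : \sum_a d a * \sum_b d b = \sum_a d a ^+ 2 + \sum_a \sum_(b | b != a) d a * d b.
      rewrite -big_split; apply: eq_bigr => a _ /=.
      by rewrite (bigD1 a) //= mulrDr -expr2 mulr_sumr.
    by move=> h; apply: (addrI (\sum_k d k ^+ 2)); rewrite -h addr0.
  move=> <-; rewrite (bigD1 k) //= (bigD1 k0) /=; last by rewrite eq_sym.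
  rewrite -addrA lerDl addr_ge0 //.
    by apply: sumr_ge0 => b _; rewrite mulr_ge0.
  by apply: sumr_ge0 => a _; apply: sumr_ge0 => b _; rewrite mulr_ge0.
exists (V k0) => k l; rewrite {1}(eigen_eq eP) conj_diagE.
rewrite (bigD1 k0) //= big1 ?addr0 => [|a ak]; last first.
  by rewrite mxE dz // mulr0 mul0r.
rewrite mxE et (bigD1 k0) //= big1 ?addr0 => [|a ak]; last exact: dz.
by rewrite mulrCA mulrA.
Qed.

(** Tight diagonal blocks have rank one, and as their sum is the scalar 1/n their vectors form an
    orthonormal basis; rotating the second factor turns it into the standard basis. *)
Lemma extremal_normal_form W : extremal W -> exists2 B : 'M[C]_n, B \is unitarymx &
  forall i k l, local 1%:M B W (ix i k) (ix i l) =
    if (k == i) && (l == i) then n%:R^-1 else 0.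
Proof.
move=> eW; have bW : block_positive W by case: eW.
have nz : (n%:R^-1 : C) != 0 by rewrite invr_eq0 pnatr_eq0 -lt0n.
have P i : exists f : 'rV[C]_n, forall k l,
    block W i i k l = n%:R^-1 * ((f 0 k)^* * f 0 l).
  have [||||f ef] := @rank_one_psd (block W i i) (n%:R^-1) nz.
  - by move=> p q; rewrite !mxE (bp_herm bW).
  - exact: diag_block_ge0.
  - exact: extremal_tr_block.
  - rewrite expr2 -{1}(extremal_tr_block eW i) -(extremal_tr_block eW i).
    rewrite -(extremal_block eW); apply: eq_bigr => k _; rewrite mxE.
    by apply: eq_bigr => l _; rewrite !mxE normCK (bp_herm bW).
  by exists (\row_k f k) => k l; rewrite !mxE -ef mxE.
have [f ef] := fin_all_exists P.
pose F := \matrix_(i, k) f i 0 k.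
have uF : F \is unitarymx.
  rewrite -trmxC_unitary; apply/unitarymxP/matrixP => k l; rewrite trmxCK !mxE.
  have /matrixP/(_ k l) := extremal_right_marginal eW.
  rewrite summxE; under eq_bigr do rewrite ef.
  rewrite -mulr_sumr mxE => e; apply: (mulfI nz); rewrite mulr_natr -[RHS]e.
  by congr (_ * _); apply: eq_bigr => i _; rewrite !mxE.
exists F => // i k l.
have -> : local 1%:M F W (ix i k) (ix i l) = block (local 1%:M F W) i i k l by rewrite [RHS]mxE.
rewrite local_right_block !mxE.
transitivity (n%:R^-1 * ((\sum_a F k a * (F i a)^*) * (\sum_b F i b * (F l b)^*))).
  rewrite mulr_sumr mulr_sumr; apply: eq_bigr => b _.
  rewrite !mxE mulr_suml mulr_suml mulr_sumr; apply: eq_bigr => a _.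
  by rewrite ef !mxE; ring.
rewrite !unitary_rowE // [i == l]eq_sym.
by case: (k == i); case: (l == i); rewrite ?mulr1 ?mulr0 ?mul0r ?mulr0.
Qed.

(** Polarization with the test vectors (1, 0), (0, 1), (1, 1) and (1, i). *)
Lemma sesq_two (B : 'M[C]_n) k l : k != l ->
  (forall x y : C, sesq B (fun c => if c == k then x else if c == l then y else 0)
     (fun c => if c == k then x else if c == l then y else 0) = 0) ->
  B k l = 0.
Proof.
move=> kl H; have lk : l != k by rewrite eq_sym.
have E x y : x^* * B k k * x + x^* * B k l * y + (y^* * B l k * x + y^* * B l l * y) = 0.
  have sum2 (G : 'I_n -> C) : (forall i, i != k -> i != l -> G i = 0) ->
      \sum_i G i = G k + G l.
    move=> G0; rewrite (bigD1 k) //= (bigD1 l) //= big1 ?addr0 //.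
    by move=> i /andP[]; exact: G0.
  rewrite -(H x y) /sesq sum2 => [|i /negbTE ik /negbTE il]; last first.
    by apply: big1 => j _; rewrite ik il conjC0 !mul0r.
  rewrite eqxx (negbTE lk) eqxx.
  rewrite sum2 => [|i /negbTE ik /negbTE il]; last by rewrite ik il mulr0.
  rewrite [in RHS]eqxx [in RHS](negbTE lk) eqxx.
  rewrite sum2 => [|i /negbTE ik /negbTE il]; last by rewrite ik il mulr0.
  by rewrite eqxx (negbTE lk) eqxx.
have e1 := E 1 0; have e2 := E 0 1; have e3 := E 1 1; have e4 := E 1 'i.
rewrite !(conjC0, conjC1, mul0r, mulr0, mul1r, mulr1, addr0, add0r) in e1 e2 e3 e4.
rewrite e1 e2 !(addr0, add0r, mulr0, mul0r) conjCi in e3 e4.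
have i0 : ('i : C) != 0 by rewrite neq0Ci.
have : 'i * (B k l - B l k) = 0 by rewrite -[RHS]e4; ring.
move/eqP; rewrite mulf_eq0 (negbTE i0) subr_eq0 => /eqP e5.
move: e3; rewrite -e5 -mulr2n => /eqP; rewrite mulrn_eq0 /= => /eqP //.
Qed.

(** In normal form W only has entries between |ij> and |ji>. Its partial transpose then lives on the
    span of the |ii>, where a form value is a value of W at a product vector. *)
Lemma extremal_decomposable W : extremal W -> decomposable W.
Proof.
move=> eW0; have [B uB nf] := extremal_normal_form eW0.
rewrite -(local_unitaryK W (unitarymx1 _) uB); apply: local_decomposable.
have := local_extremal (unitarymx1 _) uB eW0.
move: (local 1%:M B W) nf => {eW0}W nf eW.
have bW : block_positive W by case: eW.
have nz : (n%:R : C) != 0 by rewrite pnatr_eq0 -lt0n.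
have sii i v : sesq (block W i i) v v = n%:R^-1 * `|v i| ^+ 2.
  rewrite /sesq (bigD1 i) //= (bigD1 i) //= mxE nf !eqxx.
  rewrite big1 => [|k ki]; last by rewrite mxE nf (negbTE ki) andbF mulr0 mul0r.
  rewrite big1 => [|k ki]; last first.
    by apply: big1 => l _; rewrite mxE nf (negbTE ki) mulr0 mul0r.
  by rewrite !addr0 normCK /=; ring.
have zero i j k l : i != j -> (k, l) != (i, j) -> (k, l) != (j, i) ->
    W (ix i k) (ix j l) = 0.
  move=> ij n1 n2.
  (* The diagonal forms are |v_i|^2 / n, so the block form vanishes with either coordinate, and
     polarization removes all entries but two. *)
  have vz v : v i = 0 \/ v j = 0 -> sesq (block W i j) v v = 0.
    move=> h; have := block_cs bW i j v; rewrite !sii => le.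
    apply/eqP; rewrite -normr_eq0 -sqrf_eq0 eq_le exprn_ge0 // andbT.
    apply: le_trans le _; case: h => ->; rewrite normr0 expr0n mulr0 ?mul0r ?mulr0 //.
  have -> : W (ix i k) (ix j l) = block W i j k l by rewrite mxE.
  have [ekl|kl] := eqVneq k l; last first.
    apply: sesq_two => // x y; apply: vz.
    have [ik|ik] := eqVneq i k.
      right; have [jk|jk] := eqVneq j k; first by rewrite ik jk eqxx in ij.
      have [jl|//] := eqVneq j l.
      by rewrite ik jl eqxx in n1.
    have [il|il] := eqVneq i l; last by left.
    right; have [jk|jk] := eqVneq j k; first by rewrite il jk eqxx in n2.
    by have [jl|//] := eqVneq j l; rewrite il jl eqxx in ij.
  subst l; have := vz (fun c => (c == k)%:R).
  rewrite /sesq (bigD1 k) //= (bigD1 k) //= eqxx conjC1 mul1r mulr1.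
  rewrite big1 => [|c ck]; last by rewrite (negbTE ck) mulr0.
  rewrite big1 => [|c ck]; last first.
    by apply: big1 => c' _; rewrite (negbTE ck) conjC0 !mul0r.
  rewrite !addr0 => -> //.
  by have [ik|ik] := eqVneq i k; [right|left] => //; rewrite -ik eq_sym (negbTE ij).
(* Only one entry of the row |ij> is left, and it carries the whole row norm. *)
have swap i j : i != j -> `|W (ix i j) (ix j i)| ^+ 2 = n%:R ^- 2.
  move=> ij; rewrite -(extremal_row eW (ix i j)) sum_ix (bigD1 j) //= (bigD1 i) //=.
  rewrite big1 => [|l li]; last first.
    rewrite zero ?normr0 ?expr0n // xpair_eqE ?(negbTE li) ?andbF //.
    by rewrite eq_sym (negbTE ij).
  rewrite big1 ?addr0 // => q qj; apply: big1 => l _.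
  have [->|qi] := eqVneq q i.
    by rewrite nf eq_sym (negbTE ij) normr0 expr0n.
  rewrite zero ?normr0 ?expr0n // 1?eq_sym // xpair_eqE.
    by rewrite (negbTE ij).
  by rewrite (negbTE qj).
have supp i k j l : ~~ ((k == j) && (l == i)) -> W (ix i k) (ix j l) = 0.
  have [->|ij] := eqVneq i j; first by rewrite nf => /negbTE->.
  move=> h; have [/eqP|n1] := eqVneq (k, l) (i, j); last first.
    by apply: zero => //; rewrite xpair_eqE.
  rewrite xpair_eqE => /andP[/eqP-> /eqP->].
  (* The swap entry already exhausts the Frobenius norm of the block, so the other remaining entry
     is 0. *)
  have := extremal_block eW i j; rewrite !(extremal_tr_block eW) -invfM -expr2.
  have : `|W (ix i i) (ix j j)| ^+ 2 + `|W (ix i j) (ix j i)| ^+ 2 <=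
      \sum_k \sum_l `|W (ix i k) (ix j l)| ^+ 2.
    rewrite (bigD1 i) //=; apply: lerD.
      by rewrite (bigD1 j) //= lerDl sumr_ge0 // => c _; apply: exprn_ge0.
    rewrite (bigD1 j) /= 1?eq_sym // (bigD1 i) //= -addrA lerDl addr_ge0 //.
      by rewrite sumr_ge0 // => c _; apply: exprn_ge0.
    by apply: sumr_ge0 => c _; apply: sumr_ge0 => c' _; apply: exprn_ge0.
  rewrite swap // => le1 e; move: le1; rewrite e -subr_ge0 opprD addrCA subrr addr0.
  by rewrite oppr_ge0 => le2; apply/eqP; rewrite -normr_eq0 -sqrf_eq0 eq_le le2 exprn_ge0.
apply: ptrans_psd_decomposable; apply/psdP; split=> [p q|v].
  by rewrite !mxE (bp_herm bW).
(* The product of the all-ones vector with the diagonal coordinates of [v]. *)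
have [_ /(_ (fun=> 1) (fun k => v (ix k k)))] := (block_positiveP W).1 bW.
congr (0 <= _); transitivity (\sum_i \sum_j (v (ix j j))^* * W (ix i j) (ix j i) * v (ix i i)).
  apply: eq_bigr => i _; apply: eq_bigr => j _; rewrite conjC1 !mul1r /sesq.
  rewrite (bigD1 j) //= (bigD1 i) //= mxE.
  rewrite big1 => [|l li]; last by rewrite mxE supp ?(negbTE li) ?andbF ?mulr0 ?mul0r.
  rewrite big1 ?addr0 // => k kj; apply: big1 => l _.
  by rewrite mxE supp ?(negbTE kj) ?mulr0 ?mul0r.
rewrite exchange_big /sesq sum_ix; apply: eq_bigr => i _ /=.
rewrite [RHS](bigD1 i) //= sum_ix [X in _ = _ + X]big1 ?addr0 => [|k ki]; last first.
  rewrite sum_ix; apply: big1 => j _; apply: big1 => l _.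
  by rewrite ptransE supp ?(negbTE ki) ?mulr0 ?mul0r.
apply: eq_bigr => j _; rewrite (bigD1 j) //= big1 ?addr0 => [|l lj].
  by rewrite ptransE.
by rewrite ptransE supp ?(negbTE lj) ?andbF ?mulr0 ?mul0r.
Qed.

(** Equality in Cauchy-Schwarz over n^2 eigenvalues: the squared deviations of |d_k| from 1/n sum to
    tr W^2 - 1, which is at most 0. *)
Lemma max_norm1_decomposable W V d : block_positive W -> \tr W = 1 ->
  eigensystem W V d -> \sum_k `|d k| = n%:R -> decomposable W.
Proof.
move=> bW tW eW sd; apply: extremal_decomposable; split=> //.
have nz : (n%:R : R) != 0 by rewrite pnatr_eq0 -lt0n.
have d2 : \sum_k d k ^+ 2 <= 1.
  have := trsq_le bW; rewrite tW expr1n (eigen_trsq eW).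
  by rewrite -(rmorph1 (real_complex R)) lecR.
have sum0 : \sum_k (`|d k| - n%:R^-1) ^+ 2 <= 0.
  have -> : \sum_k (`|d k| - n%:R^-1) ^+ 2 = \sum_k d k ^+ 2 - 1.
    transitivity (\sum_k (d k ^+ 2 - 2 * n%:R^-1 * `|d k| + n%:R ^- 2)).
      by apply: eq_bigr => k _; rewrite sqrrB real_normK ?num_real // expr2 invfM; ring.
    rewrite big_split sumrB -mulr_sumr sd sumr_const card_ord /=.
    have -> : (n%:R ^- 2 : R) *+ (n * n) = 1.
      by rewrite -[LHS]mulr_natr natrM -expr2 mulVf ?expf_neq0.
    by field.
  by rewrite subr_le0.
have dk k : d k ^+ 2 = n%:R ^- 2.
  have /eqP : \sum_k (`|d k| - n%:R^-1) ^+ 2 = 0.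
    by apply/eqP; rewrite eq_le sum0 sumr_ge0 // => a _; exact: sqr_ge0.
  rewrite psumr_eq0 => [/allP/(_ k)|a _]; last exact: sqr_ge0.
  rewrite mem_index_enum => /(_ isT) /=; rewrite sqrf_eq0 subr_eq0 => /eqP e.
  by rewrite -(real_normK (num_real (d k))) e exprVn.
rewrite (eigen_square_scalar eW dk); congr (_%:M).
by rewrite fmorphV rmorphXn /= rmorph_nat.
Qed.

End Extremal.

(** * Detecting nondecomposability *)

Section Vectors.
Variables (R : realType) (m n : nat).
Local Notation C := R[i].
Local Notation ix := (@mxvec_index m n).
Implicit Types W P Q : 'M[C]_(m * n).

Definition herm W := forall p q, (W q p)^* = W p q.

Definition outer (u : 'I_(m * n) -> C) : 'M[C]_(m * n) :=
  \matrix_(p, q) (u p * (u q)^*).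

(** Sparse vectors as lists of coefficients and positions; forms at them reduce to short sums over
    lists that [ring] can finish. *)
Definition comb (s : seq (C * 'I_(m * n))) (q : 'I_(m * n)) : C :=
  \sum_(x <- s) x.1 * (q == x.2)%:R.

Lemma sesqD W P u v : sesq (W + P) u v = sesq W u v + sesq P u v.
Proof.
rewrite /sesq -big_split; apply: eq_bigr => p _ /=; rewrite -big_split.
by apply: eq_bigr => q _; rewrite mxE /=; ring.
Qed.

Lemma sesqZ c W u v : sesq (c *: W) u v = c * sesq W u v.
Proof.
rewrite /sesq mulr_sumr; apply: eq_bigr => p _; rewrite mulr_sumr.
by apply: eq_bigr => q _; rewrite mxE; ring.
Qed.

Lemma hermD W P : herm W -> herm P -> herm (W + P).
Proof. by move=> hW hP p q; rewrite !mxE rmorphD /= hW hP. Qed.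

Lemma hermZ (c : C) W : c \is Num.real -> herm W -> herm (c *: W).
Proof. by move=> cr hW p q; rewrite !mxE rmorphM /= hW conj_Creal. Qed.

Lemma herm_outer u : herm (outer u).
Proof. by move=> p q; rewrite !mxE rmorphM /= conjCK mulrC. Qed.

Lemma herm_ptrans W : herm W -> herm (ptrans W).
Proof. by move=> hW p q; rewrite !mxE hW. Qed.

Lemma psd_outer u : psdmx (outer u).
Proof.
have := @outer_psd R m n u 1 ler01; congr psdmx.
by apply/matrixP => p q; rewrite !mxE mul1r.
Qed.

Lemma sesq_outer u v : sesq (outer u) v v = `|\sum_q (u q)^* * v q| ^+ 2.
Proof.
rewrite normCK rmorph_sum mulr_sumr /sesq; apply: eq_bigr => p _.
rewrite mulr_suml; apply: eq_bigr => q _.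
by rewrite mxE !rmorphM /= conjCK; ring.
Qed.

Lemma dot_comb s v : \sum_q (comb s q)^* * v q = \sum_(x <- s) (x.1)^* * v x.2.
Proof.
under eq_bigr do rewrite /comb rmorph_sum mulr_suml.
rewrite exchange_big; apply: eq_bigr => x _ /=.
rewrite (bigD1 x.2) //= big1 ?addr0 => [|q qx].
  by rewrite eqxx mulr1.
by rewrite (negbTE qx) mulr0 conjC0 mul0r.
Qed.

Lemma sesq_outer_comb s v :
  sesq (outer (comb s)) v v = `|\sum_(x <- s) (x.1)^* * v x.2| ^+ 2.
Proof. by rewrite sesq_outer dot_comb. Qed.

Lemma sesq_comb s W : sesq W (comb s) (comb s) =
  \sum_(x <- s) \sum_(y <- s) (x.1)^* * y.1 * W x.2 y.2.
Proof.
transitivity (\sum_p (comb s p)^* * (\sum_q W p q * comb s q)).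
  apply: eq_bigr => p _; rewrite mulr_sumr; apply: eq_bigr => q _.
  by rewrite mulrA.
rewrite dot_comb; apply: eq_bigr => x _; rewrite mulr_sumr.
transitivity (\sum_q (x.1)^* * W x.2 q * \sum_(y <- s) y.1 * (q == y.2)%:R).
  by apply: eq_bigr => q _; rewrite mulrA.
under eq_bigr do rewrite mulr_sumr.
rewrite exchange_big; apply: eq_bigr => y _ /=.
rewrite (bigD1 y.2) //= big1 ?addr0 => [|q qx]; first by rewrite eqxx mulr1; ring.
by rewrite (negbTE qx) !mulr0.
Qed.

(** On product vectors partial transposition only conjugates the first factor, hence it preserves
    block positivity. *)
Lemma sesq_ptrans_prod W (a : 'I_m -> C) (b : 'I_n -> C) :
  sesq (ptrans W) (fun p => a (idx p).1 * b (idx p).2) (fun p => a (idx p).1 * b (idx p).2)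
  = sesq W (fun p => (a (idx p).1)^* * b (idx p).2) (fun p => (a (idx p).1)^* * b (idx p).2).
Proof.
rewrite sesq_prod (sesq_prod W (fun i => (a i)^*)) [LHS]exchange_big; apply: eq_bigr => i _; apply: eq_bigr => j _ /=.
have -> : block (ptrans W) j i = block W i j.
  by apply/matrixP => k l; rewrite !mxE !idxE.
by rewrite conjCK mulrC [in RHS]mulrC; congr (_ * _); rewrite mulrC.
Qed.

Lemma block_positive_prod W : block_positive W <-> herm W /\
  forall (a : 'I_m -> C) (b : 'I_n -> C),
  0 <= sesq W (fun p => a (idx p).1 * b (idx p).2) (fun p => a (idx p).1 * b (idx p).2).
Proof.
rewrite block_positiveP; split=> -[h p]; split=> // a b; last by rewrite -sesq_prod.
by rewrite sesq_prod.
Qed.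

Lemma ptrans_block_positive W : block_positive W -> block_positive (ptrans W).
Proof.
rewrite !block_positive_prod => -[h p]; split=> [|a b]; first exact: herm_ptrans.
by rewrite sesq_ptrans_prod; apply: (p (fun i => (a i)^*)).
Qed.

Lemma ptransD W P : ptrans (W + P) = ptrans W + ptrans P.
Proof. by apply/matrixP => p q; rewrite !mxE. Qed.

Lemma ptransZ c W : ptrans (c *: W) = c *: ptrans W.
Proof. by apply/matrixP => p q; rewrite !mxE. Qed.

(** The trace against an unnormalised PPT state, described only by linearity and its signs on the
    two cones. *)
Definition detector (l : 'M[C]_(m * n) -> C) :=
  [/\ forall W P, l (W + P) = l W + l P, forall c W, l (c *: W) = c * l W,
      forall P, psdmx P -> 0 <= l P & forall Q, psdmx Q -> 0 <= l (ptrans Q)].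

Lemma detector_nd l W : detector l -> l W < 0 -> ~ decomposable W.
Proof.
move=> [lD _ lP lQ] lW [P [Q [pP pQ eW]]]; move: lW.
by rewrite eW lD => /lt_geF; rewrite (addr_ge0 (lP _ pP) (lQ _ pQ)).
Qed.

Lemma detector_ptrans l : detector l -> detector (fun W => l (ptrans W)).
Proof.
move=> [lD lZ lP lQ]; split=> [W P|c W|//|Q pQ]; first by rewrite ptransD lD.
  by rewrite ptransZ lZ.
by rewrite ptransK; apply: lP.
Qed.

End Vectors.

(** * Scalar inequalities behind the explicit witnesses *)

Section RealNorm.
Variable R : realType.
Local Notation C := R[i].
Local Notation "x %:C" := (real_complex R x).

(** The modulus as a real number, where the order is total and [lra] applies. *)
Definition rnorm (z : C) : R := complex.Re `|z|.

Lemma rnormE z : `|z| = (rnorm z)%:C.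
Proof. by rewrite /rnorm RRe_real // normr_real. Qed.

Lemma rnorm_ge0 z : 0 <= rnorm z.
Proof. by rewrite -lecR rmorph0 -rnormE. Qed.

Lemma rnormM x y : rnorm (x * y) = rnorm x * rnorm y.
Proof. by apply: complexI; rewrite rmorphM -!rnormE normrM. Qed.

Lemma rnormD x y : rnorm (x + y) <= rnorm x + rnorm y.
Proof. by rewrite -lecR rmorphD -!rnormE ler_normD. Qed.

Lemma rnormN x : rnorm (- x) = rnorm x.
Proof. by apply: complexI; rewrite -!rnormE normrN. Qed.

Lemma rnormJ x : rnorm (x^*) = rnorm x.
Proof. by apply: complexI; rewrite -!rnormE norm_conjC. Qed.

Lemma rnorm_real (x : R) : 0 <= x -> rnorm x%:C = x.
Proof. by move=> x0; apply: complexI; rewrite -rnormE ger0_norm // ler0c. Qed.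

(** The difference of the sides is (t0 - t1 - t2)^2 + 4 (S - t1 t2). As t0 is the largest, the cube
    of t1 t2 is at most (u v w)^2, which is at most S^3. *)
Lemma choi_real_max (t0 t1 t2 u v w : R) :
  0 <= t0 -> 0 <= t1 -> 0 <= t2 -> t1 <= t0 -> t2 <= t0 ->
  t0 * t1 * t2 = u * v * w ->
  (t0 + t1 + t2) ^+ 2 <=
    2 * (t0 ^+ 2 + t1 ^+ 2 + t2 ^+ 2) + 4 * (u ^+ 2 + v ^+ 2 + w ^+ 2).
Proof.
move=> h0 h1 h2 h10 h20 e; set S := u ^+ 2 + v ^+ 2 + w ^+ 2.
have u0 := sqr_ge0 u; have v0 := sqr_ge0 v; have w0 := sqr_ge0 w.
have S0 : 0 <= S by rewrite !addr_ge0.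
have q0 : 0 <= t1 * t2 by rewrite mulr_ge0.
have qS : t1 * t2 <= S.
  rewrite -(@ler_pXn2r _ 3) ?nnegrE //.
  apply: (@le_trans _ _ ((u ^+ 2) * (v ^+ 2) * (w ^+ 2))).
    have -> : u ^+ 2 * v ^+ 2 * w ^+ 2 = t0 ^+ 2 * (t1 * t2) ^+ 2.
      by transitivity ((u * v * w) ^+ 2); [ring|rewrite -e; ring].
    rewrite exprS ler_wpM2r ?sqr_ge0 // expr2.
    by apply: ler_pM.
  have -> : S ^+ 3 = S * S * S by ring.
  have uS : u ^+ 2 <= S by rewrite /S -addrA lerDl addr_ge0.
  have vS : v ^+ 2 <= S by rewrite /S addrAC lerDr addr_ge0.
  have wS : w ^+ 2 <= S by rewrite /S lerDr addr_ge0.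
  by apply: ler_pM wS => //; [rewrite mulr_ge0|apply: ler_pM].
rewrite -subr_ge0.
have -> : 2 * (t0 ^+ 2 + t1 ^+ 2 + t2 ^+ 2) + 4 * S - (t0 + t1 + t2) ^+ 2 =
  (t0 - t1 - t2) ^+ 2 + 4 * (S - t1 * t2) by ring.
by rewrite addr_ge0 ?sqr_ge0 // mulr_ge0 // subr_ge0.
Qed.

Lemma choi_real (t0 t1 t2 u v w : R) :
  0 <= t0 -> 0 <= t1 -> 0 <= t2 -> t0 * t1 * t2 = u * v * w ->
  (t0 + t1 + t2) ^+ 2 <=
    2 * (t0 ^+ 2 + t1 ^+ 2 + t2 ^+ 2) + 4 * (u ^+ 2 + v ^+ 2 + w ^+ 2).
Proof.
move=> h0 h1 h2 e.
have [l10|/ltW l01] := leP t1 t0; have [l20|/ltW l02] := leP t2 t0.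
- exact: choi_real_max.
- have := @choi_real_max t2 t0 t1 u v w h2 h0 h1 l02 (le_trans l10 l02).
  have -> : t2 * t0 * t1 = u * v * w by rewrite -e; ring.
  by move=> /(_ erefl); lra.
- have := @choi_real_max t1 t0 t2 u v w h1 h0 h2 l01 (le_trans l20 l01).
  have -> : t1 * t0 * t2 = u * v * w by rewrite -e; ring.
  by move=> /(_ erefl); lra.
have [l21|/ltW l12] := leP t2 t1.
  have := @choi_real_max t1 t0 t2 u v w h1 h0 h2 l01 l21.
  have -> : t1 * t0 * t2 = u * v * w by rewrite -e; ring.
  by move=> /(_ erefl); lra.
have := @choi_real_max t2 t0 t1 u v w h2 h0 h1 l02 l12.
have -> : t2 * t0 * t1 = u * v * w by rewrite -e; ring.
by move=> /(_ erefl); lra.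
Qed.

(** The real inequality applies because the three moduli |x_i y_i| and the three cyclically shifted
    ones have the same product. *)
Lemma choi_complex (x0 x1 x2 y0 y1 y2 : C) :
  `|x0 * y0 + x1 * y1 + x2 * y2| ^+ 2 <=
    2 * (`|x0 * y0| ^+ 2 + `|x1 * y1| ^+ 2 + `|x2 * y2| ^+ 2) +
    4 * (`|x0 * y1| ^+ 2 + `|x1 * y2| ^+ 2 + `|x2 * y0| ^+ 2).
Proof.
rewrite !rnormE -!rmorphXn -!rmorphD.
rewrite -[2](rmorph_nat (real_complex R)) -[4](rmorph_nat (real_complex R)).
rewrite -!rmorphM -rmorphD lecR.
apply: (@le_trans _ _ ((rnorm (x0 * y0) + rnorm (x1 * y1) + rnorm (x2 * y2)) ^+ 2)).
  rewrite ler_pXn2r ?nnegrE ?addr_ge0 ?rnorm_ge0 //.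
  by rewrite (le_trans (rnormD _ _)) // lerD2r rnormD.
by apply: choi_real; rewrite ?rnorm_ge0 // !rnormM; ring.
Qed.

(* The six squares of the witness detecting Horodecki's 2 x 4 states control
   [|x0 y1|]: the second and fifth give [(|x0|^2 - |x1|^2) y1] and
   [(|x0|^2 - |x1|^2) y2], the others then give [|x1|^2 y1]. *)
Lemma horodecki_bound (x0 x1 y0 y1 y2 y3 : C) :
  `|x0 * y1| ^+ 2 <= 96 * (
    `|x0 * y0 - x1 * y1| ^+ 2 + `|x0 * y1 - x1 * y2| ^+ 2 +
    `|x0 * y2 - x1 * y3 + 2^-1 * (x1 * y0)| ^+ 2 +
    `|x0^* * y1 - x1^* * y0 + 2^-1 * (x1^* * y3)| ^+ 2 +
    `|x0^* * y2 - x1^* * y1| ^+ 2 + `|x0^* * y3 - x1^* * y2| ^+ 2).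
Proof.
set e1 := x0 * y0 - x1 * y1; set e2 := x0 * y1 - x1 * y2.
set e3 := x0 * y2 - x1 * y3 + 2^-1 * (x1 * y0).
set e4 := x0^* * y1 - x1^* * y0 + 2^-1 * (x1^* * y3).
set e5 := x0^* * y2 - x1^* * y1; set e6 := x0^* * y3 - x1^* * y2.
have E2 : x0 * (x0^* * y1) = x0^* * e2 + x1 * e5 + x1 * (x1^* * y1).
  by rewrite /e2 /e5; ring.
(* The terms with coefficient 1/2 are essential: without them the six expressions vanish together
   for |x0| = |x1| and a suitable geometric sequence y. *)
have E3 : 2^-1 * (x0^* * (x1 * (x1 * y1))) = x0 * (x0^* * e3) + x0 * (x1 * e6)
   - 2^-1 * (x1 * (x0^* * e1)) - x0 * (x1^* * e2) - x0 * (x0 * e5).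
  by rewrite /e1 /e2 /e3 /e5 /e6; ring.
rewrite !rnormE -!rmorphXn -!rmorphD -[96](rmorph_nat (real_complex R)) -rmorphM lecR.
have n2 : rnorm (2^-1 : C) = 2^-1.
  have -> : (2^-1 : C) = (2^-1)%:C by rewrite fmorphV rmorph_nat.
  by rewrite rnorm_real // invr_ge0.
have I2 : rnorm x0 * (rnorm x0 * rnorm y1) <=
    rnorm x0 * rnorm e2 + rnorm x1 * rnorm e5 + rnorm x1 * (rnorm x1 * rnorm y1).
  have /(congr1 rnorm) := E2; rewrite !rnormM !rnormJ => ->.
  rewrite (le_trans (rnormD _ _)) // !rnormM rnormJ lerD2r.
  by rewrite (le_trans (rnormD _ _)) // !rnormM rnormJ.
have I3 : 2^-1 * (rnorm x0 * (rnorm x1 * (rnorm x1 * rnorm y1))) <=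
    rnorm x0 * (rnorm x0 * rnorm e3) + rnorm x0 * (rnorm x1 * rnorm e6) +
    2^-1 * (rnorm x1 * (rnorm x0 * rnorm e1)) + rnorm x0 * (rnorm x1 * rnorm e2) +
    rnorm x0 * (rnorm x0 * rnorm e5).
  have /(congr1 rnorm) := E3; rewrite !rnormM !rnormJ n2 => ->.
  do 4! (rewrite (le_trans (rnormD _ _)) // lerD // ?rnormN ?rnormM ?rnormJ ?n2 //).
have g1 := rnorm_ge0 e1; have g2 := rnorm_ge0 e2; have g3 := rnorm_ge0 e3.
have g4 := rnorm_ge0 e4; have g5 := rnorm_ge0 e5; have g6 := rnorm_ge0 e6.
have ga := rnorm_ge0 x0; have gb := rnorm_ge0 x1; have gy := rnorm_ge0 y1.
rewrite rnormM.
move: I2 I3 g1 g2 g3 g4 g5 g6 ga gb gy.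
move: (rnorm e1) (rnorm e2) (rnorm e3) (rnorm e4) (rnorm e5) (rnorm e6)
  (rnorm x0) (rnorm x1) (rnorm y1) => f1 f2 f3 f4 f5 f6 a b y I2 I3 g1 g2 g3 g4 g5 g6 ga gb gy.
set E := f1 + f2 + f3 + f4 + f5 + f6.
have E0 : 0 <= E by rewrite !addr_ge0.
have ayE : a * y <= 4 * E.
  have [a0|an] := eqVneq a 0; first by rewrite a0 mul0r mulr_ge0.
  have ap : 0 < a by rewrite lt_def an.
  have {}I3 : b * (b * y) <= 2 * (a * (f3 + f5) + b * (f6 + f1 + f2)).
    rewrite -(ler_pM2l ap); move: I3.
    have bf : 0 <= b * (a * f1) by rewrite !mulr_ge0.
    lra.
  (* The estimates are homogeneous in (a, b); each case divides by the larger of the two. *)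
  have [ba|ab] := leP b a.
    rewrite -(ler_pM2l ap).
    have h1 : b * f5 <= a * f5 by rewrite ler_wpM2r.
    have h2 : b * (f6 + f1 + f2) <= a * (f6 + f1 + f2) by rewrite ler_wpM2r // !addr_ge0.
    have k2 : 0 <= a * f2 by rewrite mulr_ge0.
    have k1 : 0 <= a * f1 by rewrite mulr_ge0.
    have k3 : 0 <= a * f3 by rewrite mulr_ge0.
    have k4 : 0 <= a * f4 by rewrite mulr_ge0.
    have k5 : 0 <= a * f5 by rewrite mulr_ge0.
    have k6 : 0 <= a * f6 by rewrite mulr_ge0.
    rewrite /E; lra.
  have bp : 0 < b by apply: le_lt_trans ab.
  rewrite -(ler_pM2l bp).
  have h1 : a * (f3 + f5) <= b * (f3 + f5) by rewrite ler_wpM2r ?addr_ge0 // ltW.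
  have h2 : b * (a * y) <= b * (b * y).
    by rewrite ler_wpM2l // ler_wpM2r // ltW.
  have k1 : 0 <= b * f1 by rewrite mulr_ge0.
  have k2 : 0 <= b * f2 by rewrite mulr_ge0.
  have k3 : 0 <= b * f3 by rewrite mulr_ge0.
  have k4 : 0 <= b * f4 by rewrite mulr_ge0.
  have k5 : 0 <= b * f5 by rewrite mulr_ge0.
  have k6 : 0 <= b * f6 by rewrite mulr_ge0.
  rewrite /E; lra.
(* The constant is 96 = 4^2 * 6: the linear bound squared, then Cauchy-Schwarz over six terms. *)
apply: (@le_trans _ _ ((4 * E) ^+ 2)).
  by rewrite ler_pXn2r ?nnegrE ?mulr_ge0.
rewrite -subr_ge0.
have -> : 96 * (f1 ^+ 2 + f2 ^+ 2 + f3 ^+ 2 + f4 ^+ 2 + f5 ^+ 2 + f6 ^+ 2) - (4 * E) ^+ 2 =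
  16 * ((f1 - f2) ^+ 2 + (f1 - f3) ^+ 2 + (f1 - f4) ^+ 2 + (f1 - f5) ^+ 2 + (f1 - f6) ^+ 2
   + (f2 - f3) ^+ 2 + (f2 - f4) ^+ 2 + (f2 - f5) ^+ 2 + (f2 - f6) ^+ 2
   + (f3 - f4) ^+ 2 + (f3 - f5) ^+ 2 + (f3 - f6) ^+ 2
   + (f4 - f5) ^+ 2 + (f4 - f6) ^+ 2 + (f5 - f6) ^+ 2) by rewrite /E; ring.
by rewrite mulr_ge0 // !addr_ge0 ?sqr_ge0.
Qed.

End RealNorm.

(** * Explicit witnesses *)

Section Witnesses.
Variables (R : realType) (m n : nat).
Local Notation C := R[i].
Local Notation ix := (@mxvec_index m n).
Implicit Types W P Q : 'M[C]_(m * n).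

Lemma conj_simpl : ((1 : C)^* = 1) * ((-1 : C)^* = -1) * ((2 : C)^* = 2) *
  ((4 : C)^* = 4) * ((2^-1 : C)^* = 2^-1) * ((4^-1 : C)^* = 4^-1).
Proof. by rewrite !rmorphN !fmorphV /= !rmorph_nat conjC1. Qed.

Lemma sesq_outer_combr (u : 'I_(m * n) -> C) (s : seq (C * 'I_(m * n))) : sesq (outer u) (comb s) (comb s) =
  `|\sum_(x <- s) (x.1)^* * u x.2| ^+ 2 :> C.
Proof.
rewrite sesq_outer -norm_conjC rmorph_sum; congr (`|_| ^+ 2).
rewrite -dot_comb; apply: eq_bigr => q _.
by rewrite rmorphM /= conjCK mulrC.
Qed.

Lemma psd_diag_ge0 P p : psdmx P -> 0 <= P p p.
Proof.
move=> /psdP[_ /(_ (comb [:: (1, p)]))]; rewrite sesq_comb !big_cons !big_nil /=.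
by rewrite conjC1 !mul1r !addr0.
Qed.

Section Choi.
Variables (i0 i1 i2 : 'I_m) (k0 k1 k2 : 'I_n).
Hypotheses (hi : uniq [:: i0; i1; i2]) (hk : uniq [:: k0; k1; k2]).

Let neqi : ((i0 == i1) = false) * ((i1 == i0) = false) * ((i0 == i2) = false) *
  ((i2 == i0) = false) * ((i1 == i2) = false) * ((i2 == i1) = false).
Proof.
move: hi; rewrite /= !inE !negb_or andbT => /andP[/andP[/negbTE a /negbTE b] /negbTE c].
by rewrite (eq_sym i1 i0) (eq_sym i2 i0) (eq_sym i2 i1) a b c.
Qed.

Let neqk : ((k0 == k1) = false) * ((k1 == k0) = false) * ((k0 == k2) = false) *
  ((k2 == k0) = false) * ((k1 == k2) = false) * ((k2 == k1) = false).
Proof.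
move: hk; rewrite /= !inE !negb_or andbT => /andP[/andP[/negbTE a /negbTE b] /negbTE c].
by rewrite (eq_sym k1 k0) (eq_sym k2 k0) (eq_sym k2 k1) a b c.
Qed.

Let omega := comb [:: (1 : C, ix i0 k0); (1, ix i1 k1); (1, ix i2 k2)].
Let e i k := comb [:: (1 : C, ix i k)].

(* Four times the Choi term makes block positivity elementary, and the state
   with off-diagonal weights 1/16 and 16 still detects the form. *)
Definition choi_form : 'M[C]_(m * n) :=
  2 *: (outer (e i0 k0) + outer (e i1 k1) + outer (e i2 k2)) +
  4 *: (outer (e i0 k1) + outer (e i1 k2) + outer (e i2 k0)) + (-1) *: outer omega.

Definition choi_functional W : C :=
  sesq W omega omega +
  16^-1 * (W (ix i0 k1) (ix i0 k1) + W (ix i1 k2) (ix i1 k2) + W (ix i2 k0) (ix i2 k0)) +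
  16 * (W (ix i1 k0) (ix i1 k0) + W (ix i2 k1) (ix i2 k1) + W (ix i0 k2) (ix i0 k2)).

Lemma choi_block_positive : block_positive choi_form.
Proof.
apply/block_positive_prod; split.
  do !apply: hermD; apply: hermZ; rewrite ?rpredN ?rpred1 ?realn //;
  do ?apply: hermD; exact: herm_outer.
move=> a b; rewrite !(sesqD, sesqZ) !sesq_outer_comb !big_cons !big_nil /= !conj_simpl.
rewrite !idxE /= !mul1r !addr0 mulN1r subr_ge0 addrA; exact: choi_complex.
Qed.

Lemma choi_detector : detector choi_functional.
Proof.
split=> [W P|c W|P pP|Q pQ].
- by rewrite /choi_functional sesqD !mxE; ring.
- by rewrite /choi_functional sesqZ !mxE; ring.
- rewrite /choi_functional !addr_ge0 ?mulr_ge0 ?invr_ge0 ?addr_ge0 ?psd_diag_ge0 //.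
  by case/psdP: pP.
(* Positivity of the transposed state: the cross terms of [omega] now link positions of weights 1/16
   and 16, and these reciprocal weights complete them to squares with coefficients 1/4 and 4. *)
have -> : choi_functional (ptrans Q) =
    Q (ix i0 k0) (ix i0 k0) + Q (ix i1 k1) (ix i1 k1) + Q (ix i2 k2) (ix i2 k2) +
    (sesq Q (comb [:: (4^-1, ix i0 k1); (4, ix i1 k0)])
            (comb [:: (4^-1, ix i0 k1); (4, ix i1 k0)]) +
     sesq Q (comb [:: (4^-1, ix i1 k2); (4, ix i2 k1)])
            (comb [:: (4^-1, ix i1 k2); (4, ix i2 k1)]) +
     sesq Q (comb [:: (4^-1, ix i2 k0); (4, ix i0 k2)])
            (comb [:: (4^-1, ix i2 k0); (4, ix i0 k2)])).
  rewrite /choi_functional !sesq_comb !big_cons !big_nil /= !conj_simpl !ptransE.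
  by field.
by have [_ pQ'] := (psdP _).1 pQ; rewrite !addr_ge0 ?psd_diag_ge0.
Qed.

Lemma choi_functional_outer u : choi_functional (outer u) =
  (u (ix i0 k0) + u (ix i1 k1) + u (ix i2 k2)) *
  (u (ix i0 k0) + u (ix i1 k1) + u (ix i2 k2))^* +
  16^-1 * (u (ix i0 k1) * (u (ix i0 k1))^* + u (ix i1 k2) * (u (ix i1 k2))^* +
           u (ix i2 k0) * (u (ix i2 k0))^*) +
  16 * (u (ix i1 k0) * (u (ix i1 k0))^* + u (ix i2 k1) * (u (ix i2 k1))^* +
        u (ix i0 k2) * (u (ix i0 k2))^*).
Proof.
rewrite /choi_functional sesq_comb !big_cons !big_nil /= conjC1 !mxE !rmorphD /=.
by ring.
Qed.

Lemma choi_detected : choi_functional choi_form < 0.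
Proof.
have eE i k j l : e i k (ix j l) = ((j == i) && (l == k))%:R.
  by rewrite /e /comb big_cons big_nil addr0 mul1r /= ix_inj.
have oE j l : omega (ix j l) = ((j == i0) && (l == k0))%:R +
    ((j == i1) && (l == k1))%:R + ((j == i2) && (l == k2))%:R.
  by rewrite /omega /comb !big_cons big_nil addr0 !mul1r /= !ix_inj addrA.
have diag i k : (i, k) \in [:: (i0, k0); (i1, k1); (i2, k2)] ->
    choi_functional (outer (e i k)) = 1.
  rewrite !inE !xpair_eqE choi_functional_outer !eE.
  by move=> /or3P[] /andP[/eqP-> /eqP->]; rewrite !eqxx !neqi !neqk /= conjC0; ring.
have off i k : (i, k) \in [:: (i0, k1); (i1, k2); (i2, k0)] ->
    choi_functional (outer (e i k)) = 16^-1.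
  rewrite !inE !xpair_eqE choi_functional_outer !eE.
  by move=> /or3P[] /andP[/eqP-> /eqP->];
    rewrite !eqxx !neqi !neqk /= !conjC0 conjC1; ring.
have om : choi_functional (outer omega) = 9.
  rewrite choi_functional_outer !oE !eqxx !neqi !neqk /= !(addr0, add0r).
  by rewrite !rmorphD /= !conj_simpl !conjC0; ring.
have [lD lZ _ _] := choi_detector.
rewrite /choi_form !lD !lZ !lD om (diag i0 k0) ?(diag i1 k1) ?(diag i2 k2) ?(off i0 k1)
  ?(off i1 k2) ?(off i2 k0) ?inE ?eqxx ?orbT //.
have -> : 2 * (1 + 1 + 1) + 4 * (16^-1 + 16^-1 + 16^-1) + -1 * 9 = - (9 / 4) :> C.
  by field.
by rewrite oppr_lt0 divr_gt0.
Qed.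

(** Supplies the kernel vectors along whose partial transposes the witness is perturbed. *)
Lemma choi_kernel u : u (ix i0 k0) + u (ix i1 k1) + u (ix i2 k2) = 0 ->
  u (ix i0 k1) = 0 -> u (ix i1 k2) = 0 -> u (ix i2 k0) = 0 ->
  u (ix i1 k0) = 0 -> u (ix i2 k1) = 0 -> u (ix i0 k2) = 0 ->
  choi_functional (outer u) = 0.
Proof.
move=> u0 e1 e2 e3 e4 e5 e6; rewrite choi_functional_outer u0 e1 e2 e3 e4 e5 e6.
by rewrite !mul0r !addr0 !mulr0 !addr0.
Qed.

End Choi.

Section Horodecki.
Variables (i0 i1 : 'I_m) (k0 k1 k2 k3 : 'I_n).
Hypotheses (hi : i0 != i1) (hk : uniq [:: k0; k1; k2; k3]).

Let neqi : ((i0 == i1) = false) * ((i1 == i0) = false).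
Proof. by rewrite [i1 == _]eq_sym (negbTE hi). Qed.

Let neqk : ((k0 == k1) = false) * ((k1 == k0) = false) * ((k0 == k2) = false) *
  ((k2 == k0) = false) * ((k1 == k2) = false) * ((k2 == k1) = false) *
  ((k0 == k3) = false) * ((k3 == k0) = false) * ((k1 == k3) = false) *
  ((k3 == k1) = false) * ((k2 == k3) = false) * ((k3 == k2) = false).
Proof.
move: hk; rewrite /= !inE !negb_or andbT.
move=> /and3P[/and3P[/negbTE a /negbTE b /negbTE c] /andP[/negbTE d /negbTE f] /negbTE g].
rewrite [k1 == k0]eq_sym [k2 == k0]eq_sym [k2 == k1]eq_sym [k3 == k0]eq_sym.
by rewrite [k3 == k1]eq_sym [k3 == k2]eq_sym a b c d f g.
Qed.

Let p0 := comb [:: (1 : C, ix i0 k0); (-1, ix i1 k1)].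
Let p1 := comb [:: (1 : C, ix i0 k1); (-1, ix i1 k2)].
Let p2 := comb [:: (1 : C, ix i0 k2); (-1, ix i1 k3); (2^-1, ix i1 k0)].
Let q0 := comb [:: (1 : C, ix i0 k1); (-1, ix i1 k0); (2^-1, ix i1 k3)].
Let q1 := comb [:: (1 : C, ix i0 k2); (-1, ix i1 k1)].
Let q2 := comb [:: (1 : C, ix i0 k3); (-1, ix i1 k2)].
Let e := comb [:: (1 : C, ix i0 k1)].
Let f0 := comb [:: (1 : C, ix i0 k0); (1, ix i1 k1)].
Let f1 := comb [:: (1 : C, ix i0 k1); (1, ix i1 k2)].
Let f2 := comb [:: (1 : C, ix i0 k2); (1, ix i1 k3)].
Let f3 := comb [:: (1 : C, ix i1 k3); (2, ix i1 k0)].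
Let h0 := comb [:: (1 : C, ix i0 k1); (1, ix i1 k0)].
Let h1 := comb [:: (1 : C, ix i0 k2); (1, ix i1 k1)].
Let h2 := comb [:: (1 : C, ix i0 k3); (1, ix i1 k2)].
Let h3 := comb [:: (1 : C, ix i1 k0); (2, ix i1 k3)].

(** The usual witness of an edge state: projectors on kernel vectors of the state, partial
    transposes of those of its partial transpose, minus a small multiple of a product projector on
    which the state is positive. The multiple comes from [horodecki_bound]. *)
Definition horodecki_form : 'M[C]_(m * n) :=
  outer p0 + outer p1 + outer p2 + ptrans (outer q0 + outer q1 + outer q2) +
  (- 96^-1) *: outer e.

(* Horodecki's 2 x 4 state at b = 3/5, up to normalisation: it is
   annihilated by [p0], [p1], [p2] and its partial transpose by [q0], [q1], [q2]. *)
Definition horodecki_functional W : C :=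
  3 * (sesq W f0 f0 + sesq W f1 f1 + sesq W f2 f2) + sesq W f3 f3 +
  3 * W (ix i0 k3) (ix i0 k3).

Lemma horodecki_block_positive : block_positive horodecki_form.
Proof.
apply/block_positive_prod; split.
  do !apply: hermD; try exact: herm_outer.
    by apply: herm_ptrans; do !apply: hermD; exact: herm_outer.
  apply: hermZ; last exact: herm_outer.
  by rewrite rpredN rpredV realn.
move=> a b; rewrite !(sesqD, sesqZ) sesq_ptrans_prod !sesqD.
rewrite !sesq_outer_comb !big_cons !big_nil /= !conj_simpl.
rewrite !idxE /= !mul1r !addr0 !mulN1r mulNr subr_ge0.
rewrite ler_pdivrMl //.
have := horodecki_bound (a i0) (a i1) (b k0) (b k1) (b k2) (b k3).
by rewrite !addrA.
Qed.

(** The PPT property. Transposition moves the cross terms of [f0], [f1], [f2] onto [h0], [h1], [h2]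
    and fixes that of [f3]; the diagonals agree because 3 + 1 = 4. *)
Lemma horodecki_ptrans Q : horodecki_functional (ptrans Q) =
  3 * (sesq Q h0 h0 + sesq Q h1 h1 + sesq Q h2 h2) + sesq Q h3 h3 +
  3 * Q (ix i0 k0) (ix i0 k0).
Proof.
rewrite /horodecki_functional !sesq_comb !big_cons !big_nil /= !conj_simpl !ptransE.
by ring.
Qed.

Lemma horodecki_outer u : horodecki_functional (outer u) =
  3 * ((u (ix i0 k0) + u (ix i1 k1)) * (u (ix i0 k0) + u (ix i1 k1))^* +
       (u (ix i0 k1) + u (ix i1 k2)) * (u (ix i0 k1) + u (ix i1 k2))^* +
       (u (ix i0 k2) + u (ix i1 k3)) * (u (ix i0 k2) + u (ix i1 k3))^*) +
  (u (ix i1 k3) + 2 * u (ix i1 k0)) * (u (ix i1 k3) + 2 * u (ix i1 k0))^* +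
  3 * (u (ix i0 k3) * (u (ix i0 k3))^*).
Proof.
rewrite /horodecki_functional !sesq_outer_combr !big_cons !big_nil /= !conj_simpl.
by rewrite mxE !mul1r !addr0 !normCK.
Qed.

Lemma horodecki_ptrans_outer u : horodecki_functional (ptrans (outer u)) =
  3 * ((u (ix i0 k1) + u (ix i1 k0)) * (u (ix i0 k1) + u (ix i1 k0))^* +
       (u (ix i0 k2) + u (ix i1 k1)) * (u (ix i0 k2) + u (ix i1 k1))^* +
       (u (ix i0 k3) + u (ix i1 k2)) * (u (ix i0 k3) + u (ix i1 k2))^*) +
  (u (ix i1 k0) + 2 * u (ix i1 k3)) * (u (ix i1 k0) + 2 * u (ix i1 k3))^* +
  3 * (u (ix i0 k0) * (u (ix i0 k0))^*).
Proof.
rewrite horodecki_ptrans !sesq_outer_combr !big_cons !big_nil /= !conj_simpl.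
by rewrite mxE !mul1r !addr0 !normCK.
Qed.

Lemma horodecki_detector : detector horodecki_functional.
Proof.
split=> [W P|c W|P pP|Q pQ].
- by rewrite /horodecki_functional !sesqD !mxE; ring.
- by rewrite /horodecki_functional !sesqZ !mxE; ring.
- have [_ pP'] := (psdP _).1 pP.
  by rewrite /horodecki_functional !addr_ge0 ?mulr_ge0 ?addr_ge0 ?psd_diag_ge0.
have [_ pQ'] := (psdP _).1 pQ; rewrite horodecki_ptrans.
by rewrite !addr_ge0 ?mulr_ge0 ?addr_ge0 ?psd_diag_ge0.
Qed.

Lemma horodecki_kernel : horodecki_functional (outer p0) = 0.
Proof.
rewrite horodecki_outer /p0 /comb !big_cons !big_nil /= !ix_inj !eqxx !neqi !neqk /=.
by rewrite !(mulr0n, mulr1n, mulr1, mulr0, addr0, add0r) subrr !conjC0; ring.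
Qed.

Lemma horodecki_detected : horodecki_functional horodecki_form < 0.
Proof.
have z1 : horodecki_functional (outer p1) = 0.
  rewrite horodecki_outer /p1 /comb !big_cons !big_nil /= !ix_inj !eqxx !neqi !neqk /=.
  by rewrite !(mulr0n, mulr1n, mulr1, mulr0, addr0, add0r) subrr !conjC0; ring.
have z2 : horodecki_functional (outer p2) = 0.
  rewrite horodecki_outer /p2 /comb !big_cons !big_nil /= !ix_inj !eqxx !neqi !neqk /=.
  rewrite !(mulr0n, mulr1n, mulr1, mulr0, addr0, add0r) mulfV ?pnatr_eq0 // addNr subrr.
  by rewrite !conjC0; ring.
have w0 : horodecki_functional (ptrans (outer q0)) = 0.
  rewrite horodecki_ptrans_outer /q0 /comb !big_cons !big_nil /= !ix_inj !eqxx !neqi !neqk /=.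
  rewrite !(mulr0n, mulr1n, mulr1, mulr0, addr0, add0r) mulfV ?pnatr_eq0 // addNr subrr.
  by rewrite !conjC0; ring.
have w1 : horodecki_functional (ptrans (outer q1)) = 0.
  rewrite horodecki_ptrans_outer /q1 /comb !big_cons !big_nil /= !ix_inj !eqxx !neqi !neqk /=.
  by rewrite !(mulr0n, mulr1n, mulr1, mulr0, addr0, add0r) subrr !conjC0; ring.
have w2 : horodecki_functional (ptrans (outer q2)) = 0.
  rewrite horodecki_ptrans_outer /q2 /comb !big_cons !big_nil /= !ix_inj !eqxx !neqi !neqk /=.
  by rewrite !(mulr0n, mulr1n, mulr1, mulr0, addr0, add0r) subrr !conjC0; ring.
have el : horodecki_functional (outer e) = 3.
  rewrite horodecki_outer /e /comb !big_cons !big_nil /= !ix_inj !eqxx !neqi !neqk /=.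
  by rewrite !(mulr0n, mulr1n, mulr1, mulr0, addr0, add0r) conjC0 conjC1; ring.
have [lD lZ _ _] := horodecki_detector.
rewrite !lD lZ ptransD ptransD !lD horodecki_kernel z1 z2 w0 w1 w2 el !add0r mulNr.
by rewrite oppr_lt0 mulr_gt0 // invr_gt0.
Qed.

End Horodecki.

End Witnesses.

(** * Closedness of the decomposable cone *)

From mathcomp Require Import boolp classical_sets topology normedtype.
Import numFieldNormedType.Exports.

Section BolzanoWeierstrass.
Local Open Scope classical_set_scope.

(** A cluster point in a compact box. Approximation at arbitrarily late indices spares the
    extraction of a subsequence. *)
Lemma bolzano_weierstrass (R : realType) (n : nat) (M : R) (u : nat -> 'I_n -> R) :
  (forall k i, `|u k i| <= M) ->
  exists f : 'I_n -> R, forall e, 0 < e -> forall N,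
    exists2 k, (N <= k)%N & forall i, `|f i - u k i| < e.
Proof.
move=> uM; pose A := [set v : 'rV[R]_n | forall i, `[- M, M] (v 0 i)].
have cA : compact A by apply: (@rV_compact _ n (fun=> `[- M, M])) => i; exact: segment_compact.
pose v k : 'rV[R]_n := \row_i u k i.
have [|p [_ clp]] := cA (v @ \oo) _.
  by exists 0%N => // k _ i /=; rewrite mxE in_itv /= -ler_norml.
exists (fun i => p 0 i) => e e0 N.
have [||_ [[k Nk <-]]] := clp (v @` [set k | (N <= k)%N]) (ball p e).
- by exists N => // k /= Nk; exists k.
- exact: nbhsx_ballx.
rewrite /ball /= => -[_ h]; exists k => // i; have := h ord0 i; by rewrite mxE.
Qed.

End BolzanoWeierstrass.

(** Letting e tend to 0 under a linear error. It finishes every limit argument below; e < 1 is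
    offered because the concentrated witnesses ask for it. *)
Lemma le_by_approx (R : realType) (x z c : R) :
  (forall e, 0 < e -> e < 1 -> x <= z + c * e) -> x <= z.
Proof.
move=> H; rewrite leNgt; apply/negP => zx.
have c0 : 0 < `|c| + 1 by rewrite ltr_wpDl.
pose e := Num.min (2^-1) ((x - z) / (2 * (`|c| + 1))).
have e0 : 0 < e by rewrite lt_min invr_gt0 ltr0n divr_gt0 ?subr_gt0 // mulr_gt0.
have e1 : e < 1 by rewrite gt_min; apply/orP; left; lra.
have ee : e * (2 * (`|c| + 1)) <= x - z.
  by rewrite -ler_pdivlMr ?mulr_gt0 // ge_min lexx orbT.
have := H e e0 e1; have := ler_norm c => hc hx.
have : c * e <= `|c| * e by rewrite ler_pM2r.
lra.
Qed.

Section Closed.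
Variables (R : realType) (m n : nat).
Local Notation C := R[i].
Local Notation "x %:C" := (real_complex R x).
Implicit Types W P Q D : 'M[C]_(m * n).

Lemma rnorm_Re (z : C) : `|complex.Re z| <= rnorm z.
Proof. by rewrite -lecR -rnormE normc_ge_Re. Qed.

Lemma rnorm_Im (z : C) : `|complex.Im z| <= rnorm z.
Proof.
have := rnorm_Re (- (z * 'i%C)); rewrite rnormN rnormM.
have -> : rnorm ('i%C : C) = 1.
  by apply: complexI; rewrite -rnormE normc_def /= expr0n expr1n add0r sqrtr1.
rewrite mulr1; congr (_ <= _); congr `|_|; case: z => a b /=; ring.
Qed.

Lemma rnorm_le_ReIm (z : C) : rnorm z <= `|complex.Re z| + `|complex.Im z|.
Proof.
rewrite {1}(complexE z) (le_trans (rnormD _ _)) // rnormM.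
have -> : rnorm ('i%C : C) = 1.
  by apply: complexI; rewrite -rnormE normc_def /= expr0n expr1n add0r sqrtr1.
have r (x : R) : rnorm x%:C = `|x|.
  by apply: complexI; rewrite -rnormE normc_def /= expr0n addr0 sqrtr_sqr.
by rewrite mul1r !r.
Qed.

Lemma rnorm_sum (I : finType) (F : I -> C) : rnorm (\sum_i F i) <= \sum_i rnorm (F i).
Proof.
elim/big_rec2: _ => [|i y x _ h].
  by rewrite (_ : 0 = (0 : R)%:C) // rnorm_real.
by rewrite (le_trans (rnormD _ _)) // lerD2l.
Qed.

(** The principal 2 x 2 minors bound an entry by two diagonal entries, each at most the trace. *)
Lemma psd_entry_bound P p q : psdmx P -> rnorm (P p q) <= rnorm (\tr P).
Proof.
move=> pP; have [hP qP] := (psdP P).1 pP.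
have dP a : 0 <= P a a by exact: psd_diag_ge0.
have le_tr a : P a a <= \tr P.
  by rewrite /mxtrace (bigD1 a) //= lerDl sumr_ge0.
have h : `|P p q| ^+ 2 <= P p p * P q q.
  apply: two_by_two_psd => // x y; have := qP (comb [:: (x, p); (y, q)]).
  by rewrite sesq_comb !big_cons !big_nil /= !addr0 hP !addrA.
rewrite -lecR -!rnormE -(@ler_pXn2r _ 2) ?nnegrE // (le_trans h) //.
rewrite (ger0_norm (sumr_ge0 _ (fun a _ => dP a))) expr2.
by apply: ler_pM.
Qed.

(** Partial transposition preserves the trace, so the traces of both positive summands, and with
    them all their entries, stay bounded; a cluster point of the pairs decomposes [W]. *)
Lemma decomposable_closed W D :
  (forall k : nat, decomposable (W + (k.+1%:R^-1 : C) *: D)) -> decomposable W.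
Proof.
move=> H.
have /choice[PQ hPQ] : forall k : nat, exists PQ : 'M[C]_(m * n) * 'M[C]_(m * n),
    [/\ psdmx PQ.1, psdmx PQ.2 & W + (k.+1%:R^-1 : C) *: D = PQ.1 + ptrans PQ.2].
  by move=> k; have [P [Q h]] := H k; exists (P, Q).
pose M := rnorm (\tr W) + rnorm (\tr D).
have inv_le k : rnorm (k.+1%:R^-1 : C) = k.+1%:R^-1.
  have -> : (k.+1%:R^-1 : C) = (k.+1%:R^-1)%:C by rewrite fmorphV rmorph_nat.
  by rewrite rnorm_real // invr_ge0.
have trM k : rnorm (\tr (PQ k).1 + \tr (PQ k).2) <= M.
  have [_ _ e] := hPQ k.
  have <- : \tr (ptrans (PQ k).2) = \tr (PQ k).2.
    by apply: eq_bigr => p _; rewrite mxE ixE.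
  rewrite -mxtraceD -e mxtraceD mxtraceZ (le_trans (rnormD _ _)) // lerD2l rnormM inv_le.
  by rewrite ler_piMl ?rnorm_ge0 // invf_le1 ?ltr0n // ler1n.
have bM b k p q : rnorm ((if b then (PQ k).1 else (PQ k).2) p q) <= M.
  have [p1 p2 _] := hPQ k; apply: le_trans (trM k).
  have t1 : 0 <= \tr (PQ k).1 by apply: sumr_ge0 => a _; exact: psd_diag_ge0.
  have t2 : 0 <= \tr (PQ k).2 by apply: sumr_ge0 => a _; exact: psd_diag_ge0.
  have mono x y : 0 <= x -> 0 <= y -> rnorm x <= rnorm (x + y).
    move=> x0 y0; rewrite -lecR -!rnormE !ger0_norm ?addr_ge0 //.
    by rewrite lerDl.
  case: b; first by rewrite (le_trans (psd_entry_bound p q p1)) // mono.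
  by rewrite addrC (le_trans (psd_entry_bound p q p2)) // mono.
(* One real coordinate per choice of summand, of real or imaginary part, and of matrix position. *)
pose I := (bool * bool * ('I_(m * n) * 'I_(m * n)))%type.
pose u k (i : 'I_#|{: I}|) : R := let: (b, c, (p, q)) := enum_val i in
  (if c then @complex.Re R else @complex.Im R) ((if b then (PQ k).1 else (PQ k).2) p q).
have uM k i : `|u k i| <= M.
  rewrite /u; case: (enum_val i) => [[b c] [p q]]; apply: le_trans (bM b k p q).
  by case: c; [exact: rnorm_Re|exact: rnorm_Im].
have [f hf] := bolzano_weierstrass uM.
pose L b p q : C := Complex (f (enum_rank (b, true, (p, q)))) (f (enum_rank (b, false, (p, q)))).
pose P0 := \matrix_(p, q) L true p q; pose Q0 := \matrix_(p, q) L false p q.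
have ReB (x y : C) : complex.Re (x - y) = complex.Re x - complex.Re y.
  by case: x => ? ?; case: y.
have ImB (x y : C) : complex.Im (x - y) = complex.Im x - complex.Im y.
  by case: x => ? ?; case: y.
have close e N : 0 < e -> exists2 k, (N <= k)%N & forall b p q,
    rnorm (L b p q - (if b then (PQ k).1 else (PQ k).2) p q) <= 2 * e.
  move=> e0; have [k Nk hk] := hf e e0 N; exists k => // b p q.
  apply: (le_trans (rnorm_le_ReIm _)); rewrite mulr2n mulrDl mul1r.
  have h1 := hk (enum_rank (b, true, (p, q))); have h2 := hk (enum_rank (b, false, (p, q))).
  rewrite /u !enum_rankK in h1 h2; apply: lerD.
    by rewrite ReB ltW.
  by rewrite ImB ltW.
have z0 (z : C) c : (forall e, 0 < e -> e < 1 -> rnorm z <= c * e) -> z = 0.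
  move=> h; apply/eqP; rewrite -normr_eq0 rnormE.
  suff -> : rnorm z = 0 by [].
  apply/eqP; rewrite eq_le rnorm_ge0 andbT; apply: (@le_by_approx _ _ _ c).
  by move=> e e0 e1; rewrite add0r h.
have psdL b : psdmx (\matrix_(p, q) L b p q).
  have hL p q : (L b q p)^* = L b p q.
    apply/eqP; rewrite -subr_eq0; apply/eqP; apply: (@z0 _ 4) => e e0 _.
    have [k _ hk] := close e 0%N e0.
    have hP : psdmx (if b then (PQ k).1 else (PQ k).2) by case: (b); have [] := hPQ k.
    have [h _] := (psdP _).1 hP.
    have := hk b; move: (if b then _ else _) h => X h hX.
    have -> : (L b q p)^* - L b p q = (L b q p - X q p)^* + - (L b p q - X p q).
      by rewrite rmorphB /= h; ring.
    rewrite (le_trans (rnormD _ _)) // rnormN rnormJ.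
    by have := lerD (hX q p) (hX p q); lra.
  apply/psdP; split=> [p q|v]; first by rewrite !mxE hL.
  set Y := (\matrix_(p, q) L b p q : 'M[C]_(m * n)).
  have sr : (sesq Y v v)^* = sesq Y v v.
    rewrite /sesq [RHS]exchange_big rmorph_sum; apply: eq_bigr => p _ /=.
    rewrite rmorph_sum; apply: eq_bigr => q _ /=.
    by rewrite !rmorphM /= conjCK !mxE hL; ring.
  have er : sesq Y v v = (complex.Re (sesq Y v v))%:C by rewrite RRe_real //; apply/CrealP.
  rewrite er ler0c -oppr_le0.
  pose S := \sum_p \sum_q rnorm (v p) * rnorm (v q).
  apply: (@le_by_approx _ _ _ (2 * S)) => e e0 _; rewrite add0r.
  have [k _ hk] := close e 0%N e0.
  have hP : psdmx (if b then (PQ k).1 else (PQ k).2) by case: (b); have [] := hPQ k.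
  have [_ /(_ v) h] := (psdP _).1 hP.
  have := hk b; move: (if b then _ else _) h => X h hX.
  have eY : sesq Y v v = sesq X v v + sesq (Y - X) v v.
    by rewrite -sesqD addrC subrK.
  have xr : sesq X v v = (complex.Re (sesq X v v))%:C by rewrite RRe_real // ger0_real.
  have x0 : 0 <= complex.Re (sesq X v v) by rewrite -ler0c -xr.
  have zb : rnorm (sesq (Y - X) v v) <= 2 * S * e.
    rewrite /sesq (le_trans (rnorm_sum _)) // /S mulr_sumr mulr_suml; apply: ler_sum => p _.
    rewrite (le_trans (rnorm_sum _)) // mulr_sumr mulr_suml; apply: ler_sum => q _.
    rewrite !rnormM rnormJ !mxE.
    have := ler_wpM2l (mulr_ge0 (rnorm_ge0 (v p)) (rnorm_ge0 (v q))) (hX p q); lra.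
  have := rnorm_Re (sesq (Y - X) v v); rewrite ler_norml => /andP[h1 _].
  have : complex.Re (sesq Y v v) = complex.Re (sesq X v v) + complex.Re (sesq (Y - X) v v).
    by rewrite eY; case: (sesq X v v) => a1 a2; case: (sesq (Y - X) v v) => b1 b2.
  lra.
exists P0, Q0; split; [exact: psdL|exact: psdL|].
apply/matrixP => p q; apply/eqP; rewrite -subr_eq0; apply/eqP.
apply: (@z0 _ (4 + rnorm (D p q))) => e e0 _.
(* Indices from [N] on make the perturbation by [D] at most e times its entry. *)
have [N hN] : exists N : nat, e^-1 <= N.+1%:R.
  exists (Num.bound e^-1); have ei : 0 <= e^-1 by rewrite invr_ge0 ltW.
  by apply: (le_trans (ltW (archi_boundP ei))); rewrite ler_nat.
have [k Nk hk] := close e N e0; have [_ _ /matrixP/(_ p q)] := hPQ k.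
rewrite !mxE; set p' := mxvec_index _ _; set q' := mxvec_index _ _ => ek.
have ke : (k.+1%:R^-1 : R) <= e.
  rewrite -[e]invrK lef_pV2 ?posrE ?ltr0n ?invr_gt0 //.
  by apply: (le_trans hN); rewrite ler_nat.
have -> : W p q - (L true p q + L false p' q') =
    - (L true p q - (PQ k).1 p q) + - (L false p' q' - (PQ k).2 p' q') +
    - ((k.+1%:R^-1 : C) * D p q).
  have -> : W p q = (PQ k).1 p q + (PQ k).2 p' q' - (k.+1%:R^-1 : C) * D p q.
    by rewrite -ek addrK.
  by ring.
have h1 : rnorm (L true p q - (PQ k).1 p q) <= 2 * e := hk true p q.
have h2 : rnorm (L false p' q' - (PQ k).2 p' q') <= 2 * e := hk false p' q'.
move: h1 h2; move: (L true p q - _) (L false p' q' - _) => x1 x2 h1 h2.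
have h3 := rnormD (- x1 - x2) (- (k.+1%:R^-1 * D p q)).
have h4 := rnormD (- x1) (- x2).
rewrite !rnormN rnormM inv_le in h3; rewrite !rnormN in h4.
have h5 : k.+1%:R^-1 * rnorm (D p q) <= e * rnorm (D p q).
  by rewrite ler_wpM2r ?rnorm_ge0.
apply: (le_trans h3); apply: (@le_trans _ _ (2 * e + 2 * e + e * rnorm (D p q))).
  by rewrite lerD // (le_trans h4) // lerD.
by rewrite le_eqVlt; apply/orP; left; apply/eqP; ring.
Qed.

End Closed.

(** * Families of normalized witnesses *)

Section Cone.
Variables (R : realType) (m n : nat).
Local Notation C := R[i].
Local Notation ix := (@mxvec_index m n).
Local Notation "x %:C" := (real_complex R x).
Implicit Types W K G P Q : 'M[C]_(m * n).

(** The negative eigenvalue is automatic here, positive semidefinite matrices being decomposable;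
    what is left is stable under scaling and filters. *)
Definition ndw W := block_positive W /\ ~ decomposable W.

Lemma psd_block_positive P : psdmx P -> block_positive P.
Proof. by move=> /psdP[h p]; apply/block_positive_prod; split=> // a b; exact: p. Qed.

Lemma block_positiveD W K : block_positive W -> block_positive K -> block_positive (W + K).
Proof.
move=> /block_positive_prod[h p] /block_positive_prod[h' p'].
apply/block_positive_prod; split=> [|a b]; first exact: hermD.
by rewrite sesqD addr_ge0.
Qed.

Lemma block_positiveZ (c : C) W : 0 <= c -> block_positive W -> block_positive (c *: W).
Proof.
move=> c0 /block_positive_prod[h p]; apply/block_positive_prod; split=> [|a b].
  by apply: hermZ => //; exact: ger0_real.
by rewrite sesqZ mulr_ge0.
Qed.

Lemma psdZ (c : C) P : 0 <= c -> psdmx P -> psdmx (c *: P).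
Proof.
move=> c0 /psdP[h p]; apply/psdP; split=> [|v].
  by apply: hermZ => //; exact: ger0_real.
by rewrite sesqZ mulr_ge0.
Qed.

Lemma decomposableZ (c : C) W : 0 <= c -> decomposable W -> decomposable (c *: W).
Proof.
move=> c0 [P [Q [pP pQ ->]]]; exists (c *: P), (c *: Q).
by split; [exact: psdZ|exact: psdZ|rewrite scalerDr ptransZ].
Qed.

Lemma ndwZ (c : C) W : 0 < c -> ndw W -> ndw (c *: W).
Proof.
move=> c0 [bW nW]; split; first by apply: block_positiveZ => //; exact: ltW.
move=> /(@decomposableZ c^-1); rewrite invr_ge0 scalerA mulVf ?gt_eqF // scale1r.
by move=> /(_ (ltW c0)).
Qed.

(** By tr W^2 <= (tr W)^2, trace 0 would give W = 0. *)
Lemma ndw_tr_gt0 W : ndw W -> 0 < \tr W.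
Proof.
move=> [bW nW]; have t0 : 0 <= \tr W by apply: sumr_ge0 => p _; exact: diagp_ge0.
rewrite lt_def t0 andbT; apply/eqP => tz; apply: nW.
suff -> : W = 0 by apply: psd_decomposable; exact: psd0.
have := trsq_le bW; rewrite tz expr0n (trsq_normE bW) => le0.
have /eqP : \sum_p \sum_q `|W p q| ^+ 2 = 0.
  by apply/eqP; rewrite eq_le le0; do 2!apply: sumr_ge0 => ? _; exact: exprn_ge0.
rewrite psumr_eq0 => [/allP h|p _]; last by apply: sumr_ge0 => q _; exact: exprn_ge0.
apply/matrixP => p q; have := h p; rewrite mem_index_enum => /(_ isT) /=.
rewrite psumr_eq0 => [/allP/(_ q)|? _]; last exact: exprn_ge0.
by rewrite mem_index_enum => /(_ isT) /=; rewrite sqrf_eq0 normr_eq0 mxE => /eqP.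
Qed.

Lemma ndw_eigen_neg W V d : ndw W -> eigensystem W V d -> exists k, d k < 0.
Proof.
move=> [bW nW] eW; have [k dk|z] := pickP [pred k | d k < 0]; first by exists k.
case: nW; apply: psd_decomposable; apply/psdP; split; first exact: bp_herm.
move=> v; have /(_ 0 v) := eigen_lower eW; rewrite rmorph0 mul0r; apply.
by move=> k; rewrite leNgt; have /= := z k => ->.
Qed.

Lemma ndw_normalized W : ndw W -> \tr W = 1 -> normalized_NDEW W.
Proof.
move=> nW tW; split=> //; last by case: nW.
split; first by case: nW.
have [V [d eW]] := hermitian_eigensystem (bp_herm (proj1 nW)).
have [k dk] := ndw_eigen_neg nW eW; exists (d k)%:C; split.
  by rewrite -(rmorph0 (real_complex R)) ltcR.
rewrite eigenvalue_root_char (eigen_char_poly eW) rootE horner_prod.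
by rewrite (bigD1 k) //= hornerXsubC subrr mul0r.
Qed.

Lemma normalized_ndw W : normalized_NDEW W -> ndw W.
Proof. by case=> -[]. Qed.

Lemma ndw_normalize W : ndw W -> normalized_NDEW ((\tr W)^-1 *: W).
Proof.
move=> nW; have t0 := ndw_tr_gt0 nW; apply: ndw_normalized.
  by apply: ndwZ => //; rewrite invr_gt0.
by rewrite mxtraceZ mulVf ?gt_eqF.
Qed.

(** The inverse filter would carry a decomposition back to [W]. *)
Lemma filter_ndw W (a : 'I_m -> C) (b : 'I_n -> C) :
  (forall i, 0 < a i) -> (forall k, 0 < b k) -> ndw W ->
  ndw (local (diag_mx (\row_i a i)) (diag_mx (\row_k b k)) W).
Proof.
move=> a0 b0 [bW nW]; split; first exact: local_block_positive.
move=> dW; apply: nW.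
rewrite -[W]local1.
have -> : 1%:M = diag_mx (\row_i (a i)^-1) *m diag_mx (\row_i a i).
  rewrite mulmx_diag; apply/matrixP => i j; rewrite !mxE.
  by rewrite mulVf // gt_eqF ?a0.
have -> : 1%:M = diag_mx (\row_k (b k)^-1) *m diag_mx (\row_k b k).
  rewrite mulmx_diag; apply/matrixP => i j; rewrite !mxE.
  by rewrite mulVf // gt_eqF ?b0.
by rewrite -localM; exact: local_decomposable.
Qed.

Lemma filter_diag W (a : 'I_m -> C) (b : 'I_n -> C) i k :
  local (diag_mx (\row_i a i)) (diag_mx (\row_k b k)) W (ix i k) (ix i k) =
  `|a i| ^+ 2 * `|b k| ^+ 2 * W (ix i k) (ix i k).
Proof.
have -> : local (diag_mx (\row_i a i)) (diag_mx (\row_k b k)) W =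
    diag_mx (\row_p (a (idx p).1 * b (idx p).2)) *m W *m
    diag_mx (\row_p (a (idx p).1 * b (idx p).2)^*).
  have e : tensor (diag_mx (\row_i a i)) (diag_mx (\row_k b k)) =
      diag_mx (\row_p (a (idx p).1 * b (idx p).2)).
    apply: matrix_ixP => i' k' j l; rewrite tensorE !mxE !idxE ix_inj /=.
    by case: (i' == j); case: (k' == l); rewrite /= ?mulr1n ?mulr0n ?mulr0 ?mul0r.
  rewrite /local e tr_diag_mx map_diag_mx; congr (_ *m diag_mx _).
  by apply/rowP => p; rewrite !mxE.
rewrite mul_mx_diag mxE mul_diag_mx !mxE !idxE /= !normCK rmorphM /=; ring.
Qed.

(* A nondecomposable witness is deformed by invertible diagonal local filters
   towards a product projector. *)
Lemma ndw_concentrate W (e : R) : 0 < e -> e < 1 -> ndw W ->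
  exists W' p, normalized_NDEW W' /\ (1 - e)%:C <= W' p p.
Proof.
move=> e0 e1 nW; have t0 := ndw_tr_gt0 nW; have bW := proj1 nW.
have [p /= Wp|z] := pickP [pred p | W p p != 0]; last first.
  by move: t0; rewrite /mxtrace big1 ?ltxx // => p _; have /negbFE/eqP := z p.
have w0 : 0 < W p p by rewrite lt_def Wp diagp_ge0.
set w := W p p in w0; set T := \tr W in t0.
have wT : w <= T.
  by rewrite /T /mxtrace (bigD1 p) //= lerDl sumr_ge0 // => q _; exact: diagp_ge0.
have E0 : 0 < e%:C by rewrite -(rmorph0 (real_complex R)) ltcR.
have E1 : e%:C < 1 by rewrite -(rmorph1 (real_complex R)) ltcR.
(* All diagonal entries other than the one at [p] shrink by at least the factor [de]; this value
   keeps their total below e times that entry, and 1 / (1 + e) >= 1 - e. *)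
pose de := e%:C * w / T.
have de0 : 0 < de by rewrite divr_gt0 // mulr_gt0.
have de1 : de <= 1.
  by rewrite ler_pdivrMr // mul1r (le_trans _ wT) // ler_piMl // ltW.
have dn : `|de| = de by rewrite ger0_norm // ltW.
have dd : de ^+ 2 <= de by rewrite expr2 ler_piMl // ltW.
pose a (i : 'I_m) : C := if i == (idx p).1 then 1 else de.
pose b (k : 'I_n) : C := if k == (idx p).2 then 1 else de.
have nW1 : ndw (local (diag_mx (\row_i a i)) (diag_mx (\row_k b k)) W).
  by apply: filter_ndw => // i; rewrite /a /b; case: ifP.
have e1p : forall q, local (diag_mx (\row_i a i)) (diag_mx (\row_k b k)) W q q =
    `|a (idx q).1| ^+ 2 * `|b (idx q).2| ^+ 2 * W q q.
  by move=> q; rewrite -{1 2}(ixE q) filter_diag ixE.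
move: (local _ _ _) nW1 e1p => W1 nW1 e1p.
have W1p : W1 p p = w by rewrite e1p /a /b !eqxx normr1 expr1n !mul1r.
have trW1 : \tr W1 <= (1 + e%:C) * w.
  rewrite /mxtrace (bigD1 p) //= W1p mulrDl mul1r lerD2l.
  apply: (@le_trans _ _ (de * T)); last by rewrite /de divfK // gt_eqF.
  apply: (@le_trans _ _ (\sum_(q | q != p) de * W q q)).
    apply: ler_sum => q qp; rewrite e1p ler_wpM2r ?diagp_ge0 //.
    have dde : de ^+ 2 * de ^+ 2 <= de.
      by rewrite (le_trans _ dd) // ler_piMl ?exprn_ge0 ?(ltW de0) // (le_trans dd).
    rewrite /a /b; case: eqP => [q1|_]; case: eqP => [q2|_];
      rewrite ?normr1 ?expr1n ?mul1r ?mulr1 ?dn //.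
    by case/eqP: qp; rewrite -(ixE q) -(ixE p) q1 q2.
  rewrite -mulr_sumr ler_wpM2l ?(ltW de0) // /T /mxtrace [X in _ <= X](bigD1 p) //=.
  by rewrite lerDr diagp_ge0.
exists ((\tr W1)^-1 *: W1), p; split; first exact: ndw_normalize.
rewrite mxE W1p mulrC ler_pdivlMr ?ndw_tr_gt0 // rmorphB rmorph1.
apply: (@le_trans _ _ ((1 - e%:C) * ((1 + e%:C) * w))).
  by rewrite ler_wpM2l // subr_ge0 ltW.
rewrite mulrA -subr_sqr expr1n mulrBl mul1r gerBl mulr_ge0 ?exprn_ge0 // ltW //.
Qed.

End Cone.

(** * Eigenvalue data of normalized witnesses *)

Section Data.
Variables (R : realType) (m n : nat) (mn : (m <= n)%N).
Local Notation C := R[i].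
Local Notation ix := (@mxvec_index m n).
Local Notation "x %:C" := (real_complex R x).
Implicit Types W K G P Q : 'M[C]_(m * n).

Lemma tr_norm_bound W V d : block_positive W -> \tr W = 1 -> eigensystem W V d ->
  \sum_k `|d k| <= m%:R.
Proof.
move=> bW tW eW; have [M uM e] := eigen_sign eW.
have := unitary_trace_bound bW uM; rewrite e tW mulr1.
rewrite ger0_norm; last by rewrite ler0c sumr_ge0.
by rewrite -(rmorph_nat (real_complex R)) lecR.
Qed.

Lemma ndew_data W : normalized_NDEW W -> exists V d,
  [/\ eigensystem W V d, \sum_k d k = 1, \sum_k d k ^+ 2 <= 1,
      exists k, d k < 0 & forall k, - (1 / 2) < d k].
Proof.
move=> nW; have [bW nd] := normalized_ndw nW; have [_ _ tW] := nW.
have [V [d eW]] := hermitian_eigensystem (bp_herm bW); exists V, d; split=> //.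
- by apply: complexI; rewrite -(eigen_tr eW) tW.
- by rewrite -lecR -(eigen_trsq eW) rmorph1 -(expr1n _ 2) -tW trsq_le.
- exact: (ndw_eigen_neg (conj bW nd) eW).
move=> k; have [v [ev v1]] := eigen_vector eW k.
have half : (- (1 / 2))%:C = - 2^-1 :> C.
  by rewrite rmorphN rmorphM rmorph1 mul1r fmorphV rmorph_nat.
rewrite lt_def; apply/andP; split; last first.
  by rewrite -lecR half -ev (eigenvalue_ge_mhalf mn).
apply/eqP => dk; apply: nd; apply: (mhalf_decomposable mn bW tW v1).
by rewrite ev dk half.
Qed.

Lemma two_eigen_bound (N : nat) (d : 'I_N -> R) k l : k != l ->
  d k ^+ 2 + d l ^+ 2 <= \sum_k d k ^+ 2.
Proof.
move=> kl; rewrite (bigD1 k) //= (bigD1 l) /= 1?eq_sym // addrA lerDl.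
by rewrite sumr_ge0 // => ? _; exact: sqr_ge0.
Qed.

Lemma one_eigen_bound (N : nat) (d : 'I_N -> R) k : d k ^+ 2 <= \sum_k d k ^+ 2.
Proof. by rewrite (bigD1 k) //= lerDl sumr_ge0 // => ? _; exact: sqr_ge0. Qed.

Lemma diag_le_lmax W V d s p : eigensystem W V d -> spectrum W s ->
  W p p <= (nth 0 s 0)%:C.
Proof.
move=> eW sW; have := eigen_upper eW (comb [:: (1, p)]) (fun k => spectrum_max k eW sW).
rewrite sesq_comb !big_cons !big_nil /= conjC1 !mul1r !addr0.
have -> : \sum_q `|comb [:: (1 : C, p)] q| ^+ 2 = 1.
  under eq_bigr do rewrite normCK mulrC.
  by rewrite dot_comb big_cons big_nil /= /comb big_cons big_nil eqxx conjC1 !mul1r !addr0.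
by rewrite mulr1.
Qed.

(** A diagonal entry near 1 forces an eigenvalue near 1, and since the squares sum to at most 1,
    every negative eigenvalue is small. *)
Lemma concentrated_ndew W0 (e : R) : (0 < m * n)%N -> ndw W0 -> 0 < e -> e < 1 ->
  exists W s V d, [/\ normalized_NDEW W, spectrum W s, eigensystem W V d,
    forall k, - e <= d k & 1 - e <= nth 0 s 0 /\ 1 - e <= \sum_k d k ^+ 2].
Proof.
(* Chosen so that (1 - f)^2 >= 1 - e^2, which leaves at most e^2 for any other squared
   eigenvalue. *)
move=> N0 nW0 e0 e1; pose f := e ^+ 2 / 2.
have f0 : 0 < f by rewrite divr_gt0 // exprn_gt0.
have e2e : e ^+ 2 <= e by rewrite expr2 ler_piMl // ltW.
have f1 : f < 1 by rewrite /f; lra.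
have [W [p [nW Wp]]] := ndw_concentrate f0 f1 nW0.
have [V [d [eW s1 s2 _ _]]] := ndew_data nW.
have sW := eigen_spectrum eW; set s := sort _ _ in sW.
exists W, s, V, d.
have fl : 1 - f <= nth 0 s 0 by rewrite -lecR (le_trans Wp) // (diag_le_lmax _ eW).
have [k1 dk1] := spectrum_nth eW sW N0.
have q1 : (1 - f) ^+ 2 <= d k1 ^+ 2 by rewrite ler_pXn2r ?nnegrE ?dk1 //; lra.
have q2 : 1 - e ^+ 2 <= (1 - f) ^+ 2.
  have -> : (1 - f) ^+ 2 = 1 - e ^+ 2 + f ^+ 2 by rewrite /f; field.
  by rewrite lerDl sqr_ge0.
split=> //; last split.
- move=> k; have [dk|dk] := leP 0 (d k); first by rewrite (le_trans _ dk) // oppr_le0 ltW.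
  have kk1 : k != k1.
    by apply/eqP => h; move: dk; rewrite h dk1 => h'; lra.
  have := two_eigen_bound d kk1 => h.
  have : (- d k) ^+ 2 <= e ^+ 2 by rewrite sqrrN; lra.
  by rewrite ler_pXn2r ?nnegrE ?oppr_ge0 ?(ltW dk) ?(ltW e0) // lerNl.
- by rewrite (le_trans _ fl) // /f; lra.
by rewrite (le_trans _ (one_eigen_bound d k1)) // (le_trans _ q1) // (le_trans _ q2) //; lra.
Qed.

(* The decomposable cone is closed, so a nondecomposable witness tolerates some
   positive amount [tau] of white noise. *)
Lemma ndew_noise W V d : normalized_NDEW W -> eigensystem W V d ->
  exists tau W' , [/\ 0 < tau, normalized_NDEW W' &
    eigensystem W' V (fun k => (d k + tau) / (1 + tau * (m * n)%:R))].
Proof.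
move=> nW eW; have [bW nd] := normalized_ndw nW; have [_ _ tW] := nW.
have psd1 : psdmx (1%:M : 'M[C]_(m * n)).
  apply/psdP; split=> [p q|v]; first by rewrite !mxE eq_sym rmorph_nat.
  by rewrite sesq1 sumr_ge0 // => p _; exact: exprn_ge0.
have [k nk] : exists k : nat, ~ decomposable (W + (k.+1%:R^-1 : C) *: 1%:M).
  apply/not_existsP => H; apply: nd; apply: (@decomposable_closed _ _ _ _ 1%:M) => k.
  by apply: contrapT => h; apply: (H k).
pose tau : R := k.+1%:R^-1; have tau0 : 0 < tau by rewrite invr_gt0 ltr0n.
have tC : (k.+1%:R^-1 : C) = tau%:C by rewrite fmorphV rmorph_nat.
rewrite tC in nk; clearbody tau.
have tp : 0 <= tau%:C by rewrite ler0c ltW.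
have n1 : ndw (W + tau%:C *: 1%:M).
  split=> //; apply: block_positiveD => //; apply: block_positiveZ => //.
  exact: psd_block_positive.
have tr1 : \tr (W + tau%:C *: 1%:M) = (1 + tau * (m * n)%:R)%:C.
  rewrite mxtraceD mxtraceZ mxtrace1 tW [RHS]rmorphD /=; congr (_ + _).
  by rewrite [RHS]rmorphM /= rmorph_nat.
exists tau, ((\tr (W + tau%:C *: 1%:M))^-1 *: (W + tau%:C *: 1%:M)).
split=> //; first exact: ndw_normalize.
have [uV eW'] := eW; split=> //; rewrite tr1.
have -> : diag_mx (\row_k0 ((d k0 + tau) / (1 + tau * (m * n)%:R))%:C) =
    ((1 + tau * (m * n)%:R)%:C)^-1 *: (diag_mx (\row_k0 (d k0)%:C) + tau%:C *: 1%:M).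
  apply/matrixP => i j; rewrite !mxE [((_ + _) / _)%:C]rmorphM /= fmorphV /= rmorphD /=.
  by case: (i == j); rewrite /= ?mulr1n ?mulr0n ?mulr1 ?mulr0 ?addr0 ?mulr0 // mulrC.
rewrite -scalemxAr -scalemxAl mulmxDr mulmxDl -eW' -scalemxAr -scalemxAl mulmx1.
by rewrite (adj_unitaryK eW).
Qed.

(** The functional vanishes on the first summand, so its sign on the sum is decided by [K], however
    small e is. *)
Lemma perturbed_ndw (l : 'M[C]_(m * n) -> C) u K (e : R) :
  detector l -> block_positive K -> l K < 0 -> l (ptrans (outer u)) = 0 -> 0 < e ->
  ndw (ptrans (outer u) + e%:C *: K).
Proof.
move=> dl bK lK lu e0; have E0 : 0 < e%:C by rewrite -(rmorph0 (real_complex R)) ltcR.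
split.
  apply: block_positiveD; last by apply: block_positiveZ => //; exact: ltW.
  apply: ptrans_block_positive; apply: psd_block_positive; exact: psd_outer.
have [lD lZ _ _] := dl; apply: (detector_nd dl).
by rewrite lD lZ lu add0r pmulr_rlt0.
Qed.

End Data.

(** * Extremal values *)

Section Kits.
Variables (R : realType).
Local Notation C := R[i].
Local Notation "x %:C" := (real_complex R x).

(** Form and state are both partially transposed, so that a kernel vector [u] of the original state
    makes the new functional vanish on [ptrans (outer u)]. The examples sit on the first few basis
    vectors. *)
Lemma rank_two_kit m n : (2 <= m)%N -> (m <= n)%N -> (6 < m * n)%N ->
  exists (K : 'M[C]_(m * n)) l (i0 i1 : 'I_m) (k0 k1 : 'I_n),
  [/\ detector l, block_positive K, l K < 0, (i0 != i1) && (k0 != k1) &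
      l (ptrans (outer (comb [:: (1, mxvec_index i0 k0); (-1, mxvec_index i1 k1)]))) = 0].
Proof.
move=> m2 mn N6.
have lt0 : (0 < m)%N by apply: leq_trans m2.
have [m3|] := leqP 3 m.
  have n3 : (3 <= n)%N by apply: leq_trans mn.
  pose i0 := Ordinal lt0; pose i1 := Ordinal (m2 : 1 < m)%N; pose i2 := Ordinal (m3 : 2 < m)%N.
  pose k0 := Ordinal (leq_trans (isT : 0 < 3)%N n3).
  pose k1 := Ordinal (leq_trans (isT : 1 < 3)%N n3).
  pose k2 := Ordinal (leq_trans (isT : 2 < 3)%N n3).
  exists (ptrans (choi_form R i0 i1 i2 k0 k1 k2)),
    (fun W => choi_functional i0 i1 i2 k0 k1 k2 (ptrans W)), i0, i1, k0, k1.
  split=> //.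
  - exact/detector_ptrans/choi_detector.
  - exact/ptrans_block_positive/choi_block_positive.
  - by rewrite ptransK; apply: choi_detected.
  rewrite ptransK; apply: choi_kernel; rewrite /comb !big_cons !big_nil /= !ix_inj /=;
    by rewrite !(mulr0n, mulr1n, mulr1, mulr0, addr0, add0r) ?subrr.
rewrite ltnS => m2'; have em : m = 2 by apply/eqP; rewrite eqn_leq m2' m2.
(* For m = 2 the condition mn > 6 is exactly the room for the 2 x 4 example. *)
have n4 : (3 < n)%N by move: N6; rewrite em; case: (n) => [|[|[|[|?]]]].
pose i0 := Ordinal lt0; pose i1 := Ordinal (m2 : 1 < m)%N.
pose k0 := Ordinal (leq_trans (isT : 0 < 4)%N n4).
pose k1 := Ordinal (leq_trans (isT : 1 < 4)%N n4).
pose k2 := Ordinal (leq_trans (isT : 2 < 4)%N n4).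
pose k3 := Ordinal (leq_trans (isT : 3 < 4)%N n4).
exists (ptrans (horodecki_form R i0 i1 k0 k1 k2 k3)),
  (fun W => horodecki_functional i0 i1 k0 k1 k2 k3 (ptrans W)), i0, i1, k0, k1.
split=> //.
- exact/detector_ptrans/horodecki_detector.
- exact/ptrans_block_positive/horodecki_block_positive.
- by rewrite ptransK; apply: horodecki_detected.
by rewrite ptransK; apply: horodecki_kernel.
Qed.

Definition diagonal_vec n (f : 'I_n -> C) (p : 'I_(n * n)) : C :=
  if (idx p).1 == (idx p).2 then f (idx p).1 else 0.

(* The phases 1, om, om^* sum to 0, so the vector with these coordinates on the
   diagonal is maximally entangled and lies in the kernel of the detecting state. *)
Lemma full_rank_kit n : (3 <= n)%N ->
  exists (K : 'M[C]_(n * n)) l (f : 'I_n -> C),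
  [/\ detector l, block_positive K, l K < 0, forall i, f i * (f i)^* = 1 &
      l (ptrans (outer (diagonal_vec f))) = 0].
Proof.
move=> n3.
pose k0 := Ordinal (leq_trans (isT : 0 < 3)%N n3).
pose k1 := Ordinal (leq_trans (isT : 1 < 3)%N n3).
pose k2 := Ordinal (leq_trans (isT : 2 < 3)%N n3).
pose om : C := (- 2^-1 + 'i * (sqrtC 3 / 2)).
have s3r : (sqrtC 3 / 2 : C) \is Num.real by rewrite ger0_real // divr_ge0 // sqrtC_ge0.
have omJ : om^* = - 2^-1 - 'i * (sqrtC 3 / 2).
  rewrite /om rmorphD rmorphM /= conjCi (conj_Creal s3r) mulNr.
  by rewrite rmorphN fmorphV /= rmorph_nat.
have omn : om * om^* = 1.
  have s3 : sqrtC 3 * sqrtC 3 = 3 :> C by rewrite -expr2 sqrtCK.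
  have i2 : 'i * 'i = -1 :> C by rewrite -expr2 sqrCi.
  rewrite omJ /om; transitivity (4^-1 - ('i * 'i) * (sqrtC 3 * sqrtC 3) / 4 : C).
    by field.
  by rewrite i2 s3; field.
pose f (i : 'I_n) : C := if i == k1 then om else if i == k2 then om^* else 1.
exists (ptrans (choi_form R k0 k1 k2 k0 k1 k2)),
  (fun W => choi_functional k0 k1 k2 k0 k1 k2 (ptrans W)), f.
split=> //.
- exact/detector_ptrans/choi_detector.
- exact/ptrans_block_positive/choi_block_positive.
- by rewrite ptransK; apply: choi_detected.
- move=> i; rewrite /f; case: ifP => // _; case: ifP => _; last by rewrite conjC1 mulr1.
  by rewrite conjCK mulrC.
rewrite ptransK; apply: choi_kernel; rewrite /diagonal_vec !idxE //= /f /=.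
by rewrite omJ /om; field.
Qed.

End Kits.

(** * Suprema and infima in general dimensions *)

Section Bounds.
Variables (R : realType) (m n : nat).
Hypotheses (m2 : (2 <= m)%N) (mn : (m <= n)%N) (N6 : (6 < m * n)%N).
Local Notation C := R[i].
Local Notation ix := (@mxvec_index m n).
Local Notation "x %:C" := (real_complex R x).
Implicit Types W K G : 'M[C]_(m * n).

Let N0 : (0 < m * n)%N. Proof. exact: leq_trans N6. Qed.

Lemma concentrated (e : R) : 0 < e -> e < 1 ->
  exists W s V d, [/\ normalized_NDEW W, spectrum W s, eigensystem W V d,
    forall k, - e <= d k & 1 - e <= nth 0 s 0 /\ 1 - e <= \sum_k d k ^+ 2].
Proof.
have [K [l [_ [_ [_ [_ [dl bK lK _ _]]]]]]] := @rank_two_kit R m n m2 mn N6.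
move=> e0 e1.
exact: (concentrated_ndew mn N0 (conj bK (detector_nd dl lK)) e0 e1).
Qed.

Lemma trsq_data x : trsq_set R m n x -> exists W V d,
  [/\ normalized_NDEW W, eigensystem W V d & x = \sum_k d k ^+ 2].
Proof.
move=> [W [nW e]]; have [V [d [eW _ _ _ _]]] := ndew_data mn nW.
by exists W, V, d; split=> //; apply: complexI; rewrite e (eigen_trsq eW).
Qed.

Lemma trsq_sup : is_sup (trsq_set R m n) 1.
Proof.
split=> [y [W [nW e]]|z H].
  have [V [d [eW _ s2 _ _]]] := ndew_data mn nW.
  by move: e; rewrite (eigen_trsq eW) => /complexI ->.
apply: (@le_by_approx _ _ _ 1) => e e0 e1.
have [W [s [V [d [nW sW eW _ [_ h]]]]]] := concentrated e0 e1.
have : \sum_k d k ^+ 2 <= z by apply: H; exists W; rewrite (eigen_trsq eW).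
lra.
Qed.

Lemma mn_gt0R : 0 < (m * n)%:R :> R. Proof. by rewrite ltr0n. Qed.

Lemma is_inf_exists (S : R -> Prop) (b : R) : (exists x, S x) -> (forall x, S x -> b <= x) ->
  exists x, is_inf S x.
Proof.
move=> [x Sx] Sb.
have hS : has_inf (S : set R) by split; [exists x|exists b => y Sy; exact: Sb].
exists (inf (S : set R)); split=> [y Sy|z Hz]; first by apply: ge_inf => //; case: hS.
by apply: lb_le_inf; [exists x|exact: Hz].
Qed.

(** White noise moves the eigenvalues towards their mean 1/N, and a negative eigenvalue shows that
    the spectrum is not flat, so the sum of squares strictly drops. *)
Lemma trsq_inf : exists x, is_inf (trsq_set R m n) x /\ ~ trsq_set R m n x.
Proof.
have [|y /trsq_data[W [V [d [_ _ ->]]]]|x [xl xg]] := @is_inf_exists (trsq_set R m n) 0.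
- have [W [s [V [d [nW sW eW _ _]]]]] := concentrated (e := 2^-1) ltac:(lra) ltac:(lra).
  by exists (\sum_k d k ^+ 2), W; rewrite (eigen_trsq eW).
- by apply: sumr_ge0 => k _; exact: sqr_ge0.
exists x; split=> // -[W [nW ex]].
have [V [d [eW s1 s2 [k0 dk0] _]]] := ndew_data mn nW.
have {}ex : x = \sum_k d k ^+ 2 by apply: complexI; rewrite ex (eigen_trsq eW).
have [tau [W' [t0 nW' eW']]] := ndew_noise nW eW.
have := xl (\sum_k ((d k + tau) / (1 + tau * (m * n)%:R)) ^+ 2) _.
have N0R := mn_gt0R; set N : R := (m * n)%:R in N0R eW' *.
have p0 : 0 < 1 + tau * N by rewrite addr_gt0 // mulr_gt0.
have sc : \sum_(k < m * n) (1 : R) = N by rewrite sumr_const card_ord.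
clearbody N.
have e1 : \sum_k ((d k + tau) / (1 + tau * N)) ^+ 2 =
    (x + 2 * tau + tau ^+ 2 * N) / (1 + tau * N) ^+ 2.
  rewrite -sc [in RHS]mulr_sumr.
  have -> : x + 2 * tau + \sum_(i < m * n) tau ^+ 2 * 1 = \sum_k (d k + tau) ^+ 2.
    transitivity (\sum_k (d k ^+ 2 + 2 * tau * d k + tau ^+ 2 * 1)).
      have e3 : \sum_k 2 * tau * d k = 2 * tau by rewrite -mulr_sumr s1 mulr1.
      by rewrite !big_split /= e3 ex.
    by apply: eq_bigr => k _; ring.
  rewrite sc mulr_suml; apply: eq_bigr => k _; by rewrite expr_div_n.
(* The sum of squared deviations from the mean 1/N is x - 1/N. *)
have xN : 1 < x * N.
  have : 0 < \sum_k (d k - N^-1) ^+ 2.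
    rewrite (bigD1 k0) //= ltr_pwDl ?sumr_ge0 // => [|? _]; last exact: sqr_ge0.
    rewrite exprn_even_gt0 //= subr_eq0 lt_eqF // (lt_trans dk0) // invr_gt0 //.
  have -> : \sum_k (d k - N^-1) ^+ 2 = x - N^-1.
    transitivity (\sum_k (d k ^+ 2 - 2 * N^-1 * d k + N^-1 ^+ 2 * 1)).
      by apply: eq_bigr => k _; ring.
    rewrite !big_split /= sumrN -!mulr_sumr s1 sc -ex; field.
    by rewrite gt_eqF.
  by rewrite subr_gt0 -[X in X < _]mul1r ltr_pdivrMr.
rewrite e1 => h; have : x <= (x + 2 * tau + tau ^+ 2 * N) / (1 + tau * N) ^+ 2.
  by apply: h; exists W'; split=> //; rewrite (eigen_trsq eW') e1.
rewrite ler_pdivlMr ?exprn_gt0 // => h'.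
(* With denominators cleared, the assumed inequality says that this product is at most 0. *)
have : 0 < (x * N - 1) * (2 * tau + tau ^+ 2 * N).
  by rewrite mulr_gt0 ?subr_gt0 // addr_gt0 ?mulr_gt0 // exprn_gt0.
lra.
Qed.

Lemma lmin_data x : lmin_set R m n x -> exists W s V d k,
  [/\ normalized_NDEW W, spectrum W s, eigensystem W V d, x = d k & forall l, x <= d l].
Proof.
move=> [W [s [nW sW ->]]]; have [V [d [eW _ _ _ _]]] := ndew_data mn nW.
have [|k ek] := spectrum_nth (i := (m * n).-1) eW sW; first by rewrite prednK.
by exists W, s, V, d, k; split=> // l; exact: spectrum_min eW sW.
Qed.

Lemma lmin_neg x : lmin_set R m n x -> x < 0.
Proof.
move=> /lmin_data[W [s [V [d [k [nW sW eW _ h]]]]]].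
have [l dl] := ndw_eigen_neg (normalized_ndw nW) eW.
exact: le_lt_trans dl.
Qed.

Lemma lmin_sup : is_sup (lmin_set R m n) 0 /\ ~ lmin_set R m n 0.
Proof.
split; last by move=> /lmin_neg; rewrite ltxx.
split=> [y /lmin_neg/ltW//|z H].
apply: (@le_by_approx _ _ _ 1) => e e0 e1.
have [W [s [V [d [nW sW eW h _]]]]] := concentrated e0 e1.
have [|k ek] := spectrum_nth (i := (m * n).-1) eW sW; first by rewrite prednK.
have : nth 0 s (m * n).-1 <= z by apply: H; exists W, s.
by have := h k; rewrite ek; lra.
Qed.

Lemma complex_ReD_le (a b : R) (c : C) (e : R) :
  a%:C <= b%:C + e%:C * c -> a <= b + e * complex.Re c.
Proof.
rewrite lecE => /andP[_]; case: c => c1 c2 /=.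
by rewrite mul0r subr0.
Qed.

(** [G] has trace 2 and value -2 at a vector of squared norm 2, so G/2 reaches -1/2; a small
    multiple of [K] makes it nondecomposable. *)
Lemma lmin_inf_lower z : (forall y, lmin_set R m n y -> z <= y) -> z <= - (1 / 2).
Proof.
move=> Hz.
have [K [l [i0 [i1 [k0 [k1 [dl bK lK /andP[hi hk] lu]]]]]]] := @rank_two_kit R m n m2 mn N6.
move: lu; set u := comb _ => lu.
have uE i k : u (ix i k) = ((i == i0) && (k == k0))%:R - ((i == i1) && (k == k1))%:R.
  by rewrite /u /comb !big_cons big_nil addr0 mul1r mulN1r /= !ix_inj.
set G := ptrans (outer u).
have GE i k j q : G (ix i k) (ix j q) = u (ix j k) * (u (ix i q))^*.
  by rewrite /G ptransE mxE.
pose v := comb [:: (1 : C, ix i1 k0); (1, ix i0 k1)].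
have nhi := negbTE hi; have nhk := negbTE hk.
have nhi' : (i1 == i0) = false by rewrite eq_sym.
have nhk' : (k1 == k0) = false by rewrite eq_sym.
have Gv : sesq G v v = -2.
  rewrite /v sesq_comb !big_cons !big_nil /= !GE !uE !eqxx nhi nhk nhi' nhk' /=.
  by rewrite !conjC1 rmorphB /= !rmorph_nat rmorph1 ?conjC0; ring.
have vn : \sum_p `|v p| ^+ 2 = 2.
  under eq_bigr do rewrite normCK mulrC.
  rewrite /v dot_comb !big_cons !big_nil /= /comb !big_cons !big_nil /= !ix_inj !eqxx.
  by rewrite nhi nhk nhi' nhk' /= conjC1; ring.
have trG : \tr G = 2.
  transitivity (\sum_p `|u p| ^+ 2).
    by apply: eq_bigr => p _; rewrite !mxE ixE normCK.
  under eq_bigr do rewrite normCK mulrC.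
  rewrite /u dot_comb !big_cons !big_nil /= -/u !uE !eqxx nhi nhk nhi' nhk' /=.
  by rewrite conjC1 rmorphN /= conjC1; ring.
pose c := complex.Re (sesq K v v); pose kap := complex.Re (\tr K).
have K0 : 0 <= \tr K by apply: sumr_ge0 => p _; exact: diagp_ge0.
have ek : \tr K = kap%:C by rewrite RRe_real // ger0_real.
have kap0 : 0 <= kap by rewrite -ler0c -ek.
suff : 4 * z <= -2 by lra.
(* The constant collects the terms of order e in 2 z (2 + e kap) <= -2 + e c. *)
apply: (@le_by_approx _ _ _ (c - 2 * z * kap)) => e e0 e1.
have nW := perturbed_ndw dl bK lK lu e0; rewrite -/G in nW.
have tW : \tr (G + e%:C *: K) = (2 + e * kap)%:C.
  by rewrite mxtraceD mxtraceZ trG ek rmorphD rmorphM /= rmorph_nat.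
have nW' := ndw_normalize nW; set W := _ *: _ in nW'.
have [V [d [eW _ _ _ _]]] := ndew_data mn nW'.
have sW := eigen_spectrum eW; set s := sort _ _ in sW.
have zs : z <= nth 0 s (m * n).-1 by apply: Hz; exists W, s.
have t0 : 0 < 2 + e * kap by rewrite ltr_pwDl // mulr_ge0 // ltW.
have := eigen_lower eW v (fun k => spectrum_min k eW sW).
rewrite vn /W sesqZ sesqD sesqZ Gv tW.
rewrite ler_pdivlMl; last by rewrite -(rmorph0 (real_complex R)) ltcR.
have -> : (2 : C) = 2%:C by rewrite rmorph_nat.
rewrite -rmorphN -!rmorphM => /complex_ReD_le; rewrite -/c => h.
have : (2 + e * kap) * (z * 2) <= (2 + e * kap) * (nth 0 s (m * n).-1 * 2).
  by rewrite ler_pM2l // ler_pM2r.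
move: h; lra.
Qed.

Lemma lmin_inf : is_inf (lmin_set R m n) (- (1 / 2)) /\ ~ lmin_set R m n (- (1 / 2)).
Proof.
have gt x : lmin_set R m n x -> - (1 / 2) < x.
  move=> /lmin_data[W [s [V [d [k [nW sW eW -> _]]]]]].
  (* The strict bound is known for one eigensystem; both list the same spectrum. *)
  have [V' [d' [eW' _ _ _ h]]] := ndew_data mn nW.
  have : d k \in codom d' by rewrite -(perm_mem (spectrum_perm eW' (eigen_spectrum eW)))
    mem_sort codom_f.
  by case/codomP => k' ->.
split; last by move=> /gt; rewrite ltxx.
by split=> [y /gt/ltW//|z]; exact: lmin_inf_lower.
Qed.

Lemma lmax_data x : lmax_set R m n x -> exists W s V d k,
  [/\ normalized_NDEW W, spectrum W s, eigensystem W V d, x = d k & forall l, d l <= x].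
Proof.
move=> [W [s [nW sW ->]]]; have [V [d [eW _ _ _ _]]] := ndew_data mn nW.
have [k ek] := spectrum_nth (i := 0%N) eW sW N0.
by exists W, s, V, d, k; split=> // l; exact: spectrum_max eW sW.
Qed.

Lemma eigen_sums W V d : normalized_NDEW W -> eigensystem W V d ->
  [/\ \sum_k d k = 1, \sum_k d k ^+ 2 <= 1 & exists k, d k < 0].
Proof.
move=> nW eW; have [bW nd] := normalized_ndw nW; have [_ _ tW] := nW; split.
- by apply: complexI; rewrite -(eigen_tr eW) tW.
- by rewrite -lecR -(eigen_trsq eW) rmorph1 -(expr1n _ 2) -tW trsq_le.
exact: (ndw_eigen_neg (conj bW nd) eW).
Qed.

(** An eigenvalue of at least 1 would use up the whole sum of squares and leave nothing for a
    negative one. *)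
Lemma lmax_lt1 x : lmax_set R m n x -> x < 1.
Proof.
move=> /lmax_data[W [s [V [d [k [nW sW eW -> _]]]]]].
have [_ s2 [l dl]] := eigen_sums nW eW.
have [dk0|dk0] := ltP (d k) 1; first by [].
have kl : k != l by apply/eqP => e; move: dk0; rewrite e; lra.
have h := two_eigen_bound d kl.
have l2 : 0 < d l ^+ 2 by rewrite exprn_even_gt0 //= lt_eqF.
have k2 : 1 <= d k ^+ 2 by rewrite -(expr1n _ 2) ler_pXn2r ?nnegrE //; lra.
lra.
Qed.

Lemma lmax_sup : is_sup (lmax_set R m n) 1 /\ ~ lmax_set R m n 1.
Proof.
split; last by move=> /lmax_lt1; rewrite ltxx.
split=> [y /lmax_lt1/ltW//|z H].
apply: (@le_by_approx _ _ _ 1) => e e0 e1.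
have [W [s [V [d [nW sW eW _ [h _]]]]]] := concentrated e0 e1.
have : nth 0 s 0 <= z by apply: H; exists W, s.
lra.
Qed.

(** The largest eigenvalue lies strictly above the mean 1/N, so mixing in white noise lowers it. *)
Lemma lmax_inf : exists x, is_inf (lmax_set R m n) x /\ ~ lmax_set R m n x.
Proof.
have lt_N x : lmax_set R m n x -> 1 < x * (m * n)%:R.
  move=> /lmax_data[W [s [V [d [k [nW sW eW _ h]]]]]].
  have [s1 _ [l dl]] := eigen_sums nW eW.
  have : 0 < \sum_k (x - d k).
    rewrite (bigD1 l) //= ltr_pwDl ?sumr_ge0 // => [|i _]; last by rewrite subr_ge0.
    rewrite subr_gt0 (lt_le_trans dl) //.
    rewrite leNgt; apply/negP => x0; have : \sum_k d k <= 0.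
      by apply: sumr_le0 => i _; rewrite (le_trans (h i)) // ltW.
    by rewrite s1 => /(lt_le_trans ltr01); rewrite ltxx.
  by rewrite sumrB sumr_const card_ord s1 mulr_natr subr_gt0.
have [|y /lt_N h|x [xl xg]] := @is_inf_exists (lmax_set R m n) 0.
- have [W [s [V [d [nW sW eW _ _]]]]] := concentrated (e := 2^-1) ltac:(lra) ltac:(lra).
  by exists (nth 0 s 0), W, s.
- by rewrite -(pmulr_lge0 _ mn_gt0R) ltW // (lt_trans ltr01).
exists x; split=> // Sx; have xN := lt_N _ Sx.
have [W [s [V [d [k [nW sW eW _ h]]]]]] := lmax_data Sx.
have [tau [W' [t0 nW' eW']]] := ndew_noise nW eW.
have sW' := eigen_spectrum eW'; set s' := sort _ _ in sW'.
have : x <= nth 0 s' 0 by apply: xl; exists W', s'.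
have [k' <-] := spectrum_nth (i := 0%N) eW' sW' N0.
have N0R := mn_gt0R; set N : R := (m * n)%:R in N0R xN *.
have p0 : 0 < 1 + tau * N by rewrite addr_gt0 // mulr_gt0.
rewrite ler_pdivlMr // => h1; have h2 := h k'.
have : 0 < tau * (x * N - 1) by rewrite mulr_gt0 // subr_gt0.
lra.
Qed.

Lemma negativity_data x : negativity_set R m n x -> exists W s V d,
  [/\ normalized_NDEW W, spectrum W s, eigensystem W V d,
      x = - \sum_(k | d k < 0) d k & \sum_k `|d k| = 1 + 2 * x].
Proof.
move=> [W [s [nW sW ->]]]; have [V [d [eW _ _ _ _]]] := ndew_data mn nW.
have [_ _ tW] := nW; exists W, s, V, d; split=> //.
  exact: spectrum_negativity eW sW.
exact: spectrum_norm1 eW sW tW.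
Qed.

Lemma negativity_le x : negativity_set R m n x -> x <= (m%:R - 1) / 2.
Proof.
move=> /negativity_data[W [s [V [d [nW sW eW _ e]]]]].
have [bW _] := normalized_ndw nW; have [_ _ tW] := nW.
have := tr_norm_bound bW tW eW; rewrite e; lra.
Qed.

Lemma neg_part_ge (d : 'I_(m * n) -> R) k : d k < 0 -> - d k <= - \sum_(k | d k < 0) d k.
Proof.
move=> dk; rewrite lerN2 (bigD1 k) //= gerDl.
by apply: sumr_le0 => i /andP[/ltW].
Qed.

Lemma negativity_gt0 x : negativity_set R m n x -> 0 < x.
Proof.
move=> /negativity_data[W [s [V [d [nW sW eW -> _]]]]].
have [_ _ [k dk]] := eigen_sums nW eW.
by apply: lt_le_trans (neg_part_ge dk); rewrite oppr_gt0.
Qed.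

Lemma negativity_inf : is_inf (negativity_set R m n) 0 /\ ~ negativity_set R m n 0.
Proof.
split; last by move=> /negativity_gt0; rewrite ltxx.
split=> [y /negativity_gt0/ltW//|z H].
(* There are at most mn negative eigenvalues, each at least -e. *)
apply: (@le_by_approx _ _ _ (m * n)%:R) => e e0 e1.
have [W [s [V [d [nW sW eW h _]]]]] := concentrated e0 e1.
have : z <= negativity s by apply: H; exists W, s.
rewrite (spectrum_negativity eW sW) => /le_trans; apply; rewrite add0r -sumrN.
apply: (@le_trans _ _ (\sum_(k < m * n) e)); last by rewrite sumr_const card_ord mulr_natl.
rewrite big_mkcond; apply: ler_sum => k _; case: ifP => _; last exact: ltW.
by rewrite lerNl.
Qed.

(** For m = 2 the bound is 1/2, and a single eigenvalue near -1/2 already reaches it: an upper bound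
    z of the negativity makes -z a lower bound of the smallest eigenvalues. *)
Lemma negativity_sup_two : m = 2 -> is_sup (negativity_set R m n) ((m%:R - 1) / 2).
Proof.
move=> em; split=> [y|z H]; first exact: negativity_le.
suff : - z <= - (1 / 2) by rewrite em; lra.
apply: lmin_inf_lower => y Sy; have yn := lmin_neg Sy.
have [W [s [V [d [k [nW sW eW ey _]]]]]] := lmin_data Sy.
have h : negativity s <= z by apply: H; exists W, s.
have : - d k <= negativity s.
  by rewrite (spectrum_negativity eW sW); apply: neg_part_ge; rewrite -ey.
rewrite -ey; lra.
Qed.

End Bounds.

(** * Negativity in equal dimensions *)

Section Square.
Variables (R : realType) (n : nat).
Hypothesis n3 : (3 <= n)%N.
Local Notation C := R[i].
Local Notation ix := (@mxvec_index n n).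
Local Notation "x %:C" := (real_complex R x).

(** [G] is the swap operator up to phases: Hermitian, unitary, of trace n. The perturbed witness is
    tested against the unitary [G] itself, and tr G^2 / tr G = n. *)
Lemma negativity_sup_square : is_sup (negativity_set R n n) ((n%:R - 1) / 2).
Proof.
split=> [y|z H]; first exact: negativity_le.
have [K [l [f [dl bK lK fn lu]]]] := full_rank_kit R n3.
set G := ptrans _ in lu.
have GE i k j q : G (ix i k) (ix j q) =
    (if (j == k) && (i == q) then f j * (f i)^* else 0).
  rewrite /G ptransE mxE /diagonal_vec !idxE /=.
  by case: (j == k); case: (i == q); rewrite /= ?conjC0 ?mulr0 ?mul0r.
have fn' i : (f i)^* * f i = 1 by rewrite mulrC.
have uG : G \is unitarymx.
  have tE (M : 'M[C]_(n * n)) p q : (M^t*)%sesqui p q = (M q p)^* by rewrite !mxE.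
  apply/unitarymxP; apply: matrix_ixP => i k j q; rewrite [LHS]mxE [RHS]mxE sum_ix ix_inj.
  rewrite (bigD1 k) //= (bigD1 i) //= tE !GE !eqxx /=.
  rewrite big1 => [|b bi]; last by rewrite GE [i == b]eq_sym (negbTE bi) andbF mul0r.
  rewrite big1 => [|a ak]; last by apply: big1 => b _; rewrite GE (negbTE ak) mul0r.
  rewrite !addr0; case: (k == q); last first.
    by rewrite andbF conjC0 mulr0.
  rewrite andbT [j == i]eq_sym; case: eqP => [->|_]; last by rewrite conjC0 mulr0.
  by rewrite rmorphM /= conjCK mulrACA fn fn' mulr1.
have trG : \tr G = n%:R.
  rewrite /mxtrace sum_ix; under eq_bigr do under eq_bigr do rewrite GE.
  rewrite -[in RHS](card_ord n) -sumr_const; apply: eq_bigr => i _.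
  rewrite (bigD1 i) //= eqxx fn big1 ?addr0 // => k ki.
  by rewrite eq_sym (negbTE ki).
have hG p q : (G q p)^* = G p q by rewrite /G; apply: herm_ptrans; apply: herm_outer.
have tGG : \tr (G *m G) = (n * n)%:R.
  rewrite -[in RHS](card_ord (n * n)) -sumr_const; apply: eq_bigr => p _.
  have := unitary_rowE p p uG; rewrite eqxx => e; rewrite -[RHS]e mxE.
  by apply: eq_bigr => q _; rewrite hG.
pose c := complex.Re (\tr (K *m G)); pose kap := complex.Re (\tr K).
have K0 : 0 <= \tr K by apply: sumr_ge0 => p _; exact: diagp_ge0.
have ek : \tr K = kap%:C by rewrite RRe_real // ger0_real.
have kap0 : 0 <= kap by rewrite -ler0c -ek.
have n0 : 0 < n%:R :> R by rewrite ltr0n (leq_trans _ n3).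
suff : n%:R * n%:R <= (1 + 2 * z) * n%:R by rewrite ler_pM2r //; lra.
(* The terms of order e in n^2 + e c <= (1 + 2 z) (n + e kap). *)
apply: (@le_by_approx _ _ _ ((1 + 2 * z) * kap - c)) => e e0 e1.
have nW := perturbed_ndw dl bK lK lu e0; rewrite -/G in nW.
have tW : \tr (G + e%:C *: K) = (n%:R + e * kap)%:C.
  by rewrite mxtraceD mxtraceZ trG ek rmorphD rmorphM /= rmorph_nat.
have nW' := ndw_normalize nW; set W := _ *: _ in nW'.
have [V [d [eW _ _ _ _]]] := ndew_data (leqnn n) nW'.
have sW := eigen_spectrum eW; set s := sort _ _ in sW.
have zs : negativity s <= z by apply: H; exists W, s.
have [_ _ tW'] := nW'.
have t0 : 0 < n%:R + e * kap by rewrite ltr_pwDl // mulr_ge0 // ltW.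
have := eigen_unitary_trace eW uG; rewrite (spectrum_norm1 eW sW tW') => h.
have : ((1 + 2 * negativity s) * (n%:R + e * kap)) >= n%:R * n%:R + e * c.
  have tC : (0 : C) < (n%:R + e * kap)%:C by rewrite -(rmorph0 (real_complex R)) ltcR.
  have : `|\tr ((G + e%:C *: K) *m G)| <= ((1 + 2 * negativity s) * (n%:R + e * kap))%:C.
    move: h; rewrite /W -scalemxAl mxtraceZ normrM tW normfV (gtr0_norm tC).
    by rewrite ler_pdivrMl // mulrC rmorphM.
  move=> h2; have := normc_ge_Re (\tr ((G + e%:C *: K) *m G)) => h3.
  have := le_trans h3 h2; rewrite lecR => /(le_trans (ler_norm _)).
  rewrite mulmxDl mxtraceD tGG -scalemxAl mxtraceZ natrM.
  have -> : complex.Re (n%:R * n%:R + e%:C * \tr (K *m G)) = n%:R * n%:R + e * c.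
    rewrite -!(rmorph_nat (real_complex R)) -rmorphM /c; case: (\tr _) => a b /=.
    by rewrite mul0r subr0.
  by [].
have : (1 + 2 * negativity s) * (n%:R + e * kap) <= (1 + 2 * z) * (n%:R + e * kap).
  by rewrite ler_pM2r //; lra.
lra.
Qed.

Lemma negativity_square_not_attained : ~ negativity_set R n n ((n%:R - 1) / 2).
Proof.
move=> /(negativity_data (leqnn n))[W [s [V [d [nW sW eW _ e]]]]].
have [bW nd] := normalized_ndw nW; have [_ _ tW] := nW; apply: nd.
apply: (max_norm1_decomposable _ bW tW eW); first by rewrite (leq_trans _ n3).
by rewrite e; field.
Qed.

End Square.

(** For m = 1 every vector is a product vector, so a block-positive matrix is positive semidefinite
    and there are no witnesses; the range of m therefore starts at 2. *)
Theorem theorem2 (R : realType) (m n : nat) :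
  (2 <= m)%N -> (m <= n)%N -> (6 < m * n)%N ->
  (* (i) *) is_sup (trsq_set R m n) 1 /\
      (* (ii) *) (exists x, is_inf (trsq_set R m n) x /\ ~ trsq_set R m n x) /\
      (* (iii) *) (is_sup (lmin_set R m n) 0 /\ ~ lmin_set R m n 0) /\
      (* (iv) *) (is_inf (lmin_set R m n) (- (1 / 2)) /\ ~ lmin_set R m n (- (1 / 2))) /\
      (* (v) *) (is_sup (lmax_set R m n) 1 /\ ~ lmax_set R m n 1) /\
      (* (vi) *) (exists x, is_inf (lmax_set R m n) x /\ ~ lmax_set R m n x) /\
      (* (vii) *) (m = 2 \/ (m = n /\ (3 <= m)%N) ->
                   is_sup (negativity_set R m n) ((m%:R - 1) / 2)) /\
      (* (viii) *) (m = 3 -> n = 3 ->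
                    exists x, is_sup (negativity_set R m n) x /\ ~ negativity_set R m n x)
    /\ (* (ix) *) (is_inf (negativity_set R m n) 0 /\ ~ negativity_set R m n 0).
Proof.
move=> m2 mn N6; split; first exact: trsq_sup.
split; first exact: trsq_inf.
split; first exact: lmin_sup.
split; first exact: lmin_inf.
split; first exact: lmax_sup.
split; first exact: lmax_inf.
split.
  move=> [em|[en m3]]; first exact: negativity_sup_two.
  by subst n; exact: negativity_sup_square.
split; last exact: negativity_inf.
move=> em en; subst m n; exists ((3%:R - 1) / 2).
by split; [exact: negativity_sup_square|exact: negativity_square_not_attained].
Qed.
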